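(* Let $t>0$, and let $q_0:\mathbb{Z}\to\mathbb{D}$ be a sequence with finite support contained in $\mathbb{Z}_+$. Assume that $\prod_{n\in\mathbb{Z}_+}(1-|q_0(n)|^2)\ge\eta$ for some $\eta>0$. Let $q$ be the solution of the Ablowitz–Ladik equation with initial datum $q_0$, and let $\tilde q_n(t,j)$ be the approximation defined in the context by Schur's algorithm. Then $$|q(t,j)-\tilde q_n(t,j)|\le 2^{j}\,C(\eta,1/2)\,\frac{12e^{5t}}{\sqrt{2\pi n}}\left(\frac{2et}{n}\right)^{n}$$ for all $n\in\mathbb{Z}_+$, $j\in\mathbb{Z}$ such that $n+j\ge0$, $n>t$ and $\delta_{n,t}<1$.
   Context: $\mathbb{D}$, $\mathbb{T}$ are the open unit disk and unit circle, $\mathbb{Z}_+=\{0,1,2,\dots\}$, $m$ is normalized Lebesgue measure on $\mathbb{T}$. Ablowitz–Ladik equation with initial datum $q_0:\mathbb{Z}\to\mathbb{D}$: $\frac{\partial}{\partial t}q(t,n)=i(1-|q(t,n)|^2)(q(t,n-1)+q(t,n+1))$, $q(0,n)=q_0(n)$, $n\in\mathbb{Z}$; it has a unique global classical solution. Constant: $C(\eta,r)=\exp\left(\log\eta^{-1}\left(2+\frac{1}{1-\sqrt{1-\eta}}\right)\left(\frac{4}{(1-r)^2}+1\right)\right)$. Multipliers: let $J_k(2t)=i^{-k}\int_{\mathbb{T}}e^{it(z+1/z)}\bar z^{k}\,dm$ (Bessel functions), so that $e^{it(z+1/z)}=\sum_{k\in\mathbb{Z}}i^kJ_k(2t)z^k$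 on $\mathbb{T}$. Put $P_{n,t}=\sum_{|k|\le n}i^kJ_k(2t)z^k$, $\delta_{n,t}=\frac{t^ne^t}{n!}$, $G_{n,t}=(1-\delta_{n,t})z^nP_{n,t}$ (a polynomial in $z$). Coefficients: for $q_0$ supported on $[0,\ell]\cap\mathbb{Z}$, define $a,b$ on $\mathbb{T}$ by $$\begin{pmatrix}a&b\\ \overline b&\overline a\end{pmatrix}=\prod_{k\in\mathbb{Z}}\frac{1}{\sqrt{1-|q_0(k)|^2}}\begin{pmatrix}1&\overline{q_0(k)}z^{-k}\\ q_0(k)z^k&1\end{pmatrix},\qquad z\in\mathbb{T},$$ factors being ordered from left to right by increasing $k$. The functions $a$ and $\overline b$ coincide on $\mathbb{T}$ with polynomials in $z$ of degree at most $\ell$, with $|\overline b|<|a|$ on $\{|z|\le1\}$ for these polynomials; $\mathfrak{f}_{q_0}=\overline b/a$ denotes the corresponding rational function. Schur's algorithm: for a function $F$ analytic in $\mathbb{D}$ with $\sup_{\mathbb{D}}|F|\le1$ that is not a finite Blaschke product, its Schur iterates are $F_0=F$, $zF_{k+1}=\frac{F_k-F_k(0)}{1-\overline{F_k(0)}F_k}$, $k\ge0$. Under the conditions $n>t>0$, $\delta_{n,t}<1$, the function $F_{n,0}=G_{n,t}\mathfrak{f}_{q_0}$ is of this type; let $F_{n,k}$, $k\ge0$, be its Schur iterates. Define $\tilde q_n(t,j)=F_{n,n+j}(0)$ for $j\ge-n$ and $\tilde q_n(t,j)=0$ for $j<-n$. *)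

(* Defs.v *)
From HB Require Import structures.
From mathcomp Require Import all_boot all_order all_algebra.
From mathcomp Require Import complex.
From mathcomp Require Import all_classical all_reals all_analysis.

Set Implicit Arguments.
Unset Strict Implicit.
Unset Printing Implicit Defensive.

Import Order.TTheory GRing.Theory Num.Theory.
Import numFieldNormedType.Exports.
Export Normc.

Local Open Scope classical_set_scope.
Local Open Scope complex_scope.
Local Open Scope ring_scope.

Section AblowitzLadik.
Variable R : realType.
Local Notation C := R[i].

Definition AL_rhs (q : R -> int -> C) (t : R) (n : int) : C :=
  'i * (1 - normc (q t n) ^+ 2)%:C * (q t (n - 1) + q t (n + 1)).

(* Solutions are only required to live on [0, +oo[ (differentiable for t > 0,
   continuous up to t = 0); solutions defined for all real times are covered.
   Since R[i] carries no normed R-module structure in the library, continuity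
   and differentiability in t are expressed on real and imaginary parts. *)
Definition AL_solution (q0 : int -> C) (q : R -> int -> C) : Prop :=
  [/\ forall n, q 0 n = q0 n,
      forall n, {within `[0, +oo[, continuous (fun t : R => complex.Re (q t n))} /\
                {within `[0, +oo[, continuous (fun t : R => complex.Im (q t n))}
    & forall (t : R) (n : int), 0 < t ->
        is_derive t (1 : R) (fun s => complex.Re (q s n)) (complex.Re (AL_rhs q t n)) /\
        is_derive t (1 : R) (fun s => complex.Im (q s n)) (complex.Im (AL_rhs q t n))].

Definition stabC (eta r : R) : R :=
  expR (ln eta^-1 * (2 + (1 - Num.sqrt (1 - eta))^-1) *
        (4 / (1 - r) ^+ 2 + 1)).

Definition cexp (z : C) : C :=
  (expR (complex.Re z))%:C * (cos (complex.Im z) +i* sin (complex.Im z)).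

(* integral against normalized Lebesgue measure on the unit circle *)
Definition circle_integral (f : C -> C) : C :=
  let I (g : R -> R) :=
    (2 * pi)^-1 * \int[lebesgue_measure]_(x in `[0, 2 * pi]) g x in
  I (fun x => complex.Re (f (cexp (x *i)))) +i*
  I (fun x => complex.Im (f (cexp (x *i)))).

Definition besselJ (k : int) (x : R) : C :=
  'i ^ (- k) *
  circle_integral (fun z => cexp ('i * (x / 2)%:C * (z + z^-1)) * z^* ^ k).

Definition delta (n : nat) (t : R) : R := t ^+ n * expR t / n`!%:R.

(* (1 - delta_{n,t}) z^n P_{n,t}, with P_{n,t} = \sum_(|k| <= n) i^k J_k(2t) z^k;
   the coefficient of z^m is the one with k = m - n *)
Definition Gpoly (n : nat) (t : R) : {poly C} :=
  (1 - delta n t)%:C *: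
  \poly_(m < n.*2.+1) ('i ^ (m%:Z - n%:Z) * besselJ (m%:Z - n%:Z) (2 * t)).

Definition transfer_factor (w : C) (k : int) (z : C) : 'M[C]_2 :=
  (Num.sqrt (1 - normc w ^+ 2))^-1%:C *:
  \matrix_(i, j)
    (if i == 0 then (if j == 0 then 1 else w^* * z ^ (- k))
     else (if j == 0 then w * z ^ k else 1)).

(* For q0 supported on [0, l] the product over all integers reduces to this
   one, the other factors being the identity; the library's \prod multiplies
   the factors from left to right by increasing k. *)
Definition transfer_matrix (q0 : int -> C) (l : nat) (z : C) : 'M[C]_2 :=
  \prod_(0 <= k < l.+1) transfer_factor (q0 k%:Z) k%:Z z.

Definition coef_a (q0 : int -> C) (l : nat) (z : C) : C :=
  transfer_matrix q0 l z 0 0.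

Definition coef_b (q0 : int -> C) (l : nat) (z : C) : C :=
  transfer_matrix q0 l z 0 1.

(* the (unique, if any) polynomial coinciding with g on the unit circle *)
Definition circle_poly (g : C -> C) : {poly C} :=
  xget 0 [set p : {poly C} | forall z, normc z = 1 -> p.[z] = g z].

(* conj(b) / a, with a and conj(b) being continued from the circle as polynomials *)
Definition scatt_f (q0 : int -> C) (l : nat) (z : C) : C :=
  (circle_poly (fun w => (coef_b q0 l w)^*)).[z] /
  (circle_poly (coef_a q0 l)).[z].

(* One step of Schur's algorithm; the value at 0 fills in the removable
   singularity of the quotient. *)
Definition schur_quot (F : C -> C) (z : C) : C :=
  (F z - F 0) / (1 - (F 0)^* * F z) / z.

Definition schur_step (F : C -> C) (z : C) : C :=
  if z == 0 then lim ((schur_quot F w : C^o) @[w --> (0 : C^o)^'])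
  else schur_quot F z.

Definition schur_iter (F : C -> C) (k : nat) : C -> C := iter k schur_step F.

Definition qtilde (q0 : int -> C) (l n : nat) (t : R) (j : int) : C :=
  if 0 <= n%:Z + j then
    schur_iter (fun z => (Gpoly n t).[z] * scatt_f q0 l z) (absz (n%:Z + j)) 0
  else 0.

End AblowitzLadik.

(* Main.v *)
Require Import Defs.
From mathcomp Require Import all_boot all_order all_algebra.
From mathcomp Require Import complex.
From mathcomp Require Import all_classical all_reals all_analysis.
From mathcomp Require Import cyclic separable cyclotomic.
From mathcomp Require Import ring lra zify.

Set Implicit Arguments.
Unset Strict Implicit.
Unset Printing Implicit Defensive.

Import Order.TTheory GRing.Theory Num.Theory.
Import numFieldNormedType.Exports.

Local Open Scope classical_set_scope.
Local Open Scope complex_scope.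
Local Open Scope ring_scope.
Arguments normc {R} x : simpl never.

(** Why the estimate holds. Write [T] for the unit circle, [f = P/Q] for a
    contractive function in the disk represented by two polynomials, and
    [a_0, a_1, ...] for its Schur parameters.

    Stability of Schur's algorithm. If [f] and [g] are contractive with
    [prod (1 - |a_k|^2) >= eta] for both, and [|f - g| <= D] on [T], then
    [|a_k(f) - a_k(g)| <= 2^k C(eta, 1/2) D] ([schur_stability]). Measure the
    difference [h_k = f_k - g_k] of the iterates in the Hardy norm on the
    circle of radius [1/2]. A Schur step subtracts the mean [h_k(0)], which does
    not increase this norm, divides by [z], which costs the factor [2], and
    multiplies by [1 + O(|a_k| |f_k| + |g_k| |g_{k+1}| + |a_k| |g_{k+1}|)],
    where [|f_k|] is the norm of [f_k] as a multiplier on that disk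
    ([schur_step_stable]). Since [f_k = a_k + O(z f_{k+1})], these norms are
    square summable along with the [a_k], with sum [O(log (1/eta))]
    ([multiplier_sum]), so the product of all factors is bounded.

    All of this is done with polynomials. Power series are taken modulo ['X^L],
    so that Hardy norms are finite sums of squares, integrals over [T] become
    averages over roots of unity ([parseval]), and analyticity of [P/Q] is
    expressed by approximating [1/Q] by polynomials on [T] ([outer]). This
    property survives the algorithm ([outer_add]) and yields von Neumann's
    inequality ([outer_wnorm]) and the minimum principle ([outer_min]); the
    latter transfers [eta] from the function to its parameters
    ([schur_param_prod]).

    The flow. Fix [z] in [T]. For the product of the transfer matrices of
    [q(t)] over a window starting at [-n], the Lax pair turns the
    Ablowitz-Ladik equation into a Riccati equation [r' = i (z + 1/z) r + ...]
    for the ratio [r] of the entries of the first column, the remaining terms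
    being values of [q] at the two ends of the window ([lax_ratio]). The datum
    vanishes to the left of [0], and information spreads along the lattice like
    [t^n/n!] ([lattice_propagation]); hence, up to [O(e^{2t} t^n/n!)], the
    function with Schur parameters [q(t,-n), q(t,-n+1), ...] equals
    [z^n e^{it(z+1/z)} f_{q_0}] on [T] ([window_approx]). The product of the
    [1 - |q(t,k)|^2] over the lattice is conserved, so it stays at least [eta]
    ([sol_defect]).

    The symbol. The Fourier coefficients [c_k] of [e^{it(z+1/z)}] satisfy
    [c_k' = i (c_{k-1} + c_{k+1})] and [k c_k = it (c_{k-1} - c_{k+1})], whence
    [|c_k| <= t^|k|/|k|!] ([fourier_bound]). The truncated series solves the
    equation of the exponential up to its end coefficients, so that it is within
    [delta_{n,t}] of it ([fourier_sum_approx], [fourier_tail_delta]); this gives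
    both [|G_{n,t}| <= 1] and [|G_{n,t} - z^n e^{it(z+1/z)}| <= 2 delta_{n,t}].

    Therefore the functions with parameters [q(t, j)] and [q~_n(t, j)] differ by
    at most [(17/2) e^{2t} t^n/n!] on [T] ([symbol_window]). Stability at step
    [n + j] and half of Stirling's formula ([power_fact_le]) conclude. *)

(** * Moduli of complex numbers *)

Section Modulus.
Variable R : realType.
Local Notation C := R[i].
Implicit Types (x y z : C) (a b : R).

Lemma normc_normr z : `|z| = (normc z)%:C. Proof. by []. Qed.

Lemma normc_ge0 z : 0 <= normc z.
Proof. by case: z => a b; apply: sqrtr_ge0. Qed.

Lemma sqr_normcE z : normc z ^+ 2 = complex.Re z ^+ 2 + complex.Im z ^+ 2.
Proof. by case: z => a b; rewrite /normc sqr_sqrtr // addr_ge0 ?sqr_ge0. Qed.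

Lemma Re_conj z : complex.Re z^* = complex.Re z. Proof. by case: z. Qed.
Lemma Im_conj z : complex.Im z^* = - complex.Im z. Proof. by case: z. Qed.

Lemma normc_conj z : normc z^* = normc z.
Proof. by apply: complexI; rewrite -!normc_normr norm_conjC. Qed.

Lemma normcD x y : normc (x + y) <= normc x + normc y.
Proof. exact: le_normcD. Qed.

Lemma normc_opp x : normc (- x) = normc x.
Proof. by apply: complexI; rewrite -!normc_normr normrN. Qed.

Lemma normcB x y : normc (x - y) <= normc x + normc y.
Proof. by rewrite -[normc y]normc_opp normcD. Qed.

Lemma normc_distC x y : normc (x - y) = normc (y - x).
Proof. by rewrite -normc_opp opprB. Qed.

Lemma normcX z n : normc (z ^+ n) = normc z ^+ n.
Proof. by elim: n => [|n IH]; rewrite ?normc1 // !exprS normcM IH. Qed.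

Lemma normc_real a : normc a%:C = `|a|.
Proof. by rewrite /normc /= expr0n addr0 sqrtr_sqr. Qed.

Lemma normc_eq0 z : (normc z == 0) = (z == 0).
Proof. by apply/eqP/eqP => [/eq0_normc //|->]; rewrite normc0. Qed.

Lemma normc_gt0 z : (0 < normc z) = (z != 0).
Proof. by rewrite lt_neqAle normc_ge0 andbT eq_sym normc_eq0. Qed.

Lemma normc_sum (I : Type) (r : seq I) (P : pred I) (F : I -> C) :
  normc (\sum_(i <- r | P i) F i) <= \sum_(i <- r | P i) normc (F i).
Proof.
elim/big_rec2: _ => [|i a z _ IH]; first by rewrite normc0.
by rewrite (le_trans (normcD _ _)) // lerD2l.
Qed.

Lemma mulcJ z : z * z^* = (normc z ^+ 2)%:C.
Proof. by rewrite rmorphXn /= -normc_normr normCK. Qed.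

Lemma normc_i : normc ('i : C) = 1.
Proof. by rewrite /normc /= expr0n expr1n add0r sqrtr1. Qed.

Lemma Re_le_normc z : complex.Re z <= normc z.
Proof.
case: (lerP (complex.Re z) 0) => [h|/ltW h].
  exact: le_trans h (normc_ge0 z).
rewrite -(@ler_pXn2r _ 2) ?nnegrE ?normc_ge0 //.
by rewrite sqr_normcE lerDl sqr_ge0.
Qed.

Lemma conjc_inv_unit z : normc z = 1 -> z^* = z^-1.
Proof.
move=> z1; have z0 : z != 0 by rewrite -normc_gt0 z1.
by apply: (mulfI z0); rewrite mulcJ z1 expr1n divff.
Qed.

Lemma le_of_sqr a b : 0 <= a -> 0 <= b -> a ^+ 2 <= b ^+ 2 -> a <= b.
Proof. by move=> a0 b0; rewrite ler_pXn2r ?nnegrE. Qed.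

End Modulus.

(** * Parseval's identity for polynomials *)

Section Parseval.
Variable R : realType.
Local Notation C := R[i].
Implicit Types (p q : {poly C}).

Lemma prim_root_exists n : (n > 0)%N -> exists z : C, n.-primitive_root z.
Proof.
move=> n_gt0; pose p : {poly C} := 'X^n - 1.
have [r Dp] := closed_field_poly_normal p.
rewrite (monicP _) ?monicXnsubC // scale1r in Dp.
have rn1 : all n.-unity_root r.
  by apply/allP => z; rewrite -root_prod_XsubC -Dp.
have sz_r : (n < (size r).+1)%N.
  by rewrite -(size_prod_XsubC r id) -Dp size_XnsubC.
have [|z] := hasP (has_prim_root n_gt0 rn1 _ sz_r); last by exists z.
by rewrite -separable_prod_XsubC -Dp separable_Xn_sub_1 // pnatr_eq0 -lt0n.
Qed.

Lemma sum_unity_root n (x : C) : x ^+ n = 1 ->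
  \sum_(j < n) x ^+ j = if x == 1 then n%:R else 0.
Proof.
move=> xn; case: eqP => [->|/eqP x1].
  by under eq_bigr do rewrite expr1n; rewrite sumr_const card_ord.
have := subrX1 x n; rewrite xn subrr => /esym/eqP.
by rewrite mulf_eq0 subr_eq0 (negPf x1) => /eqP.
Qed.

Lemma unity_root_normc n (w : C) : (0 < n)%N -> w ^+ n = 1 -> normc w = 1.
Proof.
move=> n0 wn; apply/eqP; rewrite -(@pexpr_eq1 _ _ n) ?normc_ge0 //.
by rewrite -normcX wn normc1.
Qed.

(** Averaging over the [n]-th roots of unity instead of integrating over the
    circle keeps the identity finite; it is exact as soon as [n] bounds the
    number of coefficients. *)
Lemma parseval n (w : C) p : n.-primitive_root w -> (size p <= n)%N ->
  \sum_(j < n) normc p.[w ^+ j] ^+ 2 = n%:R * \sum_(m < n) normc p`_m ^+ 2.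
Proof.
move=> prw szp; have n0 := prim_order_gt0 prw.
have w1 : normc w = 1 by apply: unity_root_normc n0 (prim_expr_order prw).
have wu : w != 0 by rewrite -normc_gt0 w1.
have wJ : w^* = w^-1 by exact: conjc_inv_unit.
apply: complexI; rewrite rmorphM !rmorph_sum rmorph_nat /=.
under eq_bigr => j _.
  rewrite -mulcJ (horner_coef_wide _ szp) rmorph_sum mulr_suml.
  under eq_bigr => m _ do rewrite mulr_sumr.
  over.
rewrite exchange_big /= mulr_sumr; apply: eq_bigr => m _.
rewrite exchange_big /= (bigD1 m) //= [X in _ + X]big1 => [|l lm].
  rewrite addr0 -mulcJ mulr_natl.
  transitivity (\sum_(j < n) p`_m * (p`_m)^*); last by rewrite sumr_const card_ord.
  apply: eq_bigr => j _.
  rewrite !rmorphM !rmorphXn /= wJ !exprVn.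
  by field; rewrite expf_neq0 // expf_neq0.
transitivity (p`_m * (p`_l)^* * \sum_(j < n) (w ^+ m / w ^+ l) ^+ j).
  rewrite mulr_sumr; apply: eq_bigr => j _.
  rewrite !rmorphM !rmorphXn /= wJ exprMn -!exprM [(m * _)%N]mulnC !exprVn -exprM.
  by rewrite [(l * _)%N]mulnC; ring.
rewrite sum_unity_root; last first.
  by rewrite exprMn exprVn -!exprM -!(mulnC n) !exprM (prim_expr_order prw) !expr1n divr1.
case: eqP => [/divr1_eq h|]; last by rewrite mulr0.
case/negP: lm; rewrite eq_sym -val_eqE /=.
by move/eqP: h; rewrite (eq_prim_root_expr prw) !modn_small.
Qed.

End Parseval.

(** * Weighted square norms of truncated power series *)

Section TruncatedNorm.
Variable R : realType.
Local Notation C := R[i].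
Implicit Types (p q y : {poly C}) (rho : R) (L : nat).

Definition sqnorm rho L p : R := \sum_(m < L) rho ^+ m * normc p`_m ^+ 2.

(** The norm of [p] modulo ['X^L] in the Hardy space of the disk of radius
    [sqrt rho]. *)
Definition wnorm rho L p : R := Num.sqrt (sqnorm rho L p).

Lemma sqnorm_ge0 rho L p : 0 <= rho -> 0 <= sqnorm rho L p.
Proof.
by move=> r0; apply: sumr_ge0 => m _; rewrite mulr_ge0 ?sqr_ge0 ?exprn_ge0.
Qed.

Lemma wnorm_ge0 rho L p : 0 <= wnorm rho L p. Proof. by rewrite /wnorm sqrtr_ge0. Qed.

Lemma sqr_wnorm rho L p : 0 <= rho -> wnorm rho L p ^+ 2 = sqnorm rho L p.
Proof. by move=> r0; rewrite sqr_sqrtr ?sqnorm_ge0. Qed.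

Lemma wnorm_le rho L p c : 0 <= rho -> 0 <= c ->
  (wnorm rho L p <= c) = (sqnorm rho L p <= c ^+ 2).
Proof.
move=> r0 c0; rewrite -(sqr_wnorm _ _ r0).
by rewrite ler_pXn2r ?nnegrE ?wnorm_ge0.
Qed.

Lemma eq_wnorm rho L p q : (forall m, (m < L)%N -> p`_m = q`_m) ->
  wnorm rho L p = wnorm rho L q.
Proof.
by move=> pq; congr Num.sqrt; apply: eq_bigr => m _; rewrite pq.
Qed.

Lemma cauchy_schwarz_sum n (w a b : 'I_n -> R) :
    (forall i, 0 <= w i) -> (forall i, 0 <= a i) -> (forall i, 0 <= b i) ->
  \sum_i w i * (a i * b i) <=
    Num.sqrt (\sum_i w i * a i ^+ 2) * Num.sqrt (\sum_i w i * b i ^+ 2).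
Proof.
move=> w0 a0 b0; set A := Num.sqrt _; set B := Num.sqrt _.
have sA : \sum_i w i * a i ^+ 2 = A ^+ 2.
  by rewrite sqr_sqrtr // sumr_ge0 // => i _; rewrite mulr_ge0 ?sqr_ge0.
have sB : \sum_i w i * b i ^+ 2 = B ^+ 2.
  by rewrite sqr_sqrtr // sumr_ge0 // => i _; rewrite mulr_ge0 ?sqr_ge0.
have A0 : 0 <= A by exact: sqrtr_ge0.
have B0 : 0 <= B by exact: sqrtr_ge0.
(* The general argument divides by [A * B]. *)
have vanish (u v : 'I_n -> R) : (forall i, 0 <= u i) ->
    \sum_i w i * u i ^+ 2 = 0 -> \sum_i w i * (u i * v i) = 0.
  move=> u0 /psumr_eq0P h; apply: big1 => i _.
  have /eqP := h (fun i _ => mulr_ge0 (w0 i) (sqr_ge0 (u i))) i isT.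
  by rewrite mulf_eq0 sqrf_eq0 => /orP[]/eqP->; rewrite ?mul0r ?mulr0.
case: (eqVneq A 0) => [A00|An].
  by rewrite (vanish _ b a0) ?A00 ?mul0r // sA A00 expr0n.
case: (eqVneq B 0) => [B00|Bn].
  under eq_bigr do rewrite [a _ * _]mulrC.
  by rewrite (vanish _ a b0) ?B00 ?mulr0 // sB B00 expr0n.
have AB : 0 < A * B *+ 2.
  by rewrite pmulrn_rgt0 // mulr_gt0 // lt_neqAle eq_sym ?An ?Bn.
rewrite -(ler_pM2l AB).
have -> : A * B *+ 2 * (A * B) = B ^+ 2 * A ^+ 2 + A ^+ 2 * B ^+ 2 by ring.
rewrite -[X in _ * X + _]sA -[X in _ + _ * X]sB !mulr_sumr -big_split /=.
apply: ler_sum => i _.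
have : 0 <= w i * (B * a i - A * b i) ^+ 2 by rewrite mulr_ge0 ?sqr_ge0.
by rewrite -subr_ge0; congr (_ <= _); ring.
Qed.

Lemma wnormD rho L p q : 0 <= rho ->
  wnorm rho L (p + q) <= wnorm rho L p + wnorm rho L q.
Proof.
move=> r0; rewrite wnorm_le // ?addr_ge0 ?wnorm_ge0 //.
rewrite sqrrD !sqr_wnorm //.
apply: (@le_trans _ _ (sqnorm rho L p +
    (\sum_(m < L) rho ^+ m * (normc p`_m * normc q`_m)) *+ 2 +
    sqnorm rho L q)).
  rewrite /sqnorm -sumrMnl -!big_split /=; apply: ler_sum => m _.
  rewrite coefD -mulrnAr -!mulrDr ler_wpM2l ?exprn_ge0 // -sqrrD.
  by rewrite ler_pXn2r ?nnegrE ?normc_ge0 ?addr_ge0 ?normc_ge0 ?normcD.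
rewrite lerD2r lerD2l lerMn2r /= /wnorm /sqnorm.
apply: (@cauchy_schwarz_sum L (fun m => rho ^+ m) (fun m => normc p`_m)
  (fun m => normc q`_m)) => i; rewrite ?normc_ge0 ?exprn_ge0 //.
Qed.

Lemma wnormZ rho L (c : C) p : wnorm rho L (c *: p) = normc c * wnorm rho L p.
Proof.
rewrite -[normc c]ger0_norm ?normc_ge0 // -sqrtr_sqr -sqrtrM ?sqr_ge0 //.
congr Num.sqrt; rewrite mulr_sumr; apply: eq_bigr => m _.
by rewrite coefZ normcM exprMn mulrCA.
Qed.

Lemma wnormN rho L p : wnorm rho L (- p) = wnorm rho L p.
Proof. by rewrite -scaleN1r wnormZ normc_opp normc1 mul1r. Qed.

Lemma wnorm_mono rho L L' p : 0 <= rho -> (L <= L')%N ->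
  wnorm rho L p <= wnorm rho L' p.
Proof.
move=> r0 LL; rewrite wnorm_le ?wnorm_ge0 // sqr_wnorm //.
rewrite /sqnorm -!(big_mkord xpredT (fun m => rho ^+ m * normc p`_m ^+ 2)).
rewrite [leRHS](big_cat_nat (leq0n L) LL) //= lerDl sumr_ge0 // => m _.
by rewrite mulr_ge0 ?sqr_ge0 ?exprn_ge0.
Qed.

Lemma wnormXM rho L p : 0 <= rho ->
  wnorm rho L.+1 ('X * p) = Num.sqrt rho * wnorm rho L p.
Proof.
move=> r0; rewrite -sqrtrM //; congr Num.sqrt.
rewrite /sqnorm big_ord_recl coefXM /= normc0 expr0n mulr0 add0r mulr_sumr.
by apply: eq_bigr => m _; rewrite coefXM /= /bump leq0n add1n add0n [rho ^+ _.+1]exprS -mulrA.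
Qed.

Lemma wnorm1 rho L : wnorm rho L.+1 1 = 1.
Proof.
rewrite /wnorm /sqnorm big_ord_recl big1 => [|m _].
  by rewrite coef1 /= normc1 expr0 expr1n mul1r addr0 sqrtr1.
by rewrite coef1 /= normc0 expr0n mulr0.
Qed.

Lemma wnorm_coef0 rho L p : 0 <= rho -> normc p`_0 <= wnorm rho L.+1 p.
Proof.
move=> r0; apply: le_trans (_ : wnorm rho 1 p <= _); last exact: wnorm_mono.
rewrite /wnorm /sqnorm big_ord_recl big_ord0 expr0 mul1r addr0 sqrtr_sqr.
by rewrite ger0_norm ?normc_ge0.
Qed.

Lemma wnorm_sub_coef0 rho L p : 0 <= rho ->
  wnorm rho L (p - (p`_0)%:P) <= wnorm rho L p.
Proof.
move=> r0; rewrite wnorm_le ?wnorm_ge0 // sqr_wnorm //.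
apply: ler_sum => m _; rewrite ler_wpM2l ?exprn_ge0 // coefB coefC.
case: eqP => [->|_]; last by rewrite subr0.
by rewrite subrr normc0 expr0n sqr_ge0.
Qed.

(** Abel summation: decreasing weights preserve an inequality between sums that
    holds for all partial sums. *)
Lemma sqnorm_weight rho (M : R) p q : 0 <= rho <= 1 ->
    (forall L, sqnorm 1 L p <= M * sqnorm 1 L q) ->
  forall L, sqnorm rho L p <= M * sqnorm rho L q.
Proof.
move=> /andP[r0 r1] h L.
pose c m := M * normc q`_m ^+ 2 - normc p`_m ^+ 2.
have S0 n : 0 <= \sum_(m < n) c m.
  rewrite sumrB -mulr_sumr subr_ge0; move: (h n); rewrite /sqnorm.
  under eq_bigr do rewrite expr1n mul1r.
  by under [X in _ <= _ * X -> _]eq_bigr do rewrite expr1n mul1r.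
suff W n : rho ^+ n * \sum_(m < n) c m <= \sum_(m < n) rho ^+ m * c m.
  rewrite -subr_ge0 mulr_sumr -sumrB.
  apply: le_trans (mulr_ge0 (exprn_ge0 L r0) (S0 L)) _.
  apply: le_trans (W L) _; rewrite le_eqVlt; apply/orP; left; apply/eqP.
  by apply: eq_bigr => m _; rewrite /c; ring.
elim: n => [|n IH]; first by rewrite !big_ord0 mulr0.
rewrite [leRHS]big_ord_recr /= exprS.
apply: (@le_trans _ _ (rho ^+ n * \sum_(m < n.+1) c m)).
  by rewrite -mulrA ler_piMl // mulr_ge0 ?exprn_ge0 ?S0.
by rewrite big_ord_recr /= mulrDr lerD2r.
Qed.

Lemma wnorm_weight rho (M : R) p q : 0 <= rho <= 1 -> 0 <= M ->
    (forall L, wnorm 1 L p <= M * wnorm 1 L q) ->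
  forall L, wnorm rho L p <= M * wnorm rho L q.
Proof.
move=> r01 M0 h L; have /andP[r0 _] := r01.
rewrite wnorm_le ?mulr_ge0 ?wnorm_ge0 // exprMn sqr_wnorm //.
apply: sqnorm_weight => // n; move: (h n).
by rewrite wnorm_le ?mulr_ge0 ?wnorm_ge0 // exprMn sqr_wnorm.
Qed.

End TruncatedNorm.

Section CircleNorm.
Variable R : realType.
Local Notation C := R[i].
Implicit Types (p q y : {poly C}).

Definition l2norm p : R := wnorm 1 (size p) p.

Lemma l2norm_wnorm n p : (size p <= n)%N -> wnorm 1 n p = l2norm p.
Proof.
move=> sp; congr Num.sqrt; rewrite /sqnorm.
rewrite -!(big_mkord xpredT (fun m => 1 ^+ m * normc p`_m ^+ 2)).
rewrite (big_cat_nat (leq0n _) sp) //= [X in _ + X]big_nat_cond [X in _ + X]big1 ?addr0 // => m.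
by rewrite andbT => /andP[sm _]; rewrite nth_default // normc0 expr0n mulr0.
Qed.

Lemma wnorm_l2norm n p : wnorm 1 n p <= l2norm p.
Proof.
rewrite -(@l2norm_wnorm (maxn n (size p))) ?leq_maxr //.
by rewrite wnorm_mono ?leq_maxl.
Qed.

Lemma l2norm_ge0 p : 0 <= l2norm p. Proof. exact: wnorm_ge0. Qed.

Lemma l2norm1 : l2norm 1 = 1.
Proof. by rewrite -(@l2norm_wnorm 1) ?size_poly1 // wnorm1. Qed.

Lemma l2norm_le (c : R) p q : 0 <= c ->
    (forall z : C, normc z = 1 -> normc p.[z] <= c * normc q.[z]) ->
  l2norm p <= c * l2norm q.
Proof.
move=> c0 h; pose n := (maxn (size p) (size q)).+1.
have sp : (size p <= n)%N by rewrite leqW // leq_maxl.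
have sq : (size q <= n)%N by rewrite leqW // leq_maxr.
have [w prw] := @prim_root_exists R n isT.
have w1 : normc w = 1 by apply: unity_root_normc (prim_expr_order prw).
rewrite -(l2norm_wnorm sp) -(l2norm_wnorm sq).
rewrite wnorm_le ?mulr_ge0 ?wnorm_ge0 // exprMn sqr_wnorm //.
have sqE r : sqnorm 1 n r = \sum_(m < n) normc r`_m ^+ 2.
  by apply: eq_bigr => m _; rewrite expr1n mul1r.
have n0 : 0 < n%:R :> R by rewrite ltr0n.
rewrite -(ler_pM2l n0) mulrCA !sqE -(parseval prw sp) -(parseval prw sq).
rewrite mulr_sumr; apply: ler_sum => j _.
rewrite -exprMn ler_pXn2r ?nnegrE ?mulr_ge0 ?normc_ge0 // h //.
by rewrite normcX w1 expr1n.
Qed.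

End CircleNorm.

(** * Outer polynomials and von Neumann's inequality *)

Section Outer.
Variable R : realType.
Local Notation C := R[i].
Implicit Types (P Q p q x y : {poly C}) (c : R).

Definition dominated c P Q :=
  forall z : C, normc z = 1 -> normc P.[z] <= c * normc Q.[z].

(** A polynomial has no zeros in the closed disk exactly when its inverse can
    be approximated by polynomials on the circle. This form of the condition
    is preserved by Schur's algorithm and is what replaces the maximum
    principle. *)
Definition outer Q := forall e : R, 0 < e ->
  exists x, forall z : C, normc z = 1 -> normc (Q.[z] * x.[z] - 1) <= e.

Lemma ler_eps_mul (a b k : R) : (forall e, 0 < e -> a <= b + e * k) -> a <= b.
Proof.
move=> h; apply/ler_addgt0Pr => e e0.
have k0 : 0 < `|k| + 1 by rewrite ltr_wpDl.
apply: le_trans (h (e / (`|k| + 1)) _) _; first by rewrite divr_gt0.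
rewrite lerD2l -mulrA ler_piMr ?(ltW e0) // [leLHS]mulrC ler_pdivrMr // mul1r.
by rewrite (le_trans (ler_norm k)) // lerDl.
Qed.

Lemma exp_le_eps (a e : R) : 0 <= a < 1 -> 0 < e -> exists n, a ^+ n <= e.
Proof.
move=> /andP[a0 a1] e0.
have /cvgrPdist_le/(_ e e0)[n _ /(_ n (leqnn n))] :
    (fun n => a ^+ n) @ \oo --> (0 : R).
  by apply: cvg_expr; rewrite ger0_norm.
by rewrite sub0r normrN ger0_norm ?exprn_ge0 //; exists n.
Qed.

Lemma poly_circle_bounded P :
  exists2 k : R, 0 < k & forall z : C, normc z = 1 -> normc P.[z] <= k.
Proof.
exists (\sum_(i < size P) normc P`_i + 1).
  by rewrite ltr_wpDl // sumr_ge0 // => i _; rewrite normc_ge0.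
move=> z z1; apply: le_trans (_ : \sum_(i < size P) normc P`_i <= _).
  rewrite horner_coef; apply: le_trans (normc_sum _ _ _) _.
  by apply: ler_sum => i _; rewrite normcM normcX z1 expr1n mulr1.
by rewrite lerDl.
Qed.

Lemma outer1 : outer 1.
Proof.
move=> e e0; exists 1 => z _.
by rewrite hornerC mul1r subrr normc0 ltW.
Qed.

Lemma outerM P Q : outer P -> outer Q -> outer (P * Q).
Proof.
move=> oP oQ e e0.
pose d := Num.min 1 (e / 3).
have d0 : 0 < d by rewrite lt_min ltr01 divr_gt0.
have d1 : d <= 1 by rewrite ge_min lexx.
have de : d <= e / 3 by rewrite ge_min lexx orbT.
have [x hx] := oP d d0; have [y hy] := oQ d d0.
exists (x * y) => z z1; rewrite !hornerM.
set a := P.[z] * x.[z] - 1; set b := Q.[z] * y.[z] - 1.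
have -> : P.[z] * Q.[z] * (x.[z] * y.[z]) - 1 = a * b + (a + b).
  by rewrite /a /b; ring.
have ha : normc a <= d by exact: hx.
have hb : normc b <= d by exact: hy.
apply: le_trans (normcD _ _) _; rewrite normcM.
apply: le_trans (lerD (ler_pM (normc_ge0 _) (normc_ge0 _) ha hb) (normcD _ _)) _.
have : d * d <= d by rewrite ler_piMl // ltW.
lra.
Qed.

(** Neumann series: if [x] nearly inverts [Q] then [w = 1 - (Q + aP) x] has
    modulus at most about [|a| < 1] on the circle, and [x (1 + w + w^2 + ...)]
    nearly inverts [Q + aP]. *)
Lemma outer_add P Q (a : C) : outer Q -> dominated 1 P Q -> normc a < 1 ->
  outer (Q + a *: P).
Proof.
move=> oQ dPQ a1 e e0.
pose d := (1 - normc a) / 4.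
have d0 : 0 < d by rewrite divr_gt0 // subr_gt0.
pose k := (1 + normc a) / 2.
have k01 : 0 <= k < 1 by have := normc_ge0 a; rewrite /k; lra.
have [x hx] := oQ d d0.
have [n hn] := exp_le_eps k01 e0.
pose w := 1 - (Q + a *: P) * x.
exists (x * \sum_(j < n) w ^+ j) => z z1.
have -> : (Q + a *: P).[z] * (x * \sum_(j < n) w ^+ j).[z] - 1
          = - (w.[z]) ^+ n.
  have W : (w - 1).[z] = - ((Q + a *: P).[z] * x.[z]).
    by rewrite /w !hornerE; ring.
  rewrite hornerM; set s := (\sum_(j < n) _).[z].
  have E : w.[z] ^+ n - 1 = - ((Q + a *: P).[z] * x.[z]) * s.
    have hX (p : {poly C}) : (p ^+ n - 1).[z] = p.[z] ^+ n - 1.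
      by rewrite !hornerE.
    by rewrite -W -hornerM -subrX1 hX.
  apply/eqP; rewrite -subr_eq0; apply/eqP.
  apply: etrans (_ : (w.[z] ^+ n - 1) + (Q + a *: P).[z] * x.[z] * s = 0).
    by ring.
  by rewrite E; ring.
rewrite normc_opp normcX; apply: le_trans hn; rewrite lerXn2r ?nnegrE ?normc_ge0 //.
  by case/andP: k01.
have -> : w.[z] = - ((Q.[z] * x.[z] - 1) + a * (P.[z] * x.[z])).
  by rewrite /w !(hornerD, hornerN, hornerM, hornerZ, hornerC); ring.
have hx1 := hx z z1.
have QX : normc (Q.[z] * x.[z]) <= 1 + d.
  rewrite -[Q.[z] * _](subrK 1); apply: le_trans (normcD _ _) _.
  by rewrite normc1 addrC lerD2l.
have PX : normc (P.[z] * x.[z]) <= 1 + d.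
  apply: le_trans QX; rewrite !normcM ler_wpM2r ?normc_ge0 //.
  by have := dPQ z z1; rewrite mul1r.
rewrite normc_opp; apply: le_trans (normcD _ _) _; rewrite normcM.
apply: le_trans (lerD hx1 (ler_wpM2l (normc_ge0 a) PX)) _.
have : normc a * d <= d by rewrite ler_piMl // ltW.
rewrite /k /d; lra.
Qed.

(** Von Neumann's inequality for the truncated shift: [P/Q] is bounded by [c]
    on the circle and analytic in the disk, hence so is multiplication by it
    on power series modulo ['X^L]. *)
Lemma outer_wnorm c P Q : 0 <= c -> outer Q -> dominated c P Q ->
  forall L y, wnorm 1 L (P * y) <= c * wnorm 1 L (Q * y).
Proof.
move=> c0 oQ dPQ L y.
(* [P y = (P x)(Q y)] up to the error [Q x - 1]; replacing [Q y] by its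
   truncation [w] does not change the result modulo ['X^L]. *)
pose w := take_poly L (Q * y).
have wE : l2norm w = wnorm 1 L (Q * y).
  rewrite -(@l2norm_wnorm _ L) ?size_take_poly //.
  by apply: eq_wnorm => m mL; rewrite coef_take_poly mL.
apply: (@ler_eps_mul _ _ (c * l2norm w + l2norm (P * y))) => e e0.
have [x hx] := oQ e e0.
have -> : wnorm 1 L (P * y) = wnorm 1 L (P * x * w - P * y * (Q * x - 1)).
  apply: eq_wnorm => m mL.
  have -> : P * x * w - P * y * (Q * x - 1) = P * y + P * x * (w - Q * y).
    by ring.
  rewrite coefD -[w](addrK (drop_poly L (Q * y) * 'X^L)) poly_take_drop.
  by rewrite addrAC subrr add0r mulrN mulrA coefN coefMXn mL oppr0 addr0.
apply: le_trans (wnormD _ _ _ ler01) _; rewrite wnormN.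
have h1 : wnorm 1 L (P * x * w) <= c * (1 + e) * l2norm w.
  apply: le_trans (wnorm_l2norm _ _) _; apply: l2norm_le.
    by rewrite mulr_ge0 // addr_ge0 // ltW.
  move=> z z1; rewrite !hornerM normcM ler_wpM2r ?normc_ge0 // normcM.
  apply: le_trans (ler_wpM2r (normc_ge0 _) (dPQ z z1)) _.
  rewrite -mulrA ler_wpM2l // -normcM -[Q.[z] * _](subrK 1).
  by apply: le_trans (normcD _ _) _; rewrite normc1 addrC lerD2l hx.
have h2 : wnorm 1 L (P * y * (Q * x - 1)) <= e * l2norm (P * y).
  apply: le_trans (wnorm_l2norm _ _) _; apply: l2norm_le; first exact: ltW.
  move=> z z1; rewrite hornerM normcM mulrC ler_wpM2r ?normc_ge0 //.
  by rewrite !hornerE hx.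
apply: le_trans (lerD h1 h2) _; rewrite -wE le_eqVlt; apply/orP; left.
by apply/eqP; ring.
Qed.

Lemma coef0_le_circle x c : 0 <= c ->
  (forall z : C, normc z = 1 -> normc x.[z] <= c) -> normc x`_0 <= c.
Proof.
move=> c0 h; apply: le_trans (@wnorm_coef0 _ 1 0 x ler01) _.
apply: le_trans (wnorm_l2norm _ _) _.
have := @l2norm_le _ c x 1 c0; rewrite l2norm1 mulr1; apply=> z z1.
by rewrite hornerC normc1 mulr1 h.
Qed.

(** Minimum principle at the origin: apply Parseval to an approximate inverse. *)
Lemma outer_min Q c : 0 < c -> outer Q ->
  (forall z : C, normc z = 1 -> c <= normc Q.[z]) -> c <= normc Q`_0.
Proof.
move=> c0 oQ hQ.
apply: (@ler_eps_mul _ _ (c + normc Q`_0)) => e e0.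
have [x hx] := oQ e e0.
have x0 : normc x`_0 <= (1 + e) / c.
  apply: coef0_le_circle => [|z z1].
    by rewrite divr_ge0 ?addr_ge0 ?(ltW e0) ?(ltW c0).
  rewrite ler_pdivlMr // mulrC.
  apply: le_trans (ler_wpM2r (normc_ge0 _) (hQ z z1)) _.
  rewrite -normcM -[Q.[z] * _](subrK 1); apply: le_trans (normcD _ _) _.
  by rewrite normc1 addrC lerD2l hx.
have h0 : normc ((Q * x - 1)`_0) <= e.
  apply: coef0_le_circle => [|z z1]; first exact: ltW.
  by rewrite !hornerE hx.
have : 1 - e <= normc Q`_0 * ((1 + e) / c).
  apply: le_trans (ler_wpM2l (normc_ge0 _) x0); rewrite -normcM -coef0M.
  have E : (1 : C) = (Q * x)`_0 - (Q * x - 1)`_0 by rewrite coefB coef1 /=; ring.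
  have := normcB (Q * x)`_0 (Q * x - 1)`_0; rewrite -E normc1; lra.
rewrite mulrA ler_pdivlMr // => h; nra.
Qed.

End Outer.

(** * Schur's algorithm on pairs of polynomials *)

Section SchurPair.
Variable R : realType.
Local Notation C := R[i].
Implicit Types (P Q y : {poly C}) (eta : R).

Definition schur_coef (F : {poly C} * {poly C}) : C := F.1`_0 / F.2`_0.

Definition schur_next (F : {poly C} * {poly C}) : {poly C} * {poly C} :=
  (drop_poly 1 (F.1 - schur_coef F *: F.2), F.2 - (schur_coef F)^* *: F.1).

(** The pair [(P, Q)] stands for the function [P/Q]. *)
Definition schur_pair P Q k := iter k schur_next (P, Q).
Definition schur_num P Q k := (schur_pair P Q k).1.
Definition schur_den P Q k := (schur_pair P Q k).2.
Definition schur_param P Q k := schur_coef (schur_pair P Q k).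

(** Functions [P/Q] whose Szego constant [exp (\int log (1 - |P/Q|^2) dm)] is at
    least [eta]: divide the last inequality by [|Q|^2] and take logarithms, the
    mean of [log |Q|] being [log |Q(0)| = 0] for outer [Q]. *)
Definition szego_class eta P Q :=
  [/\ outer Q, Q`_0 = 1 &
      forall z : C, normc z = 1 -> eta <= normc Q.[z] ^+ 2 - normc P.[z] ^+ 2].

Section Iterates.
Variables P Q : {poly C}.
Local Notation sP := (schur_num P Q).
Local Notation sQ := (schur_den P Q).
Local Notation sa := (schur_param P Q).

Lemma schur_denS k : sQ k.+1 = sQ k - (sa k)^* *: sP k.
Proof. by []. Qed.

Lemma schur_numS k : (sQ k)`_0 != 0 -> 'X * sP k.+1 = sP k - sa k *: sQ k.
Proof.
move=> Q0; have -> : sP k.+1 = drop_poly 1 (sP k - sa k *: sQ k) by [].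
set p := _ - _; have p0 : p`_0 = 0.
  by rewrite coefB coefZ /schur_param /schur_coef divfK ?subrr.
rewrite -[RHS](poly_take_drop 1) mulrC -[LHS]add0r; congr (_ + _).
by apply/polyP => -[|i]; rewrite coef_take_poly coef0 // p0.
Qed.

Lemma moebius_normc (a u v : C) :
  normc (v - a^* * u) ^+ 2 - normc (u - a * v) ^+ 2 =
  (1 - normc a ^+ 2) * (normc v ^+ 2 - normc u ^+ 2).
Proof.
rewrite !sqr_normcE; case: a u v => [a1 a2] [u1 u2] [v1 v2] /=; ring.
Qed.

Section Szego.
Variable eta : R.
Hypotheses (eta0 : 0 < eta) (hPQ : szego_class eta P Q).

Let inv k (p : R) :=
  [/\ outer (sQ k), (sQ k)`_0 = p%:C, eta <= p &
      forall z : C, normc z = 1 -> normc (sQ k).[z] ^+ 2 - normc (sP k).[z] ^+ 2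
        = p * (normc Q.[z] ^+ 2 - normc P.[z] ^+ 2)].

Let inv_gap k p : inv k p ->
  forall z : C, normc z = 1 ->
    p * eta <= normc (sQ k).[z] ^+ 2 - normc (sP k).[z] ^+ 2.
Proof.
move=> [_ _ ep h] z z1; rewrite h // ler_wpM2l //.
  by rewrite (le_trans _ ep) ?(ltW eta0).
by have [_ _ ->] := hPQ.
Qed.

Lemma wnorm_one (p : {poly C}) : wnorm 1 1 p = normc p`_0.
Proof.
rewrite /wnorm /sqnorm big_ord_recl big_ord0 expr0 mul1r addr0 sqrtr_sqr.
by rewrite ger0_norm ?normc_ge0.
Qed.

(** On the circle [|P_k|^2 <= (1 - d) |Q_k|^2] for some [d > 0]; von Neumann's
    inequality carries this to the value at [0]. *)
Let inv_param k p : inv k p -> normc (sa k) < 1.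
Proof.
move=> ik; have := inv_gap ik; have [oQ Q0 ep _] := ik => gap.
have p0 : 0 < p by exact: lt_le_trans ep.
have [K K0 hK] := poly_circle_bounded (sQ k).
have pe : 0 < p * eta by rewrite mulr_gt0.
have d0 : 0 < p * eta / K ^+ 2 by rewrite divr_gt0 // exprn_gt0.
have d1 : p * eta / K ^+ 2 <= 1.
  rewrite ler_pdivrMr ?exprn_gt0 // mul1r.
  apply: le_trans (gap 1 (normc1 R)) _; rewrite lerBlDr.
  apply: (@le_trans _ _ (K ^+ 2)); last by rewrite lerDl sqr_ge0.
  by rewrite ler_pXn2r ?nnegrE ?normc_ge0 ?(ltW K0) ?hK ?normc1.
set d := _ / _ in d0 d1.
have dom : dominated (Num.sqrt (1 - d)) (sP k) (sQ k).
  move=> z z1; apply: le_of_sqr; rewrite ?mulr_ge0 ?sqrtr_ge0 ?normc_ge0 //.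
  rewrite exprMn sqr_sqrtr ?subr_ge0 // mulrBl mul1r lerBrDr -lerBrDl.
  apply: le_trans (gap z z1); rewrite /d -mulrA ler_piMr ?(ltW pe) //.
  rewrite mulrC ler_pdivrMr ?exprn_gt0 // mul1r.
  by rewrite ler_pXn2r ?nnegrE ?normc_ge0 ?(ltW K0) ?hK.
have := outer_wnorm (sqrtr_ge0 _) oQ dom 1 1; rewrite !mulr1 !wnorm_one => h.
have q0 : 0 < normc (sQ k)`_0 by rewrite Q0 normc_real gtr0_norm.
rewrite /schur_param /schur_coef normcM normcV ltr_pdivrMr // mul1r.
apply: le_lt_trans h _; rewrite gtr_pMl //.
by rewrite -[ltRHS](@sqrtr1 R) ltr_sqrt // gtrBl.
Qed.

(** The gap [|Q_k|^2 - |P_k|^2] and the value [Q_k(0)] are both multiplied by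
    [1 - |a_k|^2] in a step. With [p'] the new value, [|Q|^2 >= p' eta] on the
    circle and [Q(0) = p'], so the minimum principle gives [p'^2 >= p' eta]. *)
Let inv_next k p : inv k p -> inv k.+1 (p * (1 - normc (sa k) ^+ 2)).
Proof.
move=> ik; have a1 := inv_param ik; have gap := inv_gap ik.
have [oQ Q0 ep h] := ik.
have p0 : 0 < p by exact: lt_le_trans ep.
have q0 : (sQ k)`_0 != 0 by rewrite Q0 -normc_gt0 normc_real gtr0_norm.
have dom : dominated 1 (sP k) (sQ k).
  move=> z z1; rewrite mul1r; apply: le_of_sqr; rewrite ?normc_ge0 // -subr_ge0.
  by apply: le_trans (gap z z1); rewrite mulr_ge0 ?(ltW p0) ?(ltW eta0).
have oQ' : outer (sQ k.+1).
  rewrite schur_denS -scaleNr; apply: outer_add => //.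
  by rewrite normc_opp normc_conj.
have a2 : 0 < 1 - normc (sa k) ^+ 2.
  by rewrite subr_gt0 -(expr1n _ 2) ltr_pXn2r ?nnegrE ?normc_ge0.
set p' := p * _; have p'0 : 0 < p' by rewrite mulr_gt0.
have Q0' : (sQ k.+1)`_0 = p'%:C.
  have aE : (sP k)`_0 = sa k * p%:C by rewrite -Q0 /schur_param /schur_coef divfK.
  rewrite schur_denS coefB coefZ aE Q0 mulrA [_^* * _]mulrC mulcJ /p'.
  by rewrite !rmorphM rmorphB rmorph1 /=; ring.
have circ (z : C) : normc z = 1 ->
    normc (sQ k.+1).[z] ^+ 2 - normc (sP k.+1).[z] ^+ 2 =
    p' * (normc Q.[z] ^+ 2 - normc P.[z] ^+ 2).
  move=> z1; have -> : normc (sP k.+1).[z] = normc ('X * sP k.+1).[z].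
    by rewrite hornerM hornerX normcM z1 mul1r.
  rewrite schur_numS // schur_denS !(hornerD, hornerN, hornerZ).
  by rewrite moebius_normc h // /p'; ring.
split=> //.
have pe0 : 0 <= p' * eta by exact: mulr_ge0 (ltW p'0) (ltW eta0).
have lb : Num.sqrt (p' * eta) <= normc (sQ k.+1)`_0.
  apply: outer_min => // [|z z1]; first by rewrite sqrtr_gt0 mulr_gt0.
  apply: le_of_sqr; rewrite ?sqrtr_ge0 ?normc_ge0 // (sqr_sqrtr pe0).
  rewrite -[leRHS](subrK (normc (sP k.+1).[z] ^+ 2)) circ //.
  apply: (@le_trans _ _ (p' * (normc Q.[z] ^+ 2 - normc P.[z] ^+ 2))).
    by rewrite ler_wpM2l ?(ltW p'0) //; have [_ _ ->] := hPQ.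
  by rewrite lerDl sqr_ge0.
have : p' * eta <= p' ^+ 2.
  rewrite -(sqr_sqrtr pe0).
  rewrite ler_pXn2r ?nnegrE ?sqrtr_ge0 ?(ltW p'0) // (le_trans lb) //.
  by rewrite Q0' normc_real gtr0_norm.
by rewrite expr2 ler_pM2l.
Qed.

Let inv_all k : inv k (\prod_(i < k) (1 - normc (sa i) ^+ 2)).
Proof.
elim: k => [|k IH]; last by rewrite big_ord_recr; apply: inv_next.
rewrite big_ord0; have [oQ Q0 h] := hPQ.
split=> //; last by move=> z; rewrite mul1r.
have := @outer_min _ Q (Num.sqrt eta); rewrite sqrtr_gt0 Q0 normc1 => /(_ eta0 oQ).
rewrite -[X in _ <= X](@sqrtr1 R) ler_sqrt //; apply=> z z1.
apply: le_of_sqr; rewrite ?sqrtr_ge0 ?normc_ge0 // sqr_sqrtr ?(ltW eta0) //.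
by apply: le_trans (h z z1) _; rewrite gerBl sqr_ge0.
Qed.

Lemma schur_outer k : outer (sQ k).
Proof. by case: (inv_all k). Qed.

Lemma schur_den_neq0 k : (sQ k)`_0 != 0.
Proof.
have [_ -> ep _] := inv_all k.
by rewrite -normc_gt0 normc_real normr_gt0 gt_eqF // (lt_le_trans eta0).
Qed.

Lemma schur_param_lt1 k : normc (sa k) < 1.
Proof. exact: inv_param (inv_all k). Qed.

(** The Schur parameters inherit the Szego constant; this is Jensen's
    inequality for [log |Q_k|]. *)
Lemma schur_param_prod k : eta <= \prod_(i < k) (1 - normc (sa i) ^+ 2).
Proof. by case: (inv_all k). Qed.

Lemma schur_dominated k : dominated 1 (sP k) (sQ k).
Proof.
move=> z z1; rewrite mul1r; apply: le_of_sqr; rewrite ?normc_ge0 // -subr_ge0.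
apply: le_trans (inv_gap (inv_all k) z1); rewrite mulr_ge0 ?(ltW eta0) //.
exact: le_trans (ltW eta0) (schur_param_prod k).
Qed.

End Szego.
End Iterates.
End SchurPair.

(** * Stability of Schur's algorithm *)

Section MultiplierBounds.
Variable R : realType.
Local Notation C := R[i].
Local Notation wnh := (@wnorm R (1 / 4)).

Let r4 : 0 <= 1 / 4 :> R. Proof. by rewrite divr_ge0. Qed.

Lemma sqrt_quarter : Num.sqrt (1 / 4) = 1 / 2 :> R.
Proof.
have -> : 1 / 4 = (1 / 2) ^+ 2 :> R by field.
by rewrite sqrtr_sqr ger0_norm // divr_ge0.
Qed.

Variables (eta : R) (P Q : {poly C}).
Hypotheses (eta0 : 0 < eta) (hPQ : szego_class eta P Q).
Local Notation sP := (schur_num P Q).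
Local Notation sQ := (schur_den P Q).
Local Notation sa := (schur_param P Q).

(** [x] bounds multiplication by the [k]-th Schur iterate [sP k / sQ k] on the
    Hardy space of the disk of radius [1/2]. *)
Definition multiplier_bound k (x : R) :=
  forall L y, wnh L (sP k * y) <= x * wnh L (sQ k * y).

Lemma multiplier_bound1 k : multiplier_bound k 1.
Proof.
move=> L y; apply: wnorm_weight => // [|n]; first by lra.
exact: (outer_wnorm ler01 (schur_outer eta0 hPQ k) (schur_dominated eta0 hPQ k)).
Qed.

(** One inverse step [f_k = a + (1 - |a|^2) z f_{k+1} / (1 + a^* z f_{k+1})] with
    [|z| = 1/2]; the constant is [3/5 = 1/2 * 6/5] because
    [(1 - |a|^2) / (1 - |a|/2) <= 6/5]. *)
Lemma multiplier_bound_prev k x : 0 <= x <= 1 -> multiplier_bound k.+1 x ->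
  multiplier_bound k (normc (sa k) + 3 / 5 * x).
Proof.
move=> /andP[x0 x1] h L y.
set A := wnh L (sQ k * y); have A0 : 0 <= A by exact: wnorm_ge0.
set s := normc (sa k); have s0 : 0 <= s by exact: normc_ge0.
have s1 : s < 1 by exact: (schur_param_lt1 eta0 hPQ).
set W := (sP k - sa k *: sQ k) * y.
pose B := wnh L W; have B0 : 0 <= B by exact: wnorm_ge0.
have WE : W = 'X * (sP k.+1 * y).
  by rewrite mulrA (schur_numS (schur_den_neq0 eta0 hPQ k)).
have hB : B <= x / 2 * ((1 - s ^+ 2) * A + s * B).
  have Q'E : sQ k.+1 * y = (1 - s ^+ 2)%:C *: (sQ k * y) - (sa k)^* *: W.
    rewrite schur_denS /W /s rmorphB rmorph1 /= -mulcJ -!mul_polyC polyCB polyCM polyC1.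
    ring.
  have hq : wnh L (sQ k.+1 * y) <= (1 - s ^+ 2) * A + s * B.
    rewrite Q'E; apply: le_trans (wnormD _ _ _ r4) _.
    rewrite wnormN !wnormZ normc_conj normc_real ger0_norm //.
    by rewrite subr_ge0 -(expr1n _ 2) ler_pXn2r ?nnegrE ?(ltW s1).
  apply: (@le_trans _ _ (x / 2 * wnh L (sQ k.+1 * y))).
    rewrite /B WE; case: (L) => [|L'].
      by rewrite {1}/wnorm /sqnorm big_ord0 sqrtr0 mulr_ge0 ?divr_ge0 ?wnorm_ge0.
    rewrite (wnormXM _ _ r4) sqrt_quarter.
    have := h L' y; have := wnorm_mono (sQ k.+1 * y) r4 (leqnSn L').
    by nra.
  by rewrite ler_wpM2l ?divr_ge0.
have -> : sP k * y = sa k *: (sQ k * y) + W.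
  by rewrite /W -!mul_polyC; ring.
apply: le_trans (wnormD _ _ _ r4) _; rewrite wnormZ -/s -/A -/B mulrDl lerD2l.
have t0 : 0 < 1 - s * (x / 2) by nra.
rewrite -(ler_pM2l t0).
have q : 0 <= 6 / 5 * (1 - s * (x / 2)) - (1 - s ^+ 2).
  have : s * x <= s by rewrite ler_piMr.
  have := sqr_ge0 (s - 3 / 10); lra.
have := mulr_ge0 (mulr_ge0 x0 A0) q; lra.
Qed.

(** Bounds obtained from the trivial one by [J] inverse steps. The trivial bound
    is not square summable, but its weight [(3/5)^J] is removed by [J -> oo]. *)
Fixpoint multiplier J k : R :=
  if J is J'.+1 then
    Num.min 1 (normc (sa k) + 3 / 5 * multiplier J' k.+1)
  else 1.

Lemma multiplier_itv J k : 0 <= multiplier J k <= 1.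
Proof.
elim: J k => [|J IH] k /=; first by lra.
have /andP[h _] := IH k.+1; have := normc_ge0 (sa k).
by rewrite le_min ge_min lexx ler01 andbT /= => s0; lra.
Qed.

Lemma multiplierP J k : multiplier_bound k (multiplier J k).
Proof.
elim: J k => [|J IH] k /=; first exact: multiplier_bound1.
rewrite /Num.min; case: ifP => _; first exact: multiplier_bound1.
by apply: multiplier_bound_prev; [exact: multiplier_itv | exact: IH].
Qed.

(** [1 - x <= e^{-x}] turns the product bound into a sum of squares. *)
Lemma schur_param_sum n k0 :
  \sum_(k < n) normc (sa (k0 + k)) ^+ 2 <= ln eta^-1.
Proof.
have -> : ln eta^-1 = - ln eta by rewrite lnV.
apply: (@le_trans _ _ (\sum_(k < k0 + n) normc (sa k) ^+ 2)).
  rewrite big_split_ord /= lerDr sumr_ge0 // => i _; exact: sqr_ge0.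
rewrite lerNr -[leRHS]expRK ler_ln ?posrE ?expR_gt0 //.
apply: le_trans (schur_param_prod eta0 hPQ (k0 + n)) _.
elim: (k0 + n)%N => [|m IH]; first by rewrite !big_ord0 oppr0 expR0.
rewrite !big_ord_recr /= opprD expRD ler_pM //.
- apply: prodr_ge0 => i _; rewrite subr_ge0 -(expr1n _ 2).
  by rewrite ler_pXn2r ?nnegrE ?normc_ge0 // ltW // (schur_param_lt1 eta0 hPQ).
- rewrite subr_ge0 -(expr1n _ 2).
  by rewrite ler_pXn2r ?nnegrE ?normc_ge0 // ltW // (schur_param_lt1 eta0 hPQ).
- exact: expR_ge1Dx.
Qed.

Lemma schur_param_le k : normc (sa k) <= Num.sqrt (1 - eta).
Proof.
have a1 i : normc (sa i) ^+ 2 < 1.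
  rewrite -(expr1n _ 2) ltr_pXn2r ?nnegrE ?normc_ge0 //.
  exact: (schur_param_lt1 eta0 hPQ).
have h : normc (sa k) ^+ 2 <= 1 - eta.
  rewrite lerBrDr addrC -lerBrDr.
  apply: le_trans (schur_param_prod eta0 hPQ k.+1) _.
  rewrite big_ord_recr /= ler_piMl ?subr_ge0 ?(ltW (a1 k)) //.
  apply: prodr_ile1 => i _; rewrite subr_ge0 (ltW (a1 i)) /=.
  by rewrite gerBl sqr_ge0.
apply: le_of_sqr; rewrite ?normc_ge0 ?sqrtr_ge0 // sqr_sqrtr //.
exact: le_trans (sqr_ge0 _) h.
Qed.

Lemma multiplier_sum J n k0 :
  \sum_(k < n) multiplier J (k0 + k) ^+ 2 <=
    25 / 4 * ln eta^-1 + n%:R * (3 / 5) ^+ J.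
Proof.
elim: J k0 => [|J IH] k0.
  rewrite expr0 mulr1 -[leLHS]add0r lerD //.
    rewrite mulr_ge0 ?divr_ge0 //.
    by have := schur_param_sum 0 0; rewrite big_ord0.
  by under eq_bigr do rewrite expr1n; rewrite sumr_const card_ord.
have step (k : 'I_n) : multiplier J.+1 (k0 + k) ^+ 2 <=
    5 / 2 * normc (sa (k0 + k)) ^+ 2 + 3 / 5 * multiplier J (k0.+1 + k) ^+ 2.
  rewrite addSn /=; set s := normc _; set x := multiplier _ _.
  have s0 : 0 <= s by exact: normc_ge0.
  have /andP[x0 x1] : 0 <= x <= 1 by exact: multiplier_itv.
  have m0 : 0 <= s + 3 / 5 * x by lra.
  apply: (@le_trans _ _ ((s + 3 / 5 * x) ^+ 2)).
    by rewrite ler_pXn2r ?nnegrE // ?le_min ?ge_min ?lexx ?orbT // ler01.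
  (* convexity: [s + 3/5 x = 2/5 (5/2 s) + 3/5 x] *)
  have := sqr_ge0 (5 * s - 2 * x); rewrite !expr2; lra.
apply: le_trans (ler_sum _ (fun k _ => step k)) _.
rewrite big_split /= -!mulr_sumr exprS.
have := IH k0.+1; have := schur_param_sum n k0; lra.
Qed.

End MultiplierBounds.

Section PowerSeries.
Variable R : realType.
Local Notation C := R[i].
Implicit Types (p q r s y : {poly C}) (L : nat).

Definition modX L p q := exists r, p = q + r * 'X^L.

Lemma modX_coef L p q m : modX L p q -> (m < L)%N -> p`_m = q`_m.
Proof. by move=> [r ->] mL; rewrite coefD coefMXn mL addr0. Qed.

Lemma modX_wnorm rho L p q : modX L p q -> wnorm rho L p = wnorm rho L q.
Proof. by move=> h; apply: eq_wnorm => m; apply: modX_coef. Qed.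

Lemma modX_leq L L' p q : (L <= L')%N -> modX L' p q -> modX L p q.
Proof.
move=> LL [r ->]; exists (r * 'X^(L' - L)).
by rewrite -mulrA -exprD subnK.
Qed.

Lemma modX_inv L q : q`_0 != 0 -> exists i, modX L (q * i) 1.
Proof.
move=> q0; have : coprimep q 'X^L.
  by rewrite coprimep_expr // coprimepX /root horner_coef0.
case/Bezout_eq1_coprimepP => -[u v] /= E; exists u, (- v).
by rewrite -E; ring.
Qed.

End PowerSeries.

Section Stability.
Variable R : realType.
Local Notation C := R[i].
Local Notation wnh := (@wnorm R (1 / 4)).

Let r4 : 0 <= 1 / 4 :> R. Proof. by rewrite divr_ge0. Qed.

(** A bound on pairs applies to the power series [P/Q = P i]. *)
Lemma multiplier_modX L (P Q i y : {poly C}) (x : R) :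
    modX L (Q * i) 1 -> (forall y, wnh L (P * y) <= x * wnh L (Q * y)) ->
  wnh L (P * i * y) <= x * wnh L y.
Proof.
move=> [r hi] h; rewrite -mulrA; apply: le_trans (h (i * y)) _.
rewrite (@modX_wnorm _ _ _ (Q * (i * y)) y) //; exists (r * y).
by rewrite mulrA hi; ring.
Qed.

(** The linearized Schur step. Modulo ['X^L] the difference [h = f - g]
    satisfies [z h' = (h - h(0)) + a^* f (z h') + z g' (a^* h + h(0)^* g)],
    where removing the mean [h(0)] does not increase the Hardy norm. *)
Lemma schur_step_stable L (f g f' g' : {poly C}) (a b : C) (x y y' : R) :
    modX L.+1 ('X * f' * (1 - a^* *: f)) (f - a%:P) ->
    modX L.+1 ('X * g' * (1 - b^* *: g)) (g - b%:P) ->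
    a = f`_0 -> b = g`_0 -> 0 <= y -> 0 <= y' ->
    (forall v, wnh L.+1 (f * v) <= x * wnh L.+1 v) ->
    (forall v, wnh L.+1 (g * v) <= y * wnh L.+1 v) ->
    (forall v, wnh L (g' * v) <= y' * wnh L v) ->
  (1 - normc a * x) * wnh L (f' - g') <=
    2 * (1 + y' * (normc a + y) / 2) * wnh L.+1 (f - g).
Proof.
move=> [rf hf] [rg hg] af bg y0 y'0 mf mg mg'.
set h := f - g; set H := f' - g'.
have h0 : h`_0 = a - b by rewrite coefB af bg.
set E := wnh L.+1 ('X * H).
have EH : E = 1 / 2 * wnh L H by rewrite /E (wnormXM _ _ r4) sqrt_quarter.
pose k := a^* *: h + (h`_0)^* *: g.
have rel : modX L.+1 ('X * H)
    ((h - (h`_0)%:P) + a^* *: (f * ('X * H)) + 'X * (g' * k)).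
  exists (rf - rg); have hc : (a - b)^* = a^* - b^* by rewrite rmorphB.
  rewrite h0 /k h0 hc /H /h -!mul_polyC !polyCB [(rf - rg) * _]mulrBl.
  have F : rf * 'X^(L.+1) = 'X * f' * (1 - a^* *: f) - (f - a%:P).
    by rewrite hf; ring.
  have G : rg * 'X^(L.+1) = 'X * g' * (1 - b^* *: g) - (g - b%:P).
    by rewrite hg; ring.
  by rewrite F G -!mul_polyC; ring.
have hk : wnh L.+1 k <= (normc a + y) * wnh L.+1 h.
  apply: le_trans (wnormD _ _ _ r4) _; rewrite !wnormZ !normc_conj mulrDl lerD2l.
  have g1 : wnh L.+1 g <= y.
    by have := mg 1; rewrite mulr1 wnorm1 mulr1.
  by rewrite mulrC ler_pM ?wnorm_ge0 ?normc_ge0 // wnorm_coef0.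
have hE : E <= wnh L.+1 h + normc a * (x * E) + 1 / 2 * (y' * ((normc a + y) * wnh L.+1 h)).
  rewrite {1}/E (modX_wnorm _ rel); apply: le_trans (wnormD _ _ _ r4) _.
  apply: lerD.
    apply: le_trans (wnormD _ _ _ r4) _; rewrite lerD ?wnorm_sub_coef0 //.
    by rewrite wnormZ normc_conj ler_wpM2l ?normc_ge0 ?mf.
  rewrite (wnormXM _ _ r4) sqrt_quarter ler_wpM2l ?divr_ge0 //.
  apply: le_trans (mg' _) _; rewrite ler_wpM2l //.
  by apply: le_trans hk; rewrite wnorm_mono.
rewrite EH in hE; lra.
Qed.

Section TwoPairs.
Variables (eta D : R) (P Q P' Q' : {poly C}).
Hypotheses (eta0 : 0 < eta) (hPQ : szego_class eta P Q).
Hypotheses (hPQ' : szego_class eta P' Q') (D0 : 0 <= D).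
Hypothesis hD : dominated D (P * Q' - P' * Q) (Q * Q').
Local Notation a := (schur_param P Q).
Local Notation b := (schur_param P' Q').
Local Notation kap := (Num.sqrt (1 - eta)).

Let schur_modX (P0 Q0 i j : {poly C}) k L : szego_class eta P0 Q0 ->
    modX L (schur_den P0 Q0 k * i) 1 -> modX L (schur_den P0 Q0 k.+1 * j) 1 ->
  modX L ('X * (schur_num P0 Q0 k.+1 * j)
            * (1 - (schur_param P0 Q0 k)^* *: (schur_num P0 Q0 k * i)))
         (schur_num P0 Q0 k * i - (schur_param P0 Q0 k)%:P).
Proof.
move=> h0; rewrite schur_denS mulrA.
rewrite (schur_numS (schur_den_neq0 eta0 h0 k)).
move: (schur_num _ _ k) (schur_den _ _ k) (schur_param _ _ k) => p q c.
move=> [r hr] [s hs].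
exists ((p - c *: q) * i * s - (p - c *: q) * j * r - c%:P * r).
have R1 : r * 'X^L = q * i - 1 by rewrite hr; ring.
have S1 : s * 'X^L = (q - c^* *: p) * j - 1 by rewrite hs; ring.
rewrite !mulrBl -!mulrA R1 S1 -!mul_polyC; ring.
Qed.

Let schur_param_modX (P0 Q0 j : {poly C}) k L : szego_class eta P0 Q0 ->
    modX L.+1 (schur_den P0 Q0 k * j) 1 ->
  schur_param P0 Q0 k = (schur_num P0 Q0 k * j)`_0.
Proof.
move=> h0 hj; have := modX_coef hj (ltn0Sn L).
rewrite !coef0M coef1 /= /schur_param /schur_coef => E; congr (_ * _).
have q0 := schur_den_neq0 eta0 h0 k.
by apply: (mulfI q0); rewrite E divff.
Qed.

Let kap1 : 0 < 1 - kap.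
Proof.
by rewrite subr_gt0 -[ltRHS](@sqrtr1 R) ltr_sqrt // gtrBl.
Qed.

(** The logarithm of the loss at step [k]. *)
Let loss J k := normc (a k) * multiplier P Q J k / (1 - kap)
  + multiplier P' Q' J k.+1 * (normc (a k) + multiplier P' Q' J k) / 2.

Let schur_diff_bound J K (i i' : nat -> {poly C}) :
    (forall k, modX K.+1 (schur_den P Q k * i k) 1) ->
    (forall k, modX K.+1 (schur_den P' Q' k * i' k) 1) ->
  forall k L, (k + L = K.+1)%N ->
  wnh L (schur_num P Q k * i k - schur_num P' Q' k * i' k) <=
    2 ^+ k * D * expR (\sum_(m < k) loss J m).
Proof.
move=> hi hi'; elim=> [|k IH] L kL.
  rewrite big_ord0 expR0 expr0 [1 * D]mul1r mulr1.
  have [oQ _ _] := hPQ; have [oQ' _ _] := hPQ'.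
  have hw n : wnorm 1 n ((P * Q' - P' * Q) * (i 0%N * i' 0%N)) <=
      D * wnorm 1 n (Q * Q' * (i 0%N * i' 0%N)).
    exact: outer_wnorm D0 (outerM oQ oQ') hD n _.
  have q01 : 0 <= (1 / 4 : R) <= 1 by lra.
  have hw' := wnorm_weight q01 D0 hw K.+1.
  have [r hr] : modX K.+1 (Q * i 0%N) 1 := hi 0%N.
  have [r' hr'] : modX K.+1 (Q' * i' 0%N) 1 := hi' 0%N.
  rewrite /schur_num /schur_den /schur_pair /= -kL add0n in hw' hr hr' *.
  have R1 : r * 'X^L = Q * i 0%N - 1 by rewrite hr; ring.
  have R1' : r' * 'X^L = Q' * i' 0%N - 1 by rewrite hr'; ring.
  rewrite (@modX_wnorm _ _ _ _ ((P * Q' - P' * Q) * (i 0%N * i' 0%N))); last first.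
    exists (P' * i' 0%N * r - P * i 0%N * r').
    by rewrite [_ * 'X^L]mulrBl -!mulrA R1 R1'; ring.
  apply: le_trans hw' _.
  rewrite (@modX_wnorm _ _ _ _ 1); last first.
    exists (r + r' * (Q * i 0%N)); rewrite mulrDl [_ * _ * 'X^L]mulrAC R1 R1'; ring.
  by rewrite -[X in wnh X](addn0 L) -(add0n L) kL addn0 wnorm1 mulr1.
have kL' : (k + L.+1 = K.+1)%N by rewrite -kL addSnnS.
have LK : (L.+1 <= K.+1)%N by rewrite -kL' leq_addl.
have /andP[x0 x1] := multiplier_itv P Q J k.
have /andP[y0 _] := multiplier_itv P' Q' J k.
have /andP[y'0 _] := multiplier_itv P' Q' J k.+1.
have := @schur_step_stable L _ _ _ _ (a k) (b k) _ _ _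
  (modX_leq LK (schur_modX hPQ (hi k) (hi k.+1)))
  (modX_leq LK (schur_modX hPQ' (hi' k) (hi' k.+1)))
  (schur_param_modX hPQ (hi k)) (schur_param_modX hPQ' (hi' k)) y0 y'0
  (fun v => multiplier_modX v (modX_leq LK (hi k)) (multiplierP eta0 hPQ J k L.+1))
  (fun v => multiplier_modX v (modX_leq LK (hi' k)) (multiplierP eta0 hPQ' J k L.+1))
  (fun v => multiplier_modX v (modX_leq (ltnW LK) (hi' k.+1))
              (multiplierP eta0 hPQ' J k.+1 L)).
have := IH _ kL'; set h := wnh L.+1 _; set h' := wnh L _.
have h0 : 0 <= h by exact: wnorm_ge0.
set x := multiplier P Q J k; set y := multiplier P' Q' J k.
set y' := multiplier P' Q' J k.+1; set s := normc (a k).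
have s0 : 0 <= s by exact: normc_ge0.
have sk : s <= kap by exact: (schur_param_le eta0 hPQ).
set B := _ * D * _ => hB hs.
rewrite big_ord_recr /= expRD exprS -/x -/y -/y' -/s.
(* [1 / (1 - u) <= exp (u / (1 - kap))] for [u <= kap], and [1 + u <= exp u]. *)
have sx : s * x <= kap by apply: le_trans sk; rewrite ler_piMr.
have e1 : 1 <= (1 - s * x) * expR (s * x / (1 - kap)).
  have u0 : 0 < 1 - s * x by apply: lt_le_trans kap1 _; rewrite lerD2l lerN2.
  rewrite -ler_pdivrMl // mulr1; apply: le_trans (expR_ge1Dx _).
  have sx0 : 0 <= s * x by rewrite mulr_ge0.
  have le_u : s * x / (1 - s * x) <= s * x / (1 - kap).
    by rewrite ler_wpM2l // lef_pV2 ?posrE // lerD2l lerN2.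
  have -> : (1 - s * x)^-1 = 1 + s * x / (1 - s * x).
    by field; rewrite (gt_eqF u0).
  by rewrite lerD2l.
have e2 := expR_ge1Dx (y' * (s + y) / 2).
set E1 := expR (s * x / _) in e1 *; rewrite expRD -/E1.
set E2 := expR (y' * _ / 2) in e2 *.
have E10 : 0 < E1 by exact: expR_gt0.
have h'0 : 0 <= h' by exact: wnorm_ge0.
apply: (@le_trans _ _ ((1 - s * x) * h' * E1)).
  by rewrite -[leLHS]mul1r mulrAC ler_wpM2r.
apply: (@le_trans _ _ (2 * (1 + y' * (s + y) / 2) * h * E1)).
  by rewrite ler_wpM2r // ltW.
have E20 : 0 <= 1 + y' * (s + y) / 2.
  by rewrite addr_ge0 // divr_ge0 // mulr_ge0 // addr_ge0.
apply: (@le_trans _ _ (2 * E2 * B * E1)).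
  rewrite ler_wpM2r ?(ltW E10) // ler_pM ?mulr_ge0 //.
  by rewrite ler_wpM2l.
by rewrite le_eqVlt /B; apply/orP; left; apply/eqP; ring.
Qed.

Let loss_sum J K : \sum_(m < K) loss J m <=
  17 * ln eta^-1 * (2 + (1 - kap)^-1)
    + (K%:R * (3 / 5) ^+ J) * (2 + (1 - kap)^-1).
Proof.
have hx := multiplier_sum eta0 hPQ J K 0.
have hy := multiplier_sum eta0 hPQ' J K 0.
have hy' := multiplier_sum eta0 hPQ' J K 1.
have ha := schur_param_sum eta0 hPQ K 0.
set c := (1 - kap)^-1; have c0 : 0 <= c by rewrite invr_ge0 ltW.
set La := ln _ in hx hy hy' ha *; set ep := K%:R * _ in hx hy hy' *.
have La0 : 0 <= La by have := schur_param_sum eta0 hPQ 0 0; rewrite big_ord0.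
have ep0 : 0 <= ep by rewrite mulr_ge0 // exprn_ge0 // divr_ge0.
pose A := \sum_(m < K) normc (a m) ^+ 2.
pose X := \sum_(m < K) multiplier P Q J m ^+ 2.
pose Y := \sum_(m < K) multiplier P' Q' J m ^+ 2.
pose Y' := \sum_(m < K) multiplier P' Q' J m.+1 ^+ 2.
have bnd : \sum_(m < K) loss J m <= (A + X) / 2 * c + (A / 4 + Y' / 2 + Y / 4).
  rewrite /A /X /Y /Y' -big_split /= !mulr_suml -!big_split /=.
  apply: ler_sum => m _; rewrite /loss -/c.
  set s := normc _; set x := multiplier P Q J m.
  set y := multiplier _ _ J m; set y' := multiplier _ _ J m.+1.
  have := mulr_ge0 c0 (sqr_ge0 (s - x)).
  have := sqr_ge0 (y' - s); have := sqr_ge0 (y' - y); rewrite !expr2; lra.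
have hA : A <= La by exact: ha.
have hX : X <= 25 / 4 * La + ep by exact: hx.
have hY : Y <= 25 / 4 * La + ep by exact: hy.
have hY' : Y' <= 25 / 4 * La + ep by exact: hy'.
apply: le_trans bnd _.
have h1 : (A + X) / 2 * c <= (29 / 8 * La + ep / 2) * c by rewrite ler_wpM2r //; lra.
have := mulr_ge0 La0 c0; have := mulr_ge0 ep0 c0; lra.
Qed.

(** Each step of the algorithm loses a factor [2] for the division by [z] on
    [|z| = 1/2], and a factor whose logarithm is summable along the algorithm. *)
Theorem schur_stability K :
  normc (a K - b K) <= 2 ^+ K * stabC eta (1 / 2) * D.
Proof.
have [i hi] := choice (fun k => modX_inv K.+1 (schur_den_neq0 eta0 hPQ k)).
have [i' hi'] := choice (fun k => modX_inv K.+1 (schur_den_neq0 eta0 hPQ' k)).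
have bnd J : normc (a K - b K) <=
    2 ^+ K * D * expR (\sum_(m < K) loss J m).
  rewrite (schur_param_modX hPQ (hi K)) (schur_param_modX hPQ' (hi' K)) -coefB.
  by apply: le_trans (schur_diff_bound J hi hi' (addn1 K)); exact: wnorm_coef0.
set S := 17 * ln eta^-1 * (2 + (1 - kap)^-1).
have -> : stabC eta (1 / 2) = expR S.
  by rewrite /stabC /S; congr expR; field; rewrite gt_eqF.
set A := normc _ in bnd *.
set c := 2 + (1 - kap)^-1; have c0 : 0 < c by rewrite addr_gt0 // invr_gt0.
suff : A * expR (- S) <= 2 ^+ K * D.
  by rewrite expRN ler_pdivrMr ?expR_gt0 // mulrAC.
have A0 : 0 <= A by exact: normc_ge0.
apply: (@ler_eps_mul _ _ _ (A * expR (- S))) => e e0.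
have [J hJ] : exists J, (3 / 5 : R) ^+ J <= e / ((K%:R + 1) * c).
  apply: exp_le_eps; first by lra.
  by rewrite divr_gt0 // mulr_gt0 // ltr_wpDl.
have eJ : K%:R * (3 / 5) ^+ J * c <= e.
  have K1 : 0 < K%:R + 1 :> R by rewrite ltr_wpDl.
  rewrite ler_pdivlMr ?mulr_gt0 // in hJ; apply: le_trans hJ.
  have w0 : 0 <= (3 / 5 : R) ^+ J by rewrite exprn_ge0 // divr_ge0.
  by have := mulr_ge0 w0 (ltW c0); lra.
have hA : A <= 2 ^+ K * D * expR (S + e).
  apply: le_trans (bnd J) _; rewrite ler_wpM2l ?mulr_ge0 ?exprn_ge0 // ler_expR.
  by apply: le_trans (loss_sum J K) _; rewrite lerD2l.
have e1 := expR_ge1Dx (- e).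
have : A * expR (- S) * (1 - e) <= 2 ^+ K * D.
  apply: (@le_trans _ _ (A * expR (- S) * expR (- e))).
    by rewrite ler_wpM2l // mulr_ge0 // expR_ge0.
  by rewrite -mulrA -expRD -opprD expRN ler_pdivrMr ?expR_gt0.
lra.
Qed.

End TwoPairs.
End Stability.

(** * Finite sequences of Schur parameters *)

Section Layers.
Variable R : realType.
Local Notation C := R[i].
Implicit Types (s : seq C) (P Q : {poly C}).

(** The pair [(P, Q)] whose quotient has Schur parameters [s]: with the
    notation of transfer matrices, [Q = a] and [P = b^*] up to normalization. *)
Fixpoint layers s : {poly C} * {poly C} :=
  if s is b :: s' then
    let F := layers s' in
    (b *: F.2 + 'X * F.1, F.2 + b^* *: ('X * F.1))
  else (0, 1).

Definition contractive s := all (fun b => normc b < 1) s.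

Definition defect s : R := \prod_(b <- s) (1 - normc b ^+ 2).

Lemma layers_den0 s : (layers s).2`_0 = 1.
Proof.
elim: s => [|b s IH] /=; first by rewrite coef1.
by rewrite coefD coefZ coefXM mulr0 addr0.
Qed.

Lemma layers_num0 b s : (layers (b :: s)).1`_0 = b.
Proof. by rewrite /= coefD coefZ coefXM layers_den0 mulr1 addr0. Qed.

Lemma layers_defect s (z : C) : normc z = 1 ->
  normc (layers s).2.[z] ^+ 2 - normc (layers s).1.[z] ^+ 2 = defect s.
Proof.
move=> z1; elim: s => [|b s IH] /=.
  rewrite /defect big_nil hornerC horner0 normc0 normc1 expr0n expr1n.
  by rewrite subr0.
rewrite /defect big_cons -/(defect s) -IH !(hornerD, hornerZ, hornerM, hornerX).
set u := z * _; have -> : normc (layers s).1.[z] = normc u.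
  by rewrite normcM z1 mul1r.
have := moebius_normc (- b) u (layers s).2.[z].
by rewrite rmorphN /= !mulNr !opprK normc_opp addrC [u + _]addrC => <-; rewrite addrC.
Qed.

Lemma defect_gt0 s : contractive s -> 0 < defect s.
Proof.
elim: s => [|b s IH] /=; rewrite /defect ?big_nil // big_cons => /andP[b1 hs].
rewrite mulr_gt0 ?IH // subr_gt0 -(expr1n _ 2).
by rewrite ltr_pXn2r ?nnegrE ?normc_ge0.
Qed.

Lemma layers_dominated s : contractive s -> dominated 1 (layers s).1 (layers s).2.
Proof.
move=> hs z z1; rewrite mul1r; apply: le_of_sqr; rewrite ?normc_ge0 //.
by rewrite -subr_ge0 layers_defect // ltW // defect_gt0.
Qed.

Lemma layers_outer s : contractive s -> outer (layers s).2.
Proof.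
elim: s => [|b s IH] /=; first by move=> _; exact: outer1.
move=> /andP[b1 hs]; apply: outer_add; first exact: IH.
  move=> z z1; rewrite hornerM hornerX normcM z1 mul1r.
  exact: layers_dominated.
by rewrite normc_conj.
Qed.

Lemma layers_szego eta s : contractive s -> eta <= defect s ->
  szego_class eta (layers s).1 (layers s).2.
Proof.
move=> hs he; split; first exact: layers_outer.
  exact: layers_den0.
by move=> z z1; rewrite layers_defect.
Qed.

Lemma szego_class_mul eta G P Q : (forall z : C, normc z = 1 -> normc G.[z] <= 1) ->
  szego_class eta P Q -> szego_class eta (G * P) Q.
Proof.
move=> hG [oQ Q0 h]; split=> // z z1; apply: le_trans (h z z1) _.
rewrite lerD2l lerN2 hornerM normcM exprMn ler_piMl ?sqr_ge0 //.
by rewrite -(expr1n _ 2) ler_pXn2r ?nnegrE ?normc_ge0 ?hG.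
Qed.

Lemma schur_pair_scale (c : C) P Q k : c != 0 ->
  schur_pair (c *: P) (c *: Q) k =
    (c *: schur_num P Q k, c *: schur_den P Q k).
Proof.
move=> c0; elim: k => [//|k IH].
rewrite /schur_pair iterS -/(schur_pair _ _ k) IH.
rewrite /schur_num /schur_den [schur_pair P Q k.+1]iterS -/(schur_pair P Q k).
rewrite /schur_next /=; set p := (schur_pair P Q k).1; set q := _.2.
have -> : schur_coef (c *: p, c *: q) = schur_coef (schur_pair P Q k).
  by rewrite /schur_coef /= !coefZ invfM mulrACA divff // mul1r.
set a := schur_coef _; congr (_, _).
  apply/polyP => i; rewrite coefZ !coef_drop_poly !(coefB, coefZ); ring.
by rewrite -!mul_polyC; ring.
Qed.

Lemma schur_param_scale (c : C) P Q k : c != 0 ->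
  schur_param (c *: P) (c *: Q) k = schur_param P Q k.
Proof.
move=> c0; rewrite /schur_param schur_pair_scale // /schur_coef /= !coefZ.
by rewrite invfM mulrACA divff // mul1r.
Qed.

Lemma schur_param_layers s k : contractive s ->
  schur_param (layers s).1 (layers s).2 k = nth 0 s k.
Proof.
elim: k s => [|k IH] [|b s] hs.
- by rewrite /schur_param /schur_coef /= coef0 mul0r.
- by rewrite /schur_param /schur_coef layers_num0 layers_den0 divr1.
- rewrite nth_nil -(nth_nil 0 k) -IH // /schur_param /schur_pair iterSr.
  congr (schur_coef (iter _ _ _)); rewrite /schur_next /schur_coef /= coef0.
  rewrite mul0r conjC0 !scale0r !subr0; congr (_, _).
  by apply/polyP => i; rewrite coef_drop_poly !coef0.
move: hs => /= /andP[b1 hs].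
rewrite -(IH s hs) /schur_param /schur_pair iterSr.
have c0 : 1 - normc b ^+ 2 != 0.
  by rewrite subr_eq0 eq_sym lt_eqF // -(expr1n _ 2) ltr_pXn2r ?nnegrE ?normc_ge0.
have cC : (1 - normc b ^+ 2)%:C = 1 - b * b^* by rewrite rmorphB rmorph1 mulcJ.
rewrite -/(schur_pair _ _ k) -/(schur_param _ _ k).
rewrite -(@schur_param_scale (1 - normc b ^+ 2)%:C); last first.
  by rewrite -(rmorph0 (real_complex R)) (inj_eq (@complexI R)).
have aE : schur_coef (b *: (layers s).2 + 'X * (layers s).1,
    (layers s).2 + b^* *: ('X * (layers s).1)) = b.
  have := layers_num0 b s; have := layers_den0 (b :: s).
  by rewrite /schur_coef /= => -> ->; rewrite divr1.
rewrite /schur_param; congr (schur_coef _).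
rewrite /schur_pair; congr (iter _ _ _).
rewrite /schur_next aE /= cC; congr (_, _).
  have -> : b *: (layers s).2 + 'X * (layers s).1
      - b *: ((layers s).2 + b^* *: ('X * (layers s).1)) =
      (1 - b * b^*) *: (layers s).1 * 'X^1.
    by rewrite expr1 -!mul_polyC polyCB polyCM polyC1; ring.
  by rewrite drop_polyMXn_id.
by rewrite -!mul_polyC polyCB polyCM polyC1; ring.
Qed.

Lemma layers_nseq0 n s :
  layers (nseq n 0 ++ s) = ('X^n * (layers s).1, (layers s).2).
Proof.
elim: n => [|n IH] /=; first by rewrite expr0 mul1r; case: (layers s).
by rewrite IH /= scale0r add0r conjC0 scale0r addr0 mulrA -exprS.
Qed.

Lemma layers_cat_nseq0 n s : layers (s ++ nseq n 0) = layers s.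
Proof.
elim: s => [|b s IH] /=; last by rewrite IH.
by elim: n => [//|n IH] /=; rewrite IH /= scale0r add0r conjC0 scale0r addr0 mulr0.
Qed.

End Layers.


(** * Schur's algorithm on functions *)

Section RationalLimit.
Variable K : numFieldType.
Implicit Types (p q : {poly K}).

Let ev p : K -> K := fun z => p.[z].

Let continuous_ev p : continuous (ev p).
Proof.
have muladd (f : K -> K) (c : K) : continuous f -> continuous (fun z => f z * z + c).
  move=> cf x; apply: (@continuousD K K K (fun z => f z * z) (cst c)).
    by apply: (@continuousM K K f id); [exact: cf | move=> ?; exact: cvg_id].
  exact: cst_continuous.
elim/poly_ind: p => [|p c IH].
  have -> : ev 0 = cst 0 by apply/funext => z; rewrite /ev horner0.
  exact: cst_continuous.
have -> : ev (p * 'X + c%:P) = (fun z => ev p z * z + c).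
  by apply/funext => z; rewrite /ev hornerMXaddC.
exact: muladd.
Qed.

Lemma horner_neq0_near0 q : q.[0] != 0 ->
  exists2 d : K, 0 < d & forall z, `|z| < d -> q.[z] != 0.
Proof.
move=> q0; have /nbhs_ballP[d d0 h] : nbhs (0 : K) [set z | ev q z != 0].
  exact: (@cvgr_neq0 K K K _ _ (ev q) _ (@continuous_ev q 0) q0).
by exists d => // z zd; apply: h; rewrite /ball /= sub0r normrN.
Qed.

Lemma lim_rational (f : K -> K) p q (d : K) : 0 < d -> q.[0] != 0 ->
    (forall z, `|z| < d -> z != 0 -> f z = p.[z] / q.[z]) ->
  lim (f w @[w --> (0 : K)^']) = p.[0] / q.[0].
Proof.
move=> d0 q0 h; apply: cvg_lim; first exact: norm_hausdorff.
have c1 : ev p w / ev q w @[w --> (0 : K)^'] --> ev p 0 / ev q 0.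
  apply: cvg_within_filter.
  apply: (@cvgM K K _ _ (ev p) (fun w => (ev q w)^-1)); first exact: continuous_ev.
  by apply: (@cvgV K K _ _ (ev q)) => //; exact: continuous_ev.
apply: cvg_trans c1; apply: near_eq_cvg.
have := dnbhs_ball (0 : K) d0; apply: filterS => w [].
rewrite /ball /= sub0r normrN => wd /eqP w0.
by rewrite h.
Qed.

End RationalLimit.

Section SchurFunctions.
Variable R : realType.
Local Notation C := R[i].
Implicit Types (F : C -> C).

Variables (eta : R) (P Q : {poly C}).
Hypotheses (eta0 : 0 < eta) (hPQ : szego_class eta P Q).

(** Only the germ at [0] matters for the parameters, so the equality of the
    iterates is kept on a disk where the denominators do not vanish. *)
Lemma schur_iterE F k : (forall z, F z = P.[z] / Q.[z]) ->
  exists2 d : C, 0 < d & forall z, `|z| < d ->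
    schur_iter F k z = (schur_num P Q k).[z] / (schur_den P Q k).[z].
Proof.
move=> FE; elim: k => [|k [d d0 IH]]; first by exists 1 => // z _; exact: FE.
have q0 j : (schur_den P Q j).[0] != 0.
  by rewrite horner_coef0; exact: schur_den_neq0 eta0 hPQ j.
have [d1 d10 h1] := horner_neq0_near0 (q0 k).
have [d2 d20 h2] := horner_neq0_near0 (q0 k.+1).
have [e e0 [ed ed1 ed2]] : exists2 e : C, 0 < e & [/\ e <= d, e <= d1 & e <= d2].
  have rl (x y : C) : 0 < x -> 0 < y -> exists2 e, 0 < e & e <= x /\ e <= y.
    move=> x0 y0; have : x >=< y by rewrite real_comparable ?gtr0_real.
    by case/comparable_leP => [xy|/ltW xy]; [exists x | exists y].
  have [e1 e10 [ed ed1]] := rl _ _ d0 d10.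
  have [e2 e20 [ee ed2]] := rl _ _ e10 d20.
  by exists e2 => //; split=> //; apply: le_trans ee _.
set a := schur_param P Q k.
have F0 : schur_iter F k 0 = a by rewrite IH ?normr0 // !horner_coef0.
have quotE z : `|z| < e -> z != 0 -> schur_quot (schur_iter F k) z =
    (schur_num P Q k.+1).[z] / (schur_den P Q k.+1).[z].
  move=> ze z0.
  have q1 := h1 z (lt_le_trans ze ed1); have q2 := h2 z (lt_le_trans ze ed2).
  have nE : z * (schur_num P Q k.+1).[z] =
      (schur_num P Q k).[z] - a * (schur_den P Q k).[z].
    rewrite -[z in z * _]hornerX -hornerM.
    rewrite (schur_numS (schur_den_neq0 eta0 hPQ k)).
    by rewrite hornerD hornerN hornerZ.
  have dE : (schur_den P Q k.+1).[z] =
      (schur_den P Q k).[z] - a^* * (schur_num P Q k).[z].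
    by rewrite schur_denS hornerD hornerN hornerZ.
  rewrite /schur_quot F0 IH ?(lt_le_trans ze ed) //.
  have -> : (schur_num P Q k.+1).[z] =
      ((schur_num P Q k).[z] - a * (schur_den P Q k).[z]) / z.
    by rewrite -nE mulrC mulKf.
  rewrite dE in q2 *.
  by field; rewrite q1 z0 q2.
exists e => // z ze; rewrite /schur_iter iterS -/(schur_iter F k) /schur_step.
case: eqP => [->|/eqP z0]; last exact: quotE.
exact: lim_rational e0 (q0 k.+1) quotE.
Qed.

Lemma schur_iter0 F k : (forall z, F z = P.[z] / Q.[z]) ->
  schur_iter F k 0 = schur_param P Q k.
Proof.
move=> FE; have [d d0 h] := schur_iterE k FE.
by rewrite h ?normr0 // !horner_coef0.
Qed.

End SchurFunctions.

(** * The scattering coefficients of a finitely supported sequence *)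

Section Scattering.
Variable R : realType.
Local Notation C := R[i].
Implicit Types (p : {poly C}) (q : int -> C).

Lemma conjC_realc (a : R) : (a%:C)^* = a%:C. Proof. exact: conjc_real. Qed.

Lemma poly_circle_eq p p' :
  (forall z : C, normc z = 1 -> p.[z] = p'.[z]) -> p = p'.
Proof.
move=> h; apply/eqP; rewrite -subr_eq0; apply/eqP/polyP => m; rewrite coef0.
set r := p - p'.
have r0 : l2norm r = 0.
  apply/eqP; rewrite eq_le l2norm_ge0 andbT -(mul0r (l2norm 1)).
  apply: l2norm_le => // z z1.
  by rewrite hornerD hornerN h // subrr normc0 mul0r.
have : wnorm 1 m.+1 r <= 0 by rewrite -r0 wnorm_l2norm.
rewrite wnorm_le // expr0n /sqnorm big_ord_recr /= expr1n mul1r => h2.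
apply: eq0_normc; apply/eqP; rewrite -sqrf_eq0 eq_le sqr_ge0 andbT.
apply: le_trans h2; rewrite lerDr sumr_ge0 // => i _.
by rewrite expr1n mul1r sqr_ge0.
Qed.

Lemma circle_polyE (g : C -> C) p :
  (forall z : C, normc z = 1 -> p.[z] = g z) -> circle_poly g = p.
Proof.
move=> h; rewrite /circle_poly; apply: xget_unique => //= p' h'.
by apply: poly_circle_eq => z z1; rewrite h ?h'.
Qed.

Definition sample q m len : seq C := [seq q k%:Z | k <- iota m len].

Lemma transfer_layers q (z : C) m len : normc z = 1 ->
  let c := \prod_(m <= k < m + len) (Num.sqrt (1 - normc (q k%:Z) ^+ 2))^-1 in
  let F := layers (sample q m len) in
  let M := \prod_(m <= k < m + len) transfer_factor (q k%:Z) k%:Z z in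
  [/\ M 0 0 = c%:C * F.2.[z], M 1 0 = c%:C * (z ^+ m * F.1.[z]),
      M 0 1 = (c%:C * (z ^+ m * F.1.[z]))^* & M 1 1 = (c%:C * F.2.[z])^*].
Proof.
move=> z1; elim: len m => [|len IH] m /=.
  rewrite addn0 !big_geq // hornerC horner0 !mxE /=.
  by rewrite !mulr0 mulr1 !rmorph1 !rmorph0.
rewrite !(big_ltn (_ : m < m + len.+1)%N) ?addnS ?ltnS ?leq_addr //.
rewrite -addSn; have [] := IH m.+1.
set M := \prod_(_ <= k < _) transfer_factor _ _ _.
set c := \prod_(_ <= k < _) (Num.sqrt _)^-1.
set F := layers _ => M00 M10 M01 M11.
set r := (Num.sqrt _)^-1.
have mulE (i j : 'I_2) : (transfer_factor (q m%:Z) m%:Z z * M) i j =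
    transfer_factor (q m%:Z) m%:Z z i 0 * M 0 j
    + transfer_factor (q m%:Z) m%:Z z i 1 * M 1 j.
  have e1 : lift ord0 ord0 = 1 :> 'I_2 by apply: val_inj.
  by rewrite mxE !big_ord_recl big_ord0 addr0 e1.
have zu : z != 0 by rewrite -normc_gt0 z1.
have zJ : z^* = z^-1 by exact: conjc_inv_unit.
rewrite !mulE M00 M10 M01 M11 /transfer_factor !mxE /= -/r -exprnP -exprnN.
rewrite !rmorphM /= !conjC_realc !(hornerD, hornerZ, hornerM, hornerX).
rewrite !rmorphD !rmorphM !rmorphXn /= conjCK zJ !exprS !exprVn.
by split; field; rewrite ?zu ?expf_neq0.
Qed.

Lemma scatt_fE q l (z : C) : (forall k, normc (q k) < 1) ->
  scatt_f q l z = (layers (sample q 0 l.+1)).1.[z]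
                 / (layers (sample q 0 l.+1)).2.[z].
Proof.
move=> h1; rewrite /scatt_f.
set c := \prod_(0 <= k < 0 + l.+1) (Num.sqrt (1 - normc (q k%:Z) ^+ 2))^-1.
have c0 : c%:C != 0 :> C.
  rewrite -normc_gt0 normc_real normr_gt0 prodf_seq_neq0; apply/allP => k _ /=.
  rewrite invr_neq0 // gt_eqF // sqrtr_gt0 subr_gt0 -(expr1n _ 2).
  by rewrite ltr_pXn2r ?nnegrE ?normc_ge0.
rewrite (@circle_polyE _ (c%:C *: (layers (sample q 0 l.+1)).1)); last first.
  move=> w w1; have [_ _ E _] := transfer_layers q 0 l.+1 w1.
  by rewrite /coef_b /transfer_matrix [X in X^*]E conjCK hornerZ expr0 mul1r.
rewrite (@circle_polyE _ (c%:C *: (layers (sample q 0 l.+1)).2)); last first.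
  move=> w w1; have [E _ _ _] := transfer_layers q 0 l.+1 w1.
  by rewrite /coef_a /transfer_matrix [RHS]E hornerZ.
by rewrite !hornerZ invfM mulrACA divff // mul1r.
Qed.

End Scattering.

(** * Differential inequalities *)

Section RealCurves.
Variable R : realType.
Implicit Types (f g : R -> R) (T s c : R).

(** Continuity up to the end points and differentiability inside. *)
Definition curve T f f' :=
  {within `[0, T], continuous f} /\
  forall s, 0 < s < T -> is_derive s (1 : R) f (f' s).

Lemma curve_sub T S f f' : S <= T -> curve T f f' -> curve S f f'.
Proof.
move=> ST [cf df]; split.
  apply: continuous_subspaceW cf => x /=; rewrite !in_itv /= => /andP[-> h].
  exact: le_trans ST.
by move=> s /andP[s0 sS]; apply: df; rewrite s0 (lt_le_trans sS).
Qed.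

Lemma curve_ext T f f' g' : (forall s, 0 < s < T -> f' s = g' s) ->
  curve T f f' -> curve T f g'.
Proof.
by move=> h [cf df]; split=> // s hs; rewrite -h //; exact: df.
Qed.

Lemma curve_everywhere T f f' : (forall s, is_derive s (1 : R) f (f' s)) ->
  curve T f f'.
Proof.
move=> h; split; last by move=> s _; exact: h.
apply: continuous_subspaceT => x; apply: differentiable_continuous.
by apply/derivable1_diffP; have [] := h x.
Qed.

Lemma curve_cst T c : curve T (fun=> c) (fun=> 0).
Proof. by apply: curve_everywhere => s; exact: is_derive_cst. Qed.

Lemma curve_id T : curve T (fun s => s) (fun=> 1).
Proof. by apply: curve_everywhere => s; exact: is_derive_id. Qed.

Lemma curveD T f g f' g' : curve T f f' -> curve T g g' ->
  curve T (fun s => f s + g s) (fun s => f' s + g' s).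
Proof.
move=> [cf df] [cg dg]; split.
  by move=> x; apply: (@continuousD R R (subspace `[0, T]) f g); [exact: cf|exact: cg].
by move=> s hs; apply: (@is_deriveD _ _ _ f g); [exact: df|exact: dg].
Qed.

Lemma curveN T f f' : curve T f f' -> curve T (fun s => - f s) (fun s => - f' s).
Proof.
move=> [cf df]; split.
  by move=> x; apply: (@continuousN R R (subspace `[0, T]) f); exact: cf.
by move=> s hs; apply: (@is_deriveN _ _ _ f); exact: df.
Qed.

Lemma curveB T f g f' g' : curve T f f' -> curve T g g' ->
  curve T (fun s => f s - g s) (fun s => f' s - g' s).
Proof. by move=> hf /curveN; exact: curveD. Qed.

Lemma curveM T f g f' g' : curve T f f' -> curve T g g' ->
  curve T (fun s => f s * g s) (fun s => f' s * g s + f s * g' s).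
Proof.
move=> [cf df] [cg dg]; split.
  by move=> x; apply: (@continuousM R (subspace `[0, T]) f g); [exact: cf|exact: cg].
move=> s hs; have := @is_deriveM R R f g s 1 _ _ (df s hs) (dg s hs).
by move=> h; apply: is_derive_eq h _; rewrite /GRing.scale /= addrC [g s * _]mulrC.
Qed.

Lemma curveZ T c f f' : curve T f f' -> curve T (fun s => c * f s) (fun s => c * f' s).
Proof.
move=> hf; apply: curve_ext (curveM (curve_cst T c) hf) => s _.
by rewrite mul0r add0r.
Qed.

Lemma curveV T f f' : (forall s, 0 <= s <= T -> f s != 0) -> curve T f f' ->
  curve T (fun s => (f s)^-1) (fun s => - f' s / f s ^+ 2).
Proof.
move=> f0 [cf df]; split.
  apply/subspace_continuousP => x xT.
  by apply: cvgV; [exact: f0|move/subspace_continuousP: cf; exact].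
move=> s /andP[s0 sT].
have fs : f s != 0 by apply: f0; rewrite !ltW.
have := @is_deriveV _ f s _ 1 fs (df s _); rewrite s0 sT => /(_ isT) h.
by apply: is_derive_eq h _; rewrite /GRing.scale /= mulNr mulrC mulNr.
Qed.

Lemma curve_expR T c : curve T (fun s => expR (c * s)) (fun s => c * expR (c * s)).
Proof.
apply: curve_everywhere => s.
have h : is_derive s (1 : R) (fun s => c * s) c.
  have := @is_deriveZ R R R id c s 1 1 (is_derive_id s 1).
  by move=> h; apply: is_derive_eq h _; rewrite /GRing.scale /= mulr1.
have := is_derive1_comp (is_derive_expR (c * s)) h.
by move=> h2; apply: is_derive_eq h2 _; rewrite mulrC.
Qed.

Lemma curve_homo T f f' : 0 <= T -> curve T f f' ->
  (forall s, 0 < s < T -> 0 <= f' s) -> f 0 <= f T.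
Proof.
rewrite le_eqVlt => /predU1P[<- _ _|T0 [cf df] h]; first exact: lexx.
have hd x : x \in `]0, T[ -> is_derive x (1 : R) f (f' x).
  by rewrite in_itv /=; exact: df.
have [c cT E] := MVT T0 hd cf.
rewrite in_itv /= in cT.
by rewrite -subr_ge0 E subr0 mulr_ge0 ?h ?ltW.
Qed.

End RealCurves.

Section ComplexCurves.
Variable R : realType.
Local Notation C := R[i].
Local Notation Re := (@complex.Re R).
Local Notation Im := (@complex.Im R).
Implicit Types (f g : R -> C) (T s : R) (c : C).

Definition ccurve T f f' :=
  curve T (fun s => Re (f s)) (fun s => Re (f' s)) /\
  curve T (fun s => Im (f s)) (fun s => Im (f' s)).

Lemma ReD (x y : C) : Re (x + y) = Re x + Re y. Proof. by case: x y => [? ?] []. Qed.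
Lemma ImD (x y : C) : Im (x + y) = Im x + Im y. Proof. by case: x y => [? ?] []. Qed.
Lemma ReM (x y : C) : Re (x * y) = Re x * Re y - Im x * Im y.
Proof. by case: x y => [? ?] []. Qed.
Lemma ImM (x y : C) : Im (x * y) = Re x * Im y + Im x * Re y.
Proof. by case: x y => [a b] [c d] /=. Qed.
Lemma eq_ReIm (x y : C) : Re x = Re y -> Im x = Im y -> x = y.
Proof. by case: x y => [a b] [c d] /= -> ->. Qed.

Lemma ccurve_sub T S f f' : S <= T -> ccurve T f f' -> ccurve S f f'.
Proof. by move=> ST [h1 h2]; split; apply: curve_sub ST _. Qed.

Lemma ccurve_ext T f f' g' : (forall s, 0 < s < T -> f' s = g' s) ->
  ccurve T f f' -> ccurve T f g'.
Proof.
by move=> h [h1 h2]; split; [apply: curve_ext h1|apply: curve_ext h2] => s /h ->.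
Qed.

Lemma ccurve_eq T f g f' : f =1 g -> ccurve T f f' -> ccurve T g f'.
Proof. by move=> /funext ->. Qed.

Lemma ccurve_cst T c : ccurve T (fun=> c) (fun=> 0).
Proof. by split; exact: curve_cst. Qed.

Lemma ccurveD T f g f' g' : ccurve T f f' -> ccurve T g g' ->
  ccurve T (fun s => f s + g s) (fun s => f' s + g' s).
Proof.
move=> [f1 f2] [g1 g2]; split.
  under eq_fun do rewrite ReD; under [X in curve _ _ X]eq_fun do rewrite ReD.
  exact: curveD.
under eq_fun do rewrite ImD; under [X in curve _ _ X]eq_fun do rewrite ImD.
exact: curveD.
Qed.

Lemma ccurveM T f g f' g' : ccurve T f f' -> ccurve T g g' ->
  ccurve T (fun s => f s * g s) (fun s => f' s * g s + f s * g' s).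
Proof.
move=> [f1 f2] [g1 g2]; split.
  under eq_fun do rewrite ReM.
  apply: curve_ext (curveB (curveM f1 g1) (curveM f2 g2)) => s _.
  by rewrite ReD !ReM; ring.
under eq_fun do rewrite ImM.
apply: curve_ext (curveD (curveM f1 g2) (curveM f2 g1)) => s _.
by rewrite ImD !ImM; ring.
Qed.

Lemma ccurveZ T c f f' : ccurve T f f' ->
  ccurve T (fun s => c * f s) (fun s => c * f' s).
Proof.
move=> hf; apply: ccurve_ext (ccurveM (ccurve_cst T c) hf) => s _.
by rewrite mul0r add0r.
Qed.

Lemma ccurve_conj T f f' : ccurve T f f' ->
  ccurve T (fun s => (f s)^*) (fun s => (f' s)^*).
Proof.
move=> [f1 f2]; split.
  under eq_fun do rewrite Re_conj; under [X in curve _ _ X]eq_fun do rewrite Re_conj.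
  exact: f1.
under eq_fun do rewrite Im_conj; under [X in curve _ _ X]eq_fun do rewrite Im_conj.
exact: curveN.
Qed.

Lemma ccurveV T f f' : (forall s, 0 <= s <= T -> f s != 0) -> ccurve T f f' ->
  ccurve T (fun s => (f s)^-1) (fun s => - f' s / f s ^+ 2).
Proof.
move=> f0 hf; have [f1 f2] := hf.
(* [1/f] is the conjugate of [f] divided by the real curve [|f|^2]. *)
pose d s := Re (f s) * Re (f s) + Im (f s) * Im (f s).
have dE s : f s * (f s)^* = (d s)%:C by rewrite mulcJ sqr_normcE !expr2.
have d0 s : 0 <= s <= T -> d s != 0.
  move=> hs; have := f0 s hs; apply: contraNN => /eqP d0.
  by have := dE s; rewrite d0 => /eqP; rewrite mulf_eq0 conjC_eq0 orbb.
have cd := curveD (curveM f1 f1) (curveM f2 f2).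
have ci : ccurve T (fun s => ((d s)^-1)%:C) (fun s =>
    (- (Re (f' s) * Re (f s) + Re (f s) * Re (f' s)
      + (Im (f' s) * Im (f s) + Im (f s) * Im (f' s))) / (d s) ^+ 2)%:C).
  by split; [exact: curveV d0 cd | exact: curve_cst].
have := ccurveM (ccurve_conj hf) ci; move=> h.
have E s : (f s)^* * ((d s)^-1)%:C = (f s)^-1.
  have [fs|fs] := eqVneq (f s) 0.
    by rewrite fs conjC0 mul0r invr0.
  by rewrite fmorphV /= -dE; field; rewrite fs conjC_eq0.
apply: ccurve_eq E _; apply: ccurve_ext h => s /andP[s0 sT].
have fs : f s != 0 by apply: f0; rewrite !ltW.
have fJ : (f s)^* != 0 by rewrite conjC_eq0.
have -> : Re (f' s) * Re (f s) + Re (f s) * Re (f' s)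
      + (Im (f' s) * Im (f s) + Im (f s) * Im (f' s))
    = Re (f' s * (f s)^* + f s * (f' s)^*).
  by rewrite ReD !ReM !Re_conj !Im_conj; ring.
have real : (Re (f' s * (f s)^* + f s * (f' s)^*))%:C =
    f' s * (f s)^* + f s * (f' s)^*.
  apply: eq_ReIm => //=; rewrite ImD !ImM !Re_conj !Im_conj; ring.
rewrite rmorphM rmorphN !fmorphV rmorphXn /= real -dE.
by field; rewrite fs fJ.
Qed.

(** The mean value inequality, obtained by projecting on the direction of
    [f T - f 0]. *)
Lemma ccurve_mvt T f f' (g g' : R -> R) : 0 <= T ->
    ccurve T f f' -> curve T g g' ->
    (forall s, 0 < s < T -> normc (f' s) <= g' s) ->
  normc (f T - f 0) <= g T - g 0.
Proof.
move=> T0 [f1 f2] hg h; set w := f T - f 0.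
pose k := normc w; have k0 : 0 <= k by exact: normc_ge0.
pose F s := k * g s - (Re w * Re (f s) + Im w * Im (f s)).
have cF := curveB (curveZ k hg) (curveD (curveZ (Re w) f1) (curveZ (Im w) f2)).
have : F 0 <= F T.
  apply: (curve_homo T0 cF) => s hs; rewrite subr_ge0.
  apply: (@le_trans _ _ (k * normc (f' s))); last by rewrite ler_wpM2l // h.
  have -> : Re w * Re (f' s) + Im w * Im (f' s) = Re (w^* * f' s).
    by rewrite ReM Re_conj Im_conj; ring.
  by rewrite /k -[normc w]normc_conj -normcM Re_le_normc.
rewrite /F => H.
have : k * k <= k * (g T - g 0).
  have -> : k * k = Re w * (Re (f T) - Re (f 0)) + Im w * (Im (f T) - Im (f 0)).
    rewrite -expr2 /k sqr_normcE !expr2 /w.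
    by case: (f T) (f 0) => [a b] [c d] /=.
  lra.
rewrite -/k; have [-> _|kn] := eqVneq k 0.
  rewrite subr_ge0; apply: curve_homo T0 hg _ => s hs.
  exact: le_trans (normc_ge0 _) (h s hs).
by rewrite ler_pM2l // lt_neqAle eq_sym kn.
Qed.

Lemma ccurve_bound T f f' (g g' : R -> R) : 0 <= T ->
    ccurve T f f' -> curve T g g' -> normc (f 0) <= g 0 ->
    (forall s, 0 < s < T -> normc (f' s) <= g' s) ->
  normc (f T) <= g T.
Proof.
move=> T0 hf hg h0 h; have := ccurve_mvt T0 hf hg h.
have := normcD (f T - f 0) (f 0); rewrite subrK; lra.
Qed.

Definition cis (x : R) : C := cos x +i* sin x.

Lemma cisD x y : cis (x + y) = cis x * cis y.
Proof. by apply: eq_ReIm; rewrite ?ReM ?ImM /= ?cosD ?sinD //; ring. Qed.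

Lemma normc_cis x : normc (cis x) = 1.
Proof. by rewrite /normc /= cos2Dsin2 sqrtr1. Qed.

Lemma cis0 : cis 0 = 1.
Proof. by rewrite /cis cos0 sin0. Qed.

Lemma ccurve_cis T (w : R) :
  ccurve T (fun s => cis (w * s)) (fun s => 'i * w%:C * cis (w * s)).
Proof.
have d s : is_derive s (1 : R) (fun s => w * s) w.
  have := @is_deriveZ R R R id w s 1 1 (is_derive_id s 1).
  by move=> h; apply: is_derive_eq h _; rewrite /GRing.scale /= mulr1.
split; apply: curve_everywhere => s.
  have := is_derive1_comp (is_derive_cos (w * s)) (d s).
  by move=> h; apply: is_derive_eq h _ => /=; ring.
have := is_derive1_comp (is_derive_sin (w * s)) (d s).
by move=> h; apply: is_derive_eq h _ => /=; ring.
Qed.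

End ComplexCurves.

(** * Tails of the exponential series and propagation on the lattice *)

Section ExpTail.
Variable R : realType.
Implicit Types (s T : R) (n : nat).

Definition exp_tail n s : R := expR s - \sum_(m < n) s ^+ m / m`!%:R.

Lemma exp_tail0 s : exp_tail 0 s = expR s.
Proof. by rewrite /exp_tail big_ord0 subr0. Qed.

Lemma exp_tailS n s : exp_tail n.+1 s = exp_tail n s - s ^+ n / n`!%:R.
Proof. by rewrite /exp_tail big_ord_recr /= opprD addrA. Qed.

Lemma factR_gt0 n : 0 < n`!%:R :> R.
Proof. by rewrite ltr0n fact_gt0. Qed.

Lemma curve_monomial T n :
  curve T (fun s : R => s ^+ n.+1 / n.+1`!%:R) (fun s => s ^+ n / n`!%:R).
Proof.
elim: n => [|n IH].
  by apply: curve_ext (curveM (curve_id T) (curve_cst T _)) => s _; rewrite mulr0 addr0 expr0.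
have h := curveZ (n.+2%:R^-1) (curveM (curve_id T) IH).
have n2 : n.+2%:R != 0 :> R by rewrite pnatr_eq0.
have n1 : n.+1%:R != 0 :> R by rewrite pnatr_eq0.
have n0 : n`!%:R != 0 :> R by rewrite gt_eqF // factR_gt0.
have n10 : n.+1`!%:R != 0 :> R by rewrite gt_eqF // factR_gt0.
have E s : n.+2%:R^-1 * (s * (s ^+ n.+1 / n.+1`!%:R)) = s ^+ n.+2 / n.+2`!%:R.
  by rewrite [n.+2`!]factS natrM invfM [s ^+ n.+2]exprS; ring.
rewrite -(funext E); apply: curve_ext h => s _.
rewrite mul1r [n.+1`!]factS natrM invfM [s ^+ n.+1]exprS.
have E2 : n.+2%:R = n.+1%:R + 1 :> R by rewrite -natr1.
rewrite E2 in n2 *; move: n0 n1 n2; move: (n.+1%:R : R) (n`!%:R : R) => a F F0 a0 a1.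
by field; rewrite F0 a0 a1.
Qed.

Lemma curve_exp T : curve T (@expR R) (@expR R).
Proof. by apply: curve_everywhere => s; exact: is_derive_expR. Qed.

Lemma curve_exp_tail T n : curve T (exp_tail n.+1) (exp_tail n).
Proof.
elim: n => [|n IH].
  rewrite (funext exp_tail0).
  have -> : exp_tail 1 = (fun s => expR s - 1).
    by apply/funext => s; rewrite exp_tailS exp_tail0 expr0 divr1.
  by apply: curve_ext (curveB (curve_exp T) (curve_cst T 1)) => s _; rewrite subr0.
rewrite (funext (exp_tailS n.+1)).
apply: curve_ext (curveB IH (curve_monomial T n)) => s _.
by rewrite exp_tailS.
Qed.

Lemma exp_tail_at0 n : exp_tail n.+1 0 = 0.
Proof.
rewrite /exp_tail expR0 big_ord_recl big1 => [|i _].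
  by rewrite expr0 divr1 addr0 subrr.
by rewrite lift0 expr0n mul0r.
Qed.

Lemma exp_tail_ge0 n s : 0 <= s -> 0 <= exp_tail n s.
Proof.
elim: n s => [|n IH] s s0; first by rewrite exp_tail0 expR_ge0.
rewrite -(exp_tail_at0 n); apply: curve_homo (curve_exp_tail s n) _ => // u.
by move=> /andP[u0 _]; apply: IH; exact: ltW.
Qed.

Lemma exp_tail_decr n s : 0 <= s -> exp_tail n.+1 s <= exp_tail n s.
Proof.
by move=> s0; rewrite exp_tailS gerBl divr_ge0 ?exprn_ge0 ?(ltW (factR_gt0 _)).
Qed.

Lemma exp_tail_le n s : 0 <= s -> exp_tail n s <= expR s * (s ^+ n / n`!%:R).
Proof.
elim: n s => [|n IH] s s0; first by rewrite exp_tail0 expr0 divr1 mulr1.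
have h := curveB (curveM (curve_exp s) (curve_monomial s n)) (curve_exp_tail s n).
have := curve_homo s0 h; rewrite exp_tail_at0 exprS !mul0r mulr0 subr0 => H.
rewrite -subr_ge0; apply: H => u /andP[u0 us]; rewrite subr_ge0.
apply: le_trans (IH u (ltW u0)) _; rewrite lerDr mulr_ge0 ?expR_ge0 //.
by rewrite divr_ge0 ?exprn_ge0 ?(ltW u0) ?(ltW (factR_gt0 _)).
Qed.

Lemma exp_fact_eps s (e : R) : 0 < e -> exists N, forall n, (N <= n)%N ->
  `|s ^+ n / n`!%:R| <= e.
Proof.
move=> e0.
have : s ^+ n / n`!%:R @[n --> \oo] --> (0 : R).
  by apply/cvg_series_cvg_0; exact: is_cvg_series_exp_coeff.
move/cvgrPdist_le => /(_ e e0)[N _ h]; exists N => n Nn.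
by have := h n Nn; rewrite sub0r normrN.
Qed.

(** Comparison with the linear lattice equation [v_n' = v_{n-1} + v_{n+1}]:
    [e^s exp_tail n s] is a supersolution. The bound is proved up to an error
    [(2s)^K/K!], which gains one power of [s] at each integration. *)
Lemma lattice_propagation (T : R) (f f' : nat -> R -> R[i]) : 0 <= T ->
    (forall n, ccurve T (f n) (f' n)) ->
    (forall n s, 0 <= s <= T -> normc (f n s) <= 1) ->
    (forall n, f n.+1 0 = 0) ->
    (forall n s, 0 < s < T ->
       normc (f' n.+1 s) <= normc (f n s) + normc (f n.+2 s)) ->
  forall n s, 0 <= s <= T -> normc (f n s) <= expR s * exp_tail n s.
Proof.
move=> T0 cf f1 f0 hf n s hs.
have bnd K : forall n s, 0 <= s <= T ->
    normc (f n s) <= expR s * exp_tail n s + 2 ^+ K * (s ^+ K / K`!%:R).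
  elim: K => [|K IH] {n s hs} [|n] s /andP[s0 sT].
  - rewrite !expr0 divr1 mulr1; apply: le_trans (f1 _ _ _) _; first by rewrite s0.
    by rewrite lerDr mulr_ge0 ?expR_ge0 ?exp_tail_ge0.
  - rewrite !expr0 divr1 mulr1; apply: le_trans (f1 _ _ _) _; first by rewrite s0.
    by rewrite lerDr mulr_ge0 ?expR_ge0 ?exp_tail_ge0.
  - apply: le_trans (f1 _ _ _) _; first by rewrite s0.
    rewrite exp_tail0 -expRD; apply: (@le_trans _ _ (expR (s + s))).
      by rewrite -[leLHS](@expR0 R) ler_expR addr_ge0.
    by rewrite lerDl mulr_ge0 ?exprn_ge0 // divr_ge0 ?exprn_ge0 ?(ltW (factR_gt0 _)).
  have cg := curveD (curveM (curve_exp s) (curve_exp_tail s n))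
                    (curveZ (2 ^+ K.+1) (curve_monomial s K)).
  apply: (ccurve_bound s0 (ccurve_sub sT (cf n.+1)) cg).
    by rewrite f0 normc0 exp_tail_at0 mulr0 expr0n mul0r mulr0 addr0.
  move=> u /andP[u0 us]; have uT : u < T by exact: lt_le_trans us sT.
  have hu : 0 <= u <= T by rewrite !ltW.
  apply: le_trans (hf n u _) _; first by rewrite u0 uT.
  have hE := exp_tail_decr n.+1 (ltW u0).
  have h1 := IH n u hu; have h2 := IH n.+2 u hu.
  have : expR u * exp_tail n.+2 u <= expR u * exp_tail n.+1 u.
    by rewrite ler_wpM2l ?expR_ge0.
  rewrite exprS; lra.
apply/ler_addgt0Pr => e e0.
have [N hN] := exp_fact_eps (2 * s) e0.
apply: le_trans (bnd N n s hs) _; rewrite lerD2l mulrA -exprMn.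
by apply: le_trans (ler_norm _) _; exact: hN.
Qed.

End ExpTail.

(** * The flow: conservation law and Lax pair *)

Lemma window_last (l K b : nat) :
  - K%:Z + (K + (l.+1 + b))%N%:Z - 1 = l%:Z + b%:Z.
Proof. lia. Qed.

Section Windows.
Variable R : realType.
Local Notation C := R[i].
Implicit Types (p : int -> C) (L : int) (m : nat).

Fixpoint window p L m : seq C :=
  if m is m'.+1 then p L :: window p (L + 1) m' else [::].

Lemma window_cat p L a b :
  window p L (a + b) = window p L a ++ window p (L + a%:Z) b.
Proof.
elim: a L => [|a IH] L /=; first by rewrite addr0.
by rewrite IH -addrA -intS.
Qed.

Lemma nth_window p L m k : (k < m)%N -> nth 0 (window p L m) k = p (L + k%:Z).
Proof.
elim: m L k => [//|m IH] L [|k] /= km; first by rewrite addr0.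
by rewrite IH // -addrA -intS.
Qed.

Lemma window_sample p m len : window p m%:Z len = sample p m len.
Proof.
elim: len m => [//|len IH] m /=.
have -> : m%:Z + 1 = m.+1%:Z by rewrite intS addrC.
by rewrite IH.
Qed.

Lemma window_zero p L m : (forall k, (k < m)%N -> p (L + k%:Z) = 0) ->
  window p L m = nseq m 0.
Proof.
elim: m L => [//|m IH] L h /=; rewrite -[X in p X]addr0 (h 0%N) // IH // => k km.
by rewrite -addrA -intS h.
Qed.

Lemma window_contractive p L m : (forall k, normc (p k) < 1) ->
  contractive (window p L m).
Proof. by move=> h; elim: m L => [//|m IH] L /=; rewrite h IH. Qed.

Lemma sample_contractive p m len : (forall k, normc (p k) < 1) ->
  contractive (sample p m len).
Proof. by move=> h; rewrite /contractive all_map; apply/allP => k _ /=. Qed.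

Lemma defect_cat (s1 s2 : seq C) : defect (s1 ++ s2) = defect s1 * defect s2.
Proof. exact: big_cat. Qed.

Lemma defect_nseq0 m : defect (nseq m (0 : C)) = 1.
Proof.
elim: m => [|m IH]; rewrite /defect ?big_nil //= big_cons -/(defect _) IH.
by rewrite normc0 expr0n subr0 mulr1.
Qed.

Lemma defect_le1 (s : seq C) : contractive s -> defect s <= 1.
Proof.
elim: s => [|b s IH] /=; first by rewrite /defect big_nil.
move=> /andP[b1 hs]; rewrite /defect big_cons -/(defect s).
by rewrite mulr_ile1 ?IH ?(ltW (defect_gt0 hs)) // ?gerBl ?sqr_ge0 //
  subr_ge0 -(expr1n _ 2) ler_pXn2r ?nnegrE ?normc_ge0 // ltW.
Qed.

End Windows.

Section Flow.
Variable R : realType.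
Local Notation C := R[i].
Local Notation Re := (@complex.Re R).
Local Notation Im := (@complex.Im R).
Variables (q0 : int -> C) (q : R -> int -> C) (t : R).
Hypotheses (t0 : 0 < t) (hq0 : forall k, normc (q0 k) < 1).
Hypothesis hq : AL_solution q0 q.
Implicit Types (k L : int) (s : R).

Lemma sol_curve k : ccurve t (fun s => q s k) (fun s => AL_rhs q s k).
Proof.
have [_ cq dq] := hq; have [c1 c2] := cq k.
have sub : `[0, t] `<=` `[0, +oo[.
  by move=> x /=; rewrite !in_itv /= andbT => /andP[].
split; split; first 1 last.
- by move=> s /andP[s0 _]; have [] := dq s k s0.
- exact: continuous_subspaceW sub c2.
- by move=> s /andP[s0 _]; have [] := dq s k s0.
exact: continuous_subspaceW sub c1.
Qed.

(** The current through the bond between [k - 1] and [k] in the conservation law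
    for [log (1 - |q_k|^2)]. *)
Definition flux s k : R := 2 * Im ((q s k)^* * q s (k - 1)).

Let gap k s := 1 - normc (q s k) ^+ 2.

Lemma gap_curve k :
  curve t (gap k) (fun s => gap k s * (flux s k - flux s (k + 1))).
Proof.
have [c1 c2] := sol_curve k.
have E s : 1 - (Re (q s k) * Re (q s k) + Im (q s k) * Im (q s k)) = gap k s.
  by rewrite /gap sqr_normcE !expr2.
rewrite -(funext E).
apply: curve_ext (curveB (curve_cst t 1) (curveD (curveM c1 c1) (curveM c2 c2))) => s _.
rewrite E /flux /AL_rhs -/(gap k s) addrK !ReM !ImM ReD ImD !Re_conj !Im_conj /=.
move: (gap k s) (Re (q s k)) (Im (q s k)) (Re (q s (k - 1))) (Im (q s (k - 1)))
  (Re (q s (k + 1))) (Im (q s (k + 1))) => *; ring.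
Qed.

Lemma flux_curve k : exists f', curve t (flux^~ k) f'.
Proof.
have [_ c] := ccurveM (ccurve_conj (sol_curve k)) (sol_curve (k - 1)).
have h := curveZ 2 c.
by eexists; exact: h.
Qed.

(** [1 - |q_k|^2] solves a linear equation [u' = u g]; with [|g| <= M] on a
    compact interval, [u^2 e^{2Ms}] is nondecreasing, so [u] cannot vanish. *)
Lemma sol_lt1 k s : 0 <= s <= t -> normc (q s k) < 1.
Proof.
move=> /andP[s0 st].
have [f1 h1] := flux_curve k; have [f2 h2] := flux_curve (k + 1).
have cg := curve_sub st (curveB h1 h2).
have cu := curve_sub st (gap_curve k).
set g := fun s => flux s k - flux s (k + 1) in cg.
have [c _ hM] := EVT_max s0 (curveM cg cg).1.
pose M := g c * g c + 1.
have gM x : 0 <= x <= s -> - M <= g x.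
  move=> hx; have := hM x; rewrite in_itv /= => /(_ hx) h.
  rewrite /M; have := sqr_ge0 (g x + 1 / 2); have := sqr_ge0 (g x); rewrite !expr2; lra.
have cH x : x <= s -> curve x _ _ := fun xs =>
  curve_sub xs (curveM (curveM cu cu) (curve_expR s (2 * M))).
have u00 : 0 < gap k 0.
  rewrite /gap; have [E _ _] := hq; rewrite E.
  by rewrite subr_gt0 -(expr1n _ 2) ltr_pXn2r ?nnegrE ?normc_ge0 ?hq0.
have nz x : 0 <= x <= s -> gap k x != 0.
  move=> /andP[x0 xs]; apply/eqP => ux.
  have := curve_homo x0 (cH x xs); rewrite ux !mul0r mulr0 expR0 mulr1.
  have pos : 0 < gap k 0 * gap k 0 by exact: mulr_gt0.
  move=> H; suff : gap k 0 * gap k 0 <= 0 by rewrite leNgt pos.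
  apply: H => y /andP[y0 yx].
  have := gM y; rewrite (ltW y0) (le_trans (ltW yx) xs) => /(_ isT).
  rewrite -/(g y) => gy.
  have e0 : 0 <= expR (2 * M * y) by exact: expR_ge0.
  have -> : (gap k y * g y * gap k y + gap k y * (gap k y * g y)) * expR (2 * M * y)
      + gap k y * gap k y * (2 * M * expR (2 * M * y))
      = 2 * (gap k y ^+ 2 * expR (2 * M * y)) * (g y + M) by ring.
  have gM0 : 0 <= g y + M by lra.
  by rewrite mulr_ge0 // mulr_ge0 // mulr_ge0 ?sqr_ge0.
suff : 0 < gap k s.
  rewrite /gap subr_gt0 => h.
  by rewrite -(@ltr_pXn2r _ 2) ?nnegrE ?normc_ge0 // expr1n.
rewrite ltNge; apply/negP => us.
have [c' c's /eqP] : exists2 c, c \in `[0, s] & gap k c = 0.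
  apply: IVT => //; first exact: cu.1.
  by rewrite ge_min us orbT le_max (ltW u00).
by rewrite in_itv /= in c's; rewrite (negPf (nz _ c's)).
Qed.

Lemma AL_rhs_le k s : 0 <= s <= t ->
  normc (AL_rhs q s k) <= normc (q s (k - 1)) + normc (q s (k + 1)).
Proof.
move=> hs; rewrite /AL_rhs !normcM normc_i mul1r normc_real.
apply: le_trans (normcD _ _); rewrite ler_piMl ?normc_ge0 //.
have h := sol_lt1 k hs; have := normc_ge0 (q s k) => n0.
by rewrite ger0_norm ?gerBl ?sqr_ge0 // subr_ge0 -(expr1n _ 2) ler_pXn2r ?nnegrE // ltW.
Qed.

Variable l : nat.
Hypothesis hl : forall k : int, q0 k != 0 -> 0 <= k <= l%:Z.

Lemma datum_zero k : (k < 0) || (l%:Z < k) -> q0 k = 0.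
Proof.
move=> h; apply/eqP; apply: contraTT h => /hl /andP[k0 kl].
by rewrite negb_or -!leNgt k0 kl.
Qed.

Lemma sol_left_tail n s : 0 <= s <= t ->
  normc (q s (- n%:Z)) <= expR s * exp_tail n s.
Proof.
apply: (@lattice_propagation R t (fun n s => q s (- n%:Z))
  (fun n s => AL_rhs q s (- n%:Z)) (ltW t0)) => [m|m u hu|m|m u /andP[u0 ut]].
- exact: sol_curve.
- exact: ltW (sol_lt1 _ hu).
- by have [-> _ _] := hq; apply: datum_zero; rewrite oppr_lt0.
have hu : 0 <= u <= t by rewrite !ltW.
apply: le_trans (AL_rhs_le _ hu) _; rewrite addrC.
have -> : - m.+1%:Z + 1 = - m%:Z by lia.
by have -> : - m.+1%:Z - 1 = - m.+2%:Z by lia.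
Qed.

Lemma sol_right_tail n s : 0 <= s <= t ->
  normc (q s (l%:Z + n%:Z)) <= expR s * exp_tail n s.
Proof.
apply: (@lattice_propagation R t (fun n s => q s (l%:Z + n%:Z))
  (fun n s => AL_rhs q s (l%:Z + n%:Z)) (ltW t0)) => [m|m u hu|m|m u /andP[u0 ut]].
- exact: sol_curve.
- exact: ltW (sol_lt1 _ hu).
- by have [-> _ _] := hq; apply: datum_zero; apply/orP; right; lia.
have hu : 0 <= u <= t by rewrite !ltW.
apply: le_trans (AL_rhs_le _ hu) _.
have -> : l%:Z + m.+1%:Z - 1 = l%:Z + m%:Z by lia.
by have -> : l%:Z + m.+1%:Z + 1 = l%:Z + m.+2%:Z by lia.
Qed.

Lemma exp_tail_unif n s : 0 <= s <= t ->
  expR s * exp_tail n s <= expR t * expR t * (t ^+ n / n`!%:R).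
Proof.
move=> /andP[s0 st]; rewrite -mulrA ler_pM ?expR_ge0 ?exp_tail_ge0 ?ler_expR //.
apply: le_trans (exp_tail_le n s0) _.
rewrite ler_pM ?expR_ge0 ?ler_expR ?divr_ge0 ?exprn_ge0 ?(ltW (factR_gt0 _ _)) //.
by rewrite ler_wpM2r ?invr_ge0 ?(ltW (factR_gt0 _ _)) // lerXn2r ?nnegrE // ltW.
Qed.

Lemma flux_le k s : 0 <= s <= t ->
  `|flux s k| <= 2 * normc (q s k) /\ `|flux s k| <= 2 * normc (q s (k - 1)).
Proof.
move=> hs; have h1 := sol_lt1 k hs; have h2 := sol_lt1 (k - 1) hs.
have imle (x : C) : `|Im x| <= normc x.
  apply: le_of_sqr; rewrite ?normr_ge0 ?normc_ge0 //.
  by rewrite real_normK ?num_real // sqr_normcE lerDr sqr_ge0.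
have : `|flux s k| <= 2 * (normc (q s k) * normc (q s (k - 1))).
  rewrite /flux normrM ger0_norm // ler_wpM2l //.
  by apply: le_trans (imle _) _; rewrite normcM normc_conj.
have n1 := normc_ge0 (q s k); have n2 := normc_ge0 (q s (k - 1)).
by split; nra.
Qed.

Lemma defect_curve L m : curve t (fun s => defect (window (q s) L m))
  (fun s => defect (window (q s) L m) * (flux s L - flux s (L + m%:Z))).
Proof.
elim: m L => [|m IH] L /=.
  have -> : (fun s => defect ([::] : seq C)) = fun=> (1 : R).
    by apply/funext => s; rewrite /defect big_nil.
  by apply: curve_ext (curve_cst t 1) => s _; rewrite addr0 subrr mulr0.
have E s : gap L s * defect (window (q s) (L + 1) m)
    = defect (q s L :: window (q s) (L + 1) m) by rewrite /defect big_cons.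
rewrite -(funext E); apply: curve_ext (curveM (gap_curve L) (IH (L + 1))) => s _.
by rewrite -E -addrA -intS; ring.
Qed.

Lemma sol_window_contractive L m s : 0 <= s <= t -> contractive (window (q s) L m).
Proof. by move=> hs; apply: window_contractive => k; exact: sol_lt1. Qed.

Lemma datum_window n b : window q0 (- n%:Z) (n + (l.+1 + b)) =
  nseq n 0 ++ (sample q0 0 l.+1 ++ nseq b 0).
Proof using hl.
rewrite !window_cat addNr (@window_zero _ _ _ n); last first.
  by move=> k kn; apply: datum_zero; apply/orP; left; clear -kn; lia.
rewrite -window_sample (@window_zero _ _ _ b) // => k kb.
by apply: datum_zero; apply/orP; right; clear -kb; lia.
Qed.

Lemma sample_defect :
  defect (sample q0 0 l.+1) = \prod_(0 <= k < l.+1) (1 - normc (q0 k%:Z) ^+ 2).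
Proof. by rewrite /defect big_map. Qed.

Variable eta : R.
Hypotheses (eta0 : 0 < eta).
Hypothesis hprod : eta <= \prod_(0 <= k < l.+1) (1 - normc (q0 k%:Z) ^+ 2).

(** The product over a window changes only through the fluxes at its two ends,
    which vanish as the window grows; smaller windows have larger products. *)
Lemma sol_defect n b : eta <= defect (window (q t) (- n%:Z) (n + (l.+1 + b))).
Proof.
apply: (@ler_eps_mul _ _ _ (eta * t)) => e e0.
set B := 4 * (expR t * expR t).
have B0 : 0 < B by rewrite mulr_gt0 // mulr_gt0 // expR_gt0.
have [N hN] := @exp_fact_eps R t (e / B) (divr_gt0 e0 B0).
have small (k : nat) : (N <= k)%N -> 2 * (expR t * expR t * (t ^+ k / k`!%:R)) <= e / 2.
  move=> /hN /(le_trans (ler_norm _)); rewrite ler_pdivlMr // /B; lra.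
pose K := (N + n)%N; pose b' := (b + N)%N.
have tt : 0 <= t <= t by rewrite ltW ?lexx.
have sub : defect (window (q t) (- K%:Z) (K + (l.+1 + b')))
    <= defect (window (q t) (- n%:Z) (n + (l.+1 + b))).
  have -> : (K + (l.+1 + b') = N + ((n + (l.+1 + b)) + N))%N by rewrite /K /b'; lia.
  rewrite window_cat; have -> : - K%:Z + N%:Z = - n%:Z by rewrite /K; lia.
  rewrite window_cat !defect_cat mulrCA ler_piMr //.
    exact: ltW (defect_gt0 (sol_window_contractive _ _ tt)).
  by rewrite mulr_ile1 ?defect_le1 ?(ltW (defect_gt0 _)) ?sol_window_contractive.
apply: (@le_trans _ _ (defect (window (q t) (- K%:Z) (K + (l.+1 + b')))
  + e * (eta * t))); last by rewrite lerD2r.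
set m := (K + (l.+1 + b'))%N.
have c := curveM (defect_curve (- K%:Z) m) (curve_expR t e).
have := curve_homo (ltW t0) c.
rewrite mulr0 expR0 mulr1 => H.
have hd : defect (window (q 0) (- K%:Z) m) <=
    defect (window (q t) (- K%:Z) m) * expR (e * t).
  apply: H => s /andP[s0 st]; have hs : 0 <= s <= t by rewrite !ltW.
  set D := defect _; have D0 : 0 <= D.
    exact: ltW (defect_gt0 (sol_window_contractive _ _ hs)).
  have -> : D * (flux s (- K%:Z) - flux s (- K%:Z + m%:Z)) * expR (e * s)
      + D * (e * expR (e * s))
      = D * expR (e * s) * (e + (flux s (- K%:Z) - flux s (- K%:Z + m%:Z))) by ring.
  rewrite mulr_ge0 ?mulr_ge0 ?expR_ge0 //.
  have [f1 _] := flux_le (- K%:Z) hs.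
  have [_ f2] := flux_le (- K%:Z + m%:Z) hs.
  have f1' := le_trans (sol_left_tail K hs) (exp_tail_unif K hs).
  rewrite (window_last l K b') in f2.
  have f2' := le_trans (sol_right_tail b' hs) (exp_tail_unif b' hs).
  have s1 := small K (leq_addr _ _); have s2 := small b' (leq_addl _ _).
  have a1 := ler_norm (- flux s (- K%:Z)); rewrite normrN in a1.
  have a2 := ler_norm (flux s (- K%:Z + m%:Z)); lra.
have d0 : eta <= defect (window (q 0) (- K%:Z) m).
  have -> : q 0 = q0 by have [E _ _] := hq; apply/funext => k; exact: E.
  by rewrite datum_window !defect_cat !defect_nseq0 mulr1 mul1r sample_defect.
set D := defect (window (q t) _ _) in hd *.
have D0 : 0 <= D by exact: ltW (defect_gt0 (sol_window_contractive _ _ tt)).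
have : eta * expR (- (e * t)) <= D.
  by rewrite expRN ler_pdivrMr ?expR_gt0 // (le_trans d0).
have : eta * (1 - e * t) <= eta * expR (- (e * t)).
  by rewrite ler_wpM2l ?(ltW eta0) //; exact: expR_ge1Dx.
lra.
Qed.

End Flow.

Section LaxPair.
Variable R : realType.
Local Notation C := R[i].
Variables (q0 : int -> C) (q : R -> int -> C) (t : R).
Hypotheses (t0 : 0 < t) (hq0 : forall k, normc (q0 k) < 1).
Hypothesis hq : AL_solution q0 q.
Variable (z : C).
Hypothesis z1 : normc z = 1.
Implicit Types (k L : int) (s : R).

Let num m L s := (layers (window (q s) L m)).1.[z].
Let den m L s := (layers (window (q s) L m)).2.[z].

(** The entries of the matrix [A_k] with rows [(d, conj o)] and [(o, conj d)],
    where [d] is [lax_diag] and [o] is [lax_off], after conjugation by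
    [diag (1, z^k)]. *)
Definition lax_diag k s : C :=
  'i * (q s (k - 1))^* * q s k - 'i * (z + z^-1) / 2.
Definition lax_off k s : C := 'i * (q s (k - 1) - z^-1 * q s k).

(** The zero curvature equation [S_k' = A_k S_k - S_k A_{k+1}] for the transfer
    matrices telescopes along the window; this is the first column of the
    result. The terms in [L + m] are the contribution of the right end. *)
Lemma lax_window m L :
  ccurve t (den m L) (fun s =>
    lax_diag L s * den m L s + (lax_off L s)^* * num m L s
    - (den m L s * lax_diag (L + m%:Z) s
       + (num m L s)^* * (z ^+ m * lax_off (L + m%:Z) s))) /\
  ccurve t (num m L) (fun s =>
    lax_off L s * den m L s + (lax_diag L s)^* * num m L s
    - (num m L s * lax_diag (L + m%:Z) s
       + (den m L s)^* * (z ^+ m * lax_off (L + m%:Z) s))).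
Proof.
have zu : z != 0 by rewrite -normc_gt0 z1.
have zJ : z^* = z^-1 by exact: conjc_inv_unit.
have iJ : ('i : C)^* = - 'i by rewrite conjCi.
have two : (2 : C)^* = 2 by rewrite conjC_nat.
elim: m L => [|m IH] L.
  have -> : den 0 L = fun=> 1 by apply/funext => s; rewrite /den /= hornerC.
  have -> : num 0 L = fun=> 0 by apply/funext => s; rewrite /num /= horner0.
  split.
    apply: ccurve_ext (ccurve_cst t 1) => s _.
    by rewrite addr0 conjC0; ring.
  apply: ccurve_ext (ccurve_cst t 0) => s _.
  by rewrite addr0 conjC1 expr0; ring.
have [cd cn] := IH (L + 1).
have cq := @sol_curve _ _ _ t hq L.
have dE s : den m (L + 1) s + (q s L)^* * (z * num m (L + 1) s) = den m.+1 L s.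
  by rewrite /den /num /= !(hornerD, hornerZ, hornerM, hornerX).
have nE s : q s L * den m (L + 1) s + z * num m (L + 1) s = num m.+1 L s.
  by rewrite /den /num /= !(hornerD, hornerZ, hornerM, hornerX).
have idx : L + m.+1%:Z = L + 1 + m%:Z by rewrite intS addrA.
split.
  apply: (ccurve_eq dE).
  apply: ccurve_ext (ccurveD cd (ccurveM (ccurve_conj cq) (ccurveZ z cn))) => s _.
  rewrite -dE -nE idx /AL_rhs /lax_diag /lax_off addrK.
  move: (L + 1 + m%:Z) (den m _ s) (num m _ s) => L' d u.
  have uE : (1 - normc (q s L) ^+ 2)%:C = 1 - q s L * (q s L)^*.
    by rewrite rmorphB rmorph1 mulcJ.
  rewrite uE !(rmorphB, rmorphM, rmorphD, fmorphV, rmorph1) /= !conjCK ?iJ ?zJ ?two exprS.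
  by field; rewrite zu.
apply: (ccurve_eq nE).
apply: ccurve_ext (ccurveD (ccurveM cq cd) (ccurveZ z cn)) => s _.
rewrite -dE -nE idx /AL_rhs /lax_diag /lax_off addrK.
move: (L + 1 + m%:Z) (den m _ s) (num m _ s) => L' d u.
have uE : (1 - normc (q s L) ^+ 2)%:C = 1 - q s L * (q s L)^*.
  by rewrite rmorphB rmorph1 mulcJ.
rewrite uE !(rmorphB, rmorphM, rmorphD, fmorphV, rmorph1) /= !conjCK ?iJ ?zJ ?two exprS.
by field; rewrite zu.
Qed.

Lemma circle_sum_real : z + z^-1 = (2 * complex.Re z)%:C.
Proof.
rewrite -(conjc_inv_unit z1); apply: eq_ReIm.
  by rewrite ReD Re_conj /=; ring.
by rewrite ImD Im_conj subrr.
Qed.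

Let w : R := 2 * complex.Re z.

(** The ratio [r] of the first column solves a Riccati equation
    [r' = i (z + 1/z) r + ...] in which every other term contains a value of
    the solution next to one end of the window. *)
Lemma lax_ratio m L (g g' : R -> R) : curve t g g' ->
    (forall s, 0 < s < t ->
      2 * (normc (q s (L - 1)) + normc (q s L))
      + 2 * (normc (q s (L - 1)) * normc (q s L))
      + (normc (q s (L + m%:Z - 1)) + normc (q s (L + m%:Z))) <= g' s) ->
  normc (num m L t / den m L t - cis (w * t) * (num m L 0 / den m L 0))
    <= g t - g 0.
Proof.
move=> hg hb.
have zu : z != 0 by rewrite -normc_gt0 z1.
have zJ : z^* = z^-1 by exact: conjc_inv_unit.
have iJ : ('i : C)^* = - 'i by rewrite conjCi.
have two : (2 : C)^* = 2 by rewrite conjC_nat.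
have wE : w%:C = z + z^-1 by rewrite circle_sum_real.
have gap s : 0 <= s <= t -> 0 < normc (den m L s) ^+ 2 - normc (num m L s) ^+ 2.
  move=> hs; rewrite layers_defect // defect_gt0 //.
  exact: sol_window_contractive hs.
have den0 s : 0 <= s <= t -> den m L s != 0.
  move=> hs; rewrite -normc_gt0 lt_neqAle normc_ge0 andbT eq_sym.
  apply: contraTneq (gap s hs) => ->.
  by rewrite expr0n sub0r oppr_gt0 -leNgt sqr_ge0.
have [cd cn] := lax_window m L.
have cr := ccurveM cn (ccurveV den0 cd).
have cphi := ccurveM (ccurve_cis t (- w)) cr.
have H := ccurve_mvt (ltW t0) cphi hg _.
have -> : num m L t / den m L t - cis (w * t) * (num m L 0 / den m L 0) =
    cis (w * t) * (cis (- w * t) * (num m L t * (den m L t)^-1)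
                   - cis (- w * 0) * (num m L 0 * (den m L 0)^-1)).
  rewrite mulr0 cis0 mul1r mulrBr [cis (w * t) * (cis _ * _)]mulrA -cisD.
  by rewrite mulNr subrr cis0 mul1r.
rewrite normcM normc_cis mul1r; apply: H => s /andP[s0 st].
have hs : 0 <= s <= t by rewrite !ltW.
apply: le_trans (hb s _); last by rewrite s0 st.
have dn := den0 s hs; have gp := gap s hs.
set d := den m L s in dn gp *; set u := num m L s in gp *.
set gL := lax_off L s; set gR := lax_off (L + m%:Z) s.
pose r := u / d.
set lhs := _ + _.
have -> : lhs = cis (- w * s) * (gL
    - 'i * ((q s (L - 1))^* * q s L + q s (L - 1) * (q s L)^*) * r
    - gL^* * r ^+ 2 - z ^+ m * gR * ((d * d^* - u * u^*) / d ^+ 2)).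
  have aJ : (lax_diag L s)^* = - 'i * q s (L - 1) * (q s L)^* + 'i * (z + z^-1) / 2.
    rewrite /lax_diag !(rmorphB, rmorphM, rmorphD, fmorphV) /= conjCK ?iJ ?zJ ?two.
    by field; rewrite zu.
  rewrite /lhs -/d -/u -/gL -/gR aJ {1}/lax_diag [in X in _ + X]/lax_diag rmorphN /= wE.
  by rewrite /r; field; rewrite dn zu.
rewrite normcM normc_cis mul1r.
have r1 : normc r <= 1.
  rewrite /r normcM normcV ler_pdivrMr ?normc_gt0 // mul1r.
  by apply: le_of_sqr; rewrite ?normc_ge0 // -subr_ge0 ltW.
have dd1 : normc ((d * d^* - u * u^*) / d ^+ 2) <= 1.
  rewrite normcM normcV normcX !mulcJ -rmorphB normc_real ger0_norm ?(ltW gp) //.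
  rewrite ler_pdivrMr ?exprn_gt0 ?normc_gt0 // mul1r gerBl; exact: sqr_ge0.
have off k : normc (lax_off k s) <= normc (q s (k - 1)) + normc (q s k).
  rewrite normcM normc_i mul1r; apply: le_trans (normcB _ _) _.
  by rewrite normcM normcV z1 invr1 mul1r.
have hL := off L; have hR := off (L + m%:Z); rewrite -/gL in hL; rewrite -/gR in hR.
apply: le_trans (normcB _ _) _; apply: le_trans (lerD (normcB _ _) (lexx _)) _.
apply: le_trans (lerD (lerD (normcB _ _) (lexx _)) (lexx _)) _.
rewrite [normc (z ^+ m * _ * _)]normcM [normc (z ^+ m * _)]normcM normcX z1 expr1n mul1r.
rewrite [normc (gL^* * _)]normcM normcX normc_conj.
rewrite [normc ('i * _ * _)]normcM [normc ('i * _)]normcM normc_i mul1r.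
set A := normc (_ + _).
have hA : A <= 2 * (normc (q s (L - 1)) * normc (q s L)).
  by apply: le_trans (normcD _ _) _; rewrite !normcM !normc_conj; lra.
have A0 : 0 <= A by exact: normc_ge0.
have n1 : 0 <= normc gL by exact: normc_ge0.
have n2 : 0 <= normc gR by exact: normc_ge0.
have r0 : 0 <= normc r by exact: normc_ge0.
have x1 : A * normc r <= A by rewrite ler_piMr.
have x2 : normc gL * normc r ^+ 2 <= normc gL.
  by rewrite ler_piMr // -(expr1n _ 2) ler_pXn2r ?nnegrE.
have x3 : normc gR * normc ((d * d^* - u * u^*) / d ^+ 2) <= normc gR.
  by rewrite ler_piMr.
lra.
Qed.

End LaxPair.

(** * Fourier coefficients of [exp (it (z + 1/z))] *)

Section CircleMean.
Variable R : realType.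
Local Notation mu := (@lebesgue_measure R).
Implicit Types (f g F : R -> R) (c : R).

Definition circle_mean f : R := (2 * pi)^-1 * \int[mu]_(x in `[0, 2 * pi]) f x.

Lemma twopi_gt0 : 0 < 2 * pi :> R.
Proof. by rewrite mulr_gt0 // pi_gt0. Qed.

Lemma circle_integrable f : continuous f -> mu.-integrable `[0, 2 * pi] (EFin \o f).
Proof.
move=> cf; apply: continuous_compact_integrable; first exact: segment_compact.
exact: continuous_subspaceT.
Qed.

Lemma circle_meanD f g : continuous f -> continuous g ->
  circle_mean (fun x => f x + g x) = circle_mean f + circle_mean g.
Proof.
move=> cf cg; rewrite /circle_mean -[RHS]mulrDr; congr (_ * _).
exact: RintegralD (circle_integrable cf) (circle_integrable cg).
Qed.

Lemma circle_meanZ c f : continuous f ->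
  circle_mean (fun x => c * f x) = c * circle_mean f.
Proof.
move=> cf; rewrite /circle_mean RintegralZl //; last exact: circle_integrable.
by rewrite mulrCA.
Qed.

Lemma circle_mean_cst c : circle_mean (fun=> c) = c.
Proof.
rewrite /circle_mean Rintegral_cst //= lebesgue_measure_itv /= lte_fin twopi_gt0.
rewrite -EFinB /= subr0 mulrCA mulVf ?mulr1 //.
by rewrite gt_eqF // twopi_gt0.
Qed.

Lemma circle_mean_le f g : continuous f -> continuous g -> (forall x, f x <= g x) ->
  circle_mean f <= circle_mean g.
Proof.
move=> cf cg fg; rewrite ler_wpM2l ?invr_ge0 ?(ltW twopi_gt0) //.
exact: le_Rintegral (circle_integrable cf) (circle_integrable cg) (fun x _ => fg x).
Qed.

Lemma is_derive_continuous F f : (forall x, is_derive x (1 : R) F (f x)) -> continuous F.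
Proof.
move=> h x; apply: differentiable_continuous; apply/derivable1_diffP.
by have [] := h x.
Qed.

Lemma circle_mean_derive F f : (forall x, is_derive x (1 : R) F (f x)) ->
  continuous f -> F (2 * pi) = F 0 -> circle_mean f = 0.
Proof.
move=> dF cf F0; have cF := is_derive_continuous dF.
rewrite /circle_mean /Rintegral (@continuous_FTC2 _ f F) ?twopi_gt0 //.
- by rewrite F0 -EFinB subrr /= mulr0.
- exact: continuous_subspaceT.
- split=> [x _| |].
  + by have [] := dF x.
  + by apply: cvg_at_right_filter; exact: cF.
  + by apply: cvg_at_left_filter; exact: cF.
by move=> x _; rewrite derive1E; have [] := dF x.
Qed.

(** Real part of [e^{i (2 s cos x - k x + c)}]; the phase [c] gives access to the
    imaginary part, so that one family of real integrals suffices. *)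
Definition osc c (k : int) (s x : R) : R := cos (2 * s * cos x - k%:~R * x + c).

Let dphase_x c (k : int) (s x : R) :
  is_derive x (1 : R) (fun x => 2 * s * cos x - k%:~R * x + c) (- (2 * s * sin x) - k%:~R).
Proof.
have h1 := @is_deriveZ R R R cos (2 * s) x 1 _ (is_derive_cos x).
have h2 := @is_deriveZ R R R id k%:~R x 1 _ (is_derive_id x 1).
have h3 := @is_deriveB R R R _ _ x 1 _ _ h1 h2.
have h := @is_deriveD R R R _ _ x 1 _ _ h3 (is_derive_cst c x 1).
by apply: is_derive_eq h _; rewrite /GRing.scale /=; ring.
Qed.

Let dphase_s c (k : int) (s x : R) :
  is_derive s (1 : R) (fun s => 2 * s * cos x - k%:~R * x + c) (2 * cos x).
Proof.
have h1 := @is_deriveZ R R R id (2 * cos x) s 1 _ (is_derive_id s 1).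
have h := @is_deriveD R R R _ _ s 1 _ _ h1 (is_derive_cst (- (k%:~R * x) + c) s 1).
have E u : 2 * cos x * u + (- (k%:~R * x) + c) = 2 * u * cos x - k%:~R * x + c by ring.
rewrite -(funext E); apply: is_derive_eq h _; rewrite /GRing.scale /=; ring.
Qed.

Lemma osc_continuous c k s : continuous (osc c k s).
Proof.
have h x := is_derive1_comp (is_derive_cos _) (dphase_x c k s x).
exact: is_derive_continuous h.
Qed.

Lemma osc_derive c k s x :
  is_derive s (1 : R) (fun s => osc c k s x)
    (osc (c + pi / 2) (k - 1) s x + osc (c + pi / 2) (k + 1) s x).
Proof.
have := is_derive1_comp (is_derive_cos _) (dphase_s c k s x).
move=> h; apply: is_derive_eq h _; rewrite /osc rmorphB rmorphD /=.
set A := 2 * s * cos x - k%:~R * x + c.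
have -> : 2 * s * cos x - (k%:~R - 1) * x + (c + pi / 2) = A + x + pi / 2.
  by rewrite /A; ring.
have -> : 2 * s * cos x - (k%:~R + 1) * x + (c + pi / 2) = A - x + pi / 2.
  by rewrite /A; ring.
rewrite !(cosD _ (pi / 2)) cos_pihalf sin_pihalf !sinD cosN sinN; ring.
Qed.

Definition osc_mean c k s := circle_mean (osc c k s).

Lemma osc_mean_derive c k s : is_derive s (1 : R) (osc_mean c k)
  (osc_mean (c + pi / 2) (k - 1) s + osc_mean (c + pi / 2) (k + 1) s).
Proof.
have mB : measurable (`[0, 2 * pi] : set R) by [].
have Ia : (`]s - 1, s + 1[%classic : set R) s.
  by rewrite /= in_itv /= ltrBlDr ltrDl ltr01.
have intf x : (`]s - 1, s + 1[%classic : set R) x ->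
    mu.-integrable `[0, 2 * pi] (EFin \o osc c k x).
  by move=> _; apply: circle_integrable; exact: osc_continuous.
have der x y : (`]s - 1, s + 1[%classic : set R) x -> `[0, 2 * pi]%classic y ->
    derivable ((osc c k)^~ y) x 1.
  by move=> _ _; have [] := osc_derive c k x y.
have intG : mu.-integrable `[0, 2 * pi] (EFin \o (fun=> 2 : R)).
  by apply: circle_integrable => x; exact: cst_continuous.
have dE x y : partial1of2 (osc c k) x y =
    osc (c + pi / 2) (k - 1) x y + osc (c + pi / 2) (k + 1) x y.
  by rewrite partial1of2E; have [] := osc_derive c k x y.
have bnd x y : (`]s - 1, s + 1[%classic : set R) x -> `[0, 2 * pi]%classic y ->
    `|partial1of2 (osc c k) x y| <= 2.
  move=> _ _; rewrite dE; apply: le_trans (ler_normD _ _) _.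
  have le1 (u : R) : `|cos u| <= 1 by rewrite ler_norml cos_geN1 cos_le1.
  have := le1 (2 * x * cos y - (k - 1)%:~R * y + (c + pi / 2)).
  have := le1 (2 * x * cos y - (k + 1)%:~R * y + (c + pi / 2)).
  by rewrite /osc; lra.
have G0 (y : R) : 0 <= (2 : R) by [].
have d := @derivable_under_integral R _ (measurableTypeR R) mu (osc c k) _ mB
  _ _ _ Ia intf der _ G0 intG bnd.
have e := @differentiation_under_integral R _ (measurableTypeR R) mu (osc c k) _ mB
  _ _ _ Ia intf der _ G0 intG bnd.
have h : is_derive s (1 : R) (fun s => \int[mu]_(y in `[0, 2 * pi]) osc c k s y)
    (\int[mu]_(y in `[0, 2 * pi])
      (osc (c + pi / 2) (k - 1) s y + osc (c + pi / 2) (k + 1) s y)).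
  apply: DeriveDef => //; rewrite -derive1E e.
  by apply: eq_Rintegral => y _; rewrite dE.
have := @is_deriveZ R R R _ (2 * pi)^-1 s 1 _ h.
move=> h2; apply: is_derive_eq h2 _.
by rewrite -circle_meanD //; exact: osc_continuous.
Qed.


End CircleMean.

Section FourierCoefficients.
Variable R : realType.
Local Notation C := R[i].
Implicit Types (k : int) (s t c : R) (n m : nat).

Lemma sin_periodic_int k (x : R) : sin (x - k%:~R * (2 * pi)) = sin x.
Proof.
have p n (y : R) : sin (y + (pi *+ 2) *+ n) = sin y by exact: periodicn (@sinD2pi R) n y.
have e n : n%:R * (2 * pi) = (pi *+ 2) *+ n :> R by rewrite mulr_natl mulr_natl.
case: k => n; first by rewrite -pmulrn e -[LHS](p n) subrK.
by rewrite NegzE mulrNz mulNr opprK -pmulrn e p.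
Qed.

(** Integration by parts: the mean of the derivative of [sin (phase)] vanishes. *)
Lemma osc_mean_rec c k s : k%:~R * osc_mean c k s =
  s * (osc_mean (c + pi / 2) (k - 1) s - osc_mean (c + pi / 2) (k + 1) s).
Proof.
set c' := c + pi / 2.
have co := fun c0 k0 => @osc_continuous R c0 k0 s.
pose f x : R := s * (osc c' (k - 1) s x - osc c' (k + 1) s x) - k%:~R * osc c k s x.
have fE : f = fun x => (s * osc c' (k - 1) s x + (- s) * osc c' (k + 1) s x)
    + (- k%:~R) * osc c k s x.
  by apply/funext => x; rewrite /f; ring.
have cc a c0 k0 : continuous (fun x => a * osc c0 k0 s x).
  move=> x; apply: (@cvgM R R (nbhs x) _ (fun=> a) (osc c0 k0 s)).
    exact: cst_continuous.
  exact: co.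
have cc2 : continuous (fun x => s * osc c' (k - 1) s x + (- s) * osc c' (k + 1) s x).
  move=> x; apply: (@cvgD R R _ (nbhs x) _ (fun x => s * osc c' (k - 1) s x)
    (fun x => (- s) * osc c' (k + 1) s x)); exact: cc.
have cf : continuous f.
  rewrite fE => x; apply: (@cvgD R R _ (nbhs x) _
    (fun x => s * osc c' (k - 1) s x + (- s) * osc c' (k + 1) s x)
    (fun x => - k%:~R * osc c k s x)); [exact: cc2 | exact: cc].
have dF x : is_derive x (1 : R)
    (fun x => sin (2 * s * cos x - k%:~R * x + c)) (f x).
  have h1 := @is_deriveZ R R R cos (2 * s) x 1 _ (is_derive_cos x).
  have h2 := @is_deriveZ R R R id k%:~R x 1 _ (is_derive_id x 1).
  have h3 := @is_deriveB R R R _ _ x 1 _ _ h1 h2.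
  have h4 := @is_deriveD R R R _ _ x 1 _ _ h3 (is_derive_cst c x 1).
  have h := is_derive1_comp (is_derive_sin _) h4.
  apply: is_derive_eq h _; rewrite /GRing.scale /= /f /osc rmorphB rmorphD /=.
  set A := 2 * s * cos x - k%:~R * x + c.
  have -> : 2 * s * cos x - (k%:~R - 1) * x + c' = A + x + pi / 2.
    by rewrite /A /c'; ring.
  have -> : 2 * s * cos x - (k%:~R + 1) * x + c' = A - x + pi / 2.
    by rewrite /A /c'; ring.
  rewrite -[X in cos X * (_ + 0)]/A.
  rewrite !(cosD _ (pi / 2)) cos_pihalf sin_pihalf (sinD A x) (sinD A (- x)) cosN sinN.
  ring.
have : circle_mean f = 0.
  apply: circle_mean_derive dF cf _.
  have e : 2 * pi = pi *+ 2 :> R by rewrite mulr_natl.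
  have -> : 2 * s * cos (2 * pi) - k%:~R * (2 * pi) + c
      = (2 * s * cos (2 * pi) + c) - k%:~R * (2 * pi) by ring.
  by rewrite sin_periodic_int e cos2pi cos0 mulr0 subr0.
rewrite fE circle_meanD // circle_meanD // !circle_meanZ //.
by rewrite -!/(osc_mean _ _ _) => E; lra.
Qed.

(** [fourier k t] is the [k]-th Fourier coefficient of [exp (it (z + 1/z))],
    that is [i^k J_k(2t)]. *)
Definition fourier k t : C := osc_mean 0 k t +i* osc_mean (- (pi / 2)) k t.

Let osc_mean_pihalf k t : osc_mean (0 + pi / 2) k t = - osc_mean (- (pi / 2)) k t.
Proof.
have -> : - osc_mean (- (pi / 2)) k t = circle_mean (fun x => -1 * osc (- (pi / 2)) k t x).
  by rewrite circle_meanZ ?mulN1r //; exact: osc_continuous.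
congr circle_mean; apply/funext => x; rewrite /osc add0r.
by rewrite !cosD cosN sinN cos_pihalf sin_pihalf; ring.
Qed.

Lemma fourier_curve T k :
  ccurve T (fourier k) (fun s => 'i * (fourier (k - 1) s + fourier (k + 1) s)).
Proof.
split.
  have := @osc_mean_derive R 0 k => h.
  apply: curve_ext (curve_everywhere T h) => s _.
  by rewrite !osc_mean_pihalf /=; ring.
have := @osc_mean_derive R (- (pi / 2)) k => h.
apply: curve_ext (curve_everywhere T h) => s _.
by rewrite addNr /=; ring.
Qed.

Lemma fourier_rec k t :
  k%:~R * fourier k t = 'i * t%:C * (fourier (k - 1) t - fourier (k + 1) t).
Proof.
have -> : (k%:~R : C) = (k%:~R : R)%:C by rewrite rmorph_int.
apply: eq_ReIm; rewrite ?ReM ?ImM /=.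
  by have := osc_mean_rec 0 k t; rewrite !osc_mean_pihalf; lra.
by have := osc_mean_rec (- (pi / 2)) k t; rewrite addNr; lra.
Qed.

Lemma fourier_le1 k t : normc (fourier k t) <= 1.
Proof.
set w := fourier k t; set a := complex.Re w; set b := complex.Im w.
have co := fun c0 => @osc_continuous R c0 k t.
have cc a0 c0 : continuous (fun x => a0 * osc c0 k t x).
  move=> x; apply: (@cvgM R R (nbhs x) _ (fun=> a0) (osc c0 k t)).
    exact: cst_continuous.
  exact: co.
have E : normc w ^+ 2 =
    circle_mean (fun x => a * osc 0 k t x + b * osc (- (pi / 2)) k t x).
  by rewrite circle_meanD // !circle_meanZ // sqr_normcE !expr2.
have h : normc w ^+ 2 <= normc w.
  rewrite {1}E -[leRHS](circle_mean_cst (normc w)).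
  apply: circle_mean_le => [x|x|x].
  - apply: (@cvgD R R _ (nbhs x) _ (fun x => a * osc 0 k t x)
      (fun x => b * osc (- (pi / 2)) k t x)); exact: cc.
  - exact: cst_continuous.
  rewrite /osc addr0; set A := 2 * t * cos x - k%:~R * x.
  have -> : a * cos A + b * cos (A - pi / 2) = complex.Re (w^* * cis A).
    have -> : complex.Re (w^* * cis A) = a * cos A + b * sin A.
      rewrite ReM Re_conj Im_conj -/a -/b.
      by rewrite -[complex.Re (cis A)]/(cos A) -[complex.Im (cis A)]/(sin A); ring.
    by rewrite (cosB A) cos_pihalf sin_pihalf; ring.
  apply: le_trans (Re_le_normc _) _.
  by rewrite normcM normc_cis mulr1 normc_conj.
have [w0|w0] := eqVneq (normc w) 0; first by rewrite w0.
have wp : 0 < normc w by rewrite lt_neqAle eq_sym w0 normc_ge0.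
by rewrite -(ler_pM2l wp) mulr1 -expr2.
Qed.

Lemma fourier_at0 k : fourier k 0 = (k == 0)%:R.
Proof.
have [->|k0] := eqVneq k 0.
  have o c : osc c 0 0 = fun=> cos c :> R.
    by apply/funext => x; rewrite /osc mulr0 mul0r mul0r subr0 add0r.
  rewrite /fourier /osc_mean !o !circle_mean_cst cos0 cosN cos_pihalf.
  by [].
have := fourier_rec k 0; rewrite mulr0 mul0r => /eqP.
by rewrite mulf_eq0 intr_eq0 (negPf k0) => /eqP.
Qed.

Lemma curve_pow T n : curve T (fun s : R => s ^+ n.+1) (fun s => n.+1%:R * s ^+ n).
Proof.
elim: n => [|n IH].
  by apply: curve_ext (curve_id T) => s _; rewrite mul1r expr0.
have h := curveM (curve_id T) IH.
have E (s : R) : s * s ^+ n.+1 = s ^+ n.+2 by rewrite -exprS.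
rewrite -(funext E); apply: curve_ext h => s _.
rewrite mul1r mulrCA -exprS -[n.+2%:R]natr1; ring.
Qed.

Lemma ccurve_real T (f f' : R -> R) : curve T f f' ->
  ccurve T (fun s => (f s)%:C) (fun s => (f' s)%:C).
Proof. by move=> h; split=> //=; exact: curve_cst. Qed.

(** With [c_k = i^k J_k(2t)] one has [(t^k J_k(2t))' = 2 t^k J_{k-1}(2t)], so the
    bound propagates from [|J_0| <= 1] by induction on [|k|]; the sign [e] treats
    positive and negative [k] at once. *)
Lemma fourier_bound (e : int) m t : (e == 1) || (e == -1) -> 0 <= t ->
  normc (fourier (e * m%:Z) t) <= t ^+ m / m`!%:R.
Proof.
move=> he; elim: m t => [|m IH] t t0.
  by rewrite mulr0 expr0 divr1 fourier_le1.
have [->|tn] := eqVneq t 0.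
  rewrite fourier_at0 expr0n mul0r mulf_eq0 orbF.
  by case/orP: he => /eqP->; rewrite normc0.
have tp : 0 < t by rewrite lt_neqAle eq_sym tn.
set k := e * m.+1%:Z.
have ke : k - e = e * m%:Z by rewrite /k intS; ring.
have cP := ccurveM (ccurve_real (curve_pow t m)) (fourier_curve t k).
have cg := curveZ (m.+1`!%:R^-1) (curve_pow t (m.*2.+1)).
have F0 : (m`!%:R : R) != 0 by rewrite gt_eqF // factR_gt0.
have m0 : (m.+1%:R : R) != 0 by rewrite pnatr_eq0.
have := ccurve_bound t0 cP cg.
rewrite expr0n mul0r normc0 expr0n mulr0 lexx => /(_ isT) H.
have {}H : normc ((t ^+ m.+1)%:C * fourier k t) <= m.+1`!%:R^-1 * t ^+ m.*2.+2.
  apply: H => s /andP[s0 st].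
  have rec := fourier_rec k s.
  have -> : (m.+1%:R * s ^+ m)%:C * fourier k s
      + (s ^+ m.+1)%:C * ('i * (fourier (k - 1) s + fourier (k + 1) s))
      = 2 * 'i * (s ^+ m.+1)%:C * fourier (e * m%:Z) s.
    have rec' : (m.+1%:R : C) * fourier k s =
        e%:~R * ('i * s%:C * (fourier (k - 1) s - fourier (k + 1) s)).
      rewrite -rec mulrA -intrM; congr (_ * _); rewrite pmulrn; congr (_%:~R).
      by rewrite /k mulrA; case/orP: he => /eqP->; rewrite ?mulr1 ?mulrNN ?mul1r.
    rewrite rmorphM rmorph_nat !rmorphXn /= mulrAC rec' exprS.
    by rewrite -ke; case/orP: he => /eqP->; rewrite ?opprK; ring.
  rewrite !normcM normc_i mulr1.
  have -> : normc (2 : C) = 2.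
    by have := normc_real (2 : R); rewrite rmorph_nat ger0_norm.
  rewrite normc_real ger0_norm ?exprn_ge0 ?(ltW s0) //.
  have h1 := IH s (ltW s0).
  have s1 : 0 <= s ^+ m.+1 by rewrite exprn_ge0 // ltW.
  apply: (@le_trans _ _ (2 * s ^+ m.+1 * (s ^+ m / m`!%:R))).
    by rewrite ler_wpM2l // mulr_ge0.
  rewrite factS natrM invfM.
  have -> : s ^+ m.*2.+1 = s ^+ m.+1 * s ^+ m.
    by rewrite -exprD addSn addnn.
  have -> : m.*2.+2%:R = 2 * m.+1%:R :> R by rewrite -doubleS -muln2 natrM mulrC.
  rewrite le_eqVlt; apply/orP; left; apply/eqP.
  move: (m.+1%:R : R) (m`!%:R : R) m0 F0 => M F M0 F0.
  by field; rewrite F0 M0.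
move: H; rewrite normcM normc_real ger0_norm ?exprn_ge0 //.
have -> : t ^+ m.*2.+2 = t ^+ m.+1 * t ^+ m.+1 by rewrite -exprD -addnn addSn addnS.
by rewrite mulrCA ler_pM2l ?exprn_gt0 // mulrC.
Qed.

End FourierCoefficients.

(** * The polynomial symbol [G_{n,t}] on the circle *)

Section Symbol.
Variable R : realType.
Local Notation C := R[i].
Variable z : C.
Hypothesis z1 : normc z = 1.
Implicit Types (s t : R) (n m : nat).

Let w : R := 2 * complex.Re z.

Definition fourier_sum n s : C :=
  \sum_(m < n.*2.+1) fourier (m%:Z - n%:Z) s * z ^+ m.

Lemma ccurve_sum T (N : nat) (f f' : nat -> R -> C) :
  (forall m, ccurve T (f m) (f' m)) ->
  ccurve T (fun s => \sum_(m < N) f m s) (fun s => \sum_(m < N) f' m s).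
Proof.
move=> h; elim: N => [|N IH].
  have -> : (fun s => \sum_(m < 0) f m s) = fun=> 0.
    by apply/funext => s; rewrite big_ord0.
  by apply: ccurve_ext (ccurve_cst T 0) => s _; rewrite big_ord0.
have E s : \sum_(m < N) f m s + f N s = \sum_(m < N.+1) f m s.
  by rewrite big_ord_recr.
apply: (ccurve_eq E); apply: ccurve_ext (ccurveD IH (h N)) => s _.
by rewrite big_ord_recr.
Qed.

Lemma sum_shift (a : nat -> C) N :
  \sum_(m < N) (a m + a m.+2) * z ^+ m =
  (z + z^-1) * \sum_(m < N) a m.+1 * z ^+ m
  + (a 0%N - a N * z ^+ N - z^-1 * a 1%N + z^-1 * a N.+1 * z ^+ N).
Proof.
have zu : z != 0 by rewrite -normc_gt0 z1.
elim: N => [|N IH]; first by rewrite !big_ord0 expr0; ring.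
by rewrite !big_ord_recr /= IH exprS; field.
Qed.

(** The truncation [S] satisfies [S' = i (z + 1/z) S] up to four coefficients at
    the ends, and their bounds can be integrated; the tail of the series is never
    summed. *)
Lemma fourier_sum_approx n t : 0 <= t ->
  normc (fourier_sum n t - z ^+ n * cis (w * t)) <=
    2 * (t ^+ n.+1 / n.+1`!%:R + t ^+ n.+2 / n.+2`!%:R).
Proof.
move=> t0; have zu : z != 0 by rewrite -normc_gt0 z1.
pose a s m := fourier (m%:Z - n%:Z - 1) s.
have aS s m : a s m.+1 = fourier (m%:Z - n%:Z) s.
  by rewrite /a intS; congr (fourier _ s); ring.
have aSS s m : a s m.+2 = fourier (m%:Z - n%:Z + 1) s.
  by rewrite aS intS; congr (fourier _ s); ring.
have cS : ccurve t (fourier_sum n) (fun s =>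
    'i * ((z + z^-1) * fourier_sum n s +
      (a s 0%N - a s n.*2.+1 * z ^+ n.*2.+1 - z^-1 * a s 1%N
       + z^-1 * a s n.*2.+2 * z ^+ n.*2.+1))).
  have h m : ccurve t (fun s => fourier (m%:Z - n%:Z) s * z ^+ m)
      (fun s => 'i * (a s m + a s m.+2) * z ^+ m).
    apply: ccurve_ext (ccurveM (fourier_curve t _) (ccurve_cst t (z ^+ m))) => s _.
    by rewrite mulr0 addr0 aSS.
  apply: ccurve_ext (ccurve_sum n.*2.+1 h) => s _.
  have -> : fourier_sum n s = \sum_(m < n.*2.+1) a s m.+1 * z ^+ m.
    by apply: eq_bigr => m _; rewrite aS.
  by rewrite -sum_shift mulr_sumr; apply: eq_bigr => m _; rewrite mulrA.
have cphi := ccurveM (ccurve_cis t (- w)) cS.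
have cg := curveZ 2 (curveD (curve_monomial t n) (curve_monomial t n.+1)).
have wE : w%:C = z + z^-1 by rewrite circle_sum_real.
have := ccurve_mvt t0 cphi cg.
rewrite !expr0n !mul0r addr0 mulr0 subr0 mulr0 cis0 mul1r => H.
have S0 : fourier_sum n 0 = z ^+ n.
  rewrite /fourier_sum (bigD1 (inord n)) //= inordK ?ltnS -?addnn ?leq_addr //.
  rewrite subrr fourier_at0 eqxx mul1r big1 ?addr0 // => m mn.
  rewrite fourier_at0 subr_eq0 (_ : (m%:Z == n%:Z) = false) ?mul0r //.
  apply: contraNF mn => /eqP[mE]; apply/eqP/val_inj.
  by rewrite /= inordK ?ltnS -?addnn ?leq_addr.
have -> : fourier_sum n t - z ^+ n * cis (w * t)
    = cis (w * t) * (cis (- w * t) * fourier_sum n t - fourier_sum n 0).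
  rewrite S0 mulrBr mulrA -cisD mulNr subrr cis0 mul1r; ring.
rewrite normcM normc_cis mul1r; apply: H => s /andP[s0 st].
have -> : 'i * (- w)%:C * cis (- w * s) * fourier_sum n s + cis (- w * s) *
    ('i * ((z + z^-1) * fourier_sum n s +
      (a s 0%N - a s n.*2.+1 * z ^+ n.*2.+1 - z^-1 * a s 1%N
       + z^-1 * a s n.*2.+2 * z ^+ n.*2.+1)))
    = cis (- w * s) * 'i * (a s 0%N - a s n.*2.+1 * z ^+ n.*2.+1 - z^-1 * a s 1%N
       + z^-1 * a s n.*2.+2 * z ^+ n.*2.+1).
  by rewrite rmorphN /= wE; ring.
rewrite 2!normcM normc_cis normc_i !mul1r.
have nzi : normc z^-1 = 1 by rewrite normcV z1 invr1.
have nzn m : normc (z ^+ m) = 1 by rewrite normcX z1 expr1n.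
have b m (e : int) : (e == 1) || (e == -1) -> normc (fourier (e * m%:Z) s) <= s ^+ m / m`!%:R.
  by move=> he; apply: fourier_bound => //; exact: ltW.
have h0 : normc (a s 0%N) <= s ^+ n.+1 / n.+1`!%:R.
  by rewrite (_ : a s 0%N = fourier (-1 * n.+1%:Z) s) ?b // /a intS; congr (fourier _ s); ring.
have h1 : normc (a s 1%N) <= s ^+ n / n`!%:R.
  by rewrite (_ : a s 1%N = fourier (-1 * n%:Z) s) ?b // aS; congr (fourier _ s); ring.
have h2 : normc (a s n.*2.+1) <= s ^+ n / n`!%:R.
  by rewrite (_ : a s n.*2.+1 = fourier (1 * n%:Z) s) ?b // aS; congr (fourier _ s); lia.
have h3 : normc (a s n.*2.+2) <= s ^+ n.+1 / n.+1`!%:R.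
  by rewrite (_ : a s n.*2.+2 = fourier (1 * n.+1%:Z) s) ?b // aSS; congr (fourier _ s); lia.
apply: le_trans (normcD _ _) _; rewrite 2!normcM nzi nzn mul1r mulr1.
apply: le_trans (lerD (normcB _ _) (lexx _)) _; rewrite normcM nzi mul1r.
apply: le_trans (lerD (lerD (normcB _ _) (lexx _)) (lexx _)) _.
rewrite normcM nzn mulr1; lra.
Qed.

Lemma fourier_tail_delta n t : (0 < n)%N -> 0 <= t ->
  2 * (t ^+ n.+1 / n.+1`!%:R + t ^+ n.+2 / n.+2`!%:R) <= delta n t.
Proof.
move=> n0 t0; rewrite /delta !factS !natrM !exprS.
have F0 : 0 < n`!%:R :> R by exact: factR_gt0.
have tn : 0 <= t ^+ n / n`!%:R by rewrite divr_ge0 ?exprn_ge0 // ltW.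
have n1 : 2 <= n.+1%:R :> R by rewrite ler_nat.
have n2 : 3 <= n.+2%:R :> R by rewrite ler_nat.
have e2 : 1 + t + t ^+ 2 / 2 <= expR t.
  have := @exp_tail_ge0 R 3 t t0.
  rewrite /exp_tail !big_ord_recr big_ord0 /= expr0 expr1 add0r subr_ge0.
  by rewrite (_ : 2`! = 2)%N // !divr1.
have i1 : n.+1%:R^-1 <= 1 / 2 :> R.
  by rewrite div1r lef_pV2 ?posrE // (lt_le_trans _ n1).
have i2 : n.+2%:R^-1 <= 1 / 3 :> R.
  by rewrite div1r lef_pV2 ?posrE // (lt_le_trans _ n2).
have p1 : 0 <= n.+1%:R^-1 :> R by rewrite invr_ge0.
have p2 : 0 <= n.+2%:R^-1 :> R by rewrite invr_ge0.
have -> : 2 * (t * t ^+ n / (n.+1%:R * n`!%:R)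
      + t * (t * t ^+ n) / (n.+2%:R * (n.+1%:R * n`!%:R)))
    = t ^+ n / n`!%:R * (2 * t * n.+1%:R^-1 + 2 * t ^+ 2 * (n.+1%:R^-1 * n.+2%:R^-1)).
  rewrite !invfM; ring.
have -> : t ^+ n * expR t / n`!%:R = t ^+ n / n`!%:R * expR t by ring.
rewrite ler_wpM2l // (le_trans _ e2) //.
have : n.+1%:R^-1 * n.+2%:R^-1 <= 1 / 2 * (1 / 3) :> R by rewrite ler_pM.
have : 0 <= t ^+ 2 by rewrite sqr_ge0.
move: (n.+1%:R^-1 : R) (n.+2%:R^-1 : R) i1 p1 p2 => u v i1 p1 p2 t2 uv.
have := ler_wpM2l t0 i1; have := ler_wpM2l t2 uv; lra.
Qed.

Lemma cexp_imag (x : R) : cexp (x *i) = cis x :> C.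
Proof.
rewrite /cexp -[complex.Re _]/(0 : R) -[complex.Im _]/x expR0.
exact: mul1r.
Qed.

Lemma GpolyE n t : (Gpoly n t).[z] = (1 - delta n t)%:C * fourier_sum n t.
Proof.
rewrite /Gpoly hornerZ horner_poly; congr (_ * _); apply: eq_bigr => m _.
congr (_ * _); rewrite /besselJ mulrA -expfzDr; last first.
  by rewrite -normc_gt0 normc_i.
rewrite subrr expr0z mul1r /circle_integral /fourier /osc_mean /circle_mean.
set k := m%:Z - n%:Z.
have E x : cexp ('i * ((2 * t) / 2)%:C * (cexp (x *i) + (cexp (x *i))^-1)) *
    (cexp (x *i))^* ^ k = cis (2 * t * cos x - k%:~R * x).
  have cx := cexp_imag x.
  have ci : (cis x)^-1 = (cis x)^* by rewrite conjc_inv_unit // normc_cis.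
  have cJ : (cis x)^* = cis (- x) by rewrite /cis cosN sinN.
  rewrite cx ci cisD cJ; congr (_ * _).
    have -> : 'i * (2 * t / 2)%:C * (cis x + cis (- x)) = 0 +i* (2 * t * cos x).
      by apply: eq_ReIm; rewrite ?ReM ?ImM ?ReD ?ImD /= ?cosN ?sinN; field.
    exact: cexp_imag.
  have pw (y : R) (p : nat) : cis y ^+ p = cis (p%:R * y).
    elim: p => [|p IH]; first by rewrite mul0r cis0 expr0.
    by rewrite exprS IH -cisD -natr1; congr cis; ring.
  case: k => p; first by rewrite -exprnP pw -pmulrn mulrN.
  rewrite NegzE -exprnN -exprVn mulrNz -pmulrn.
  have -> : (cis (- x))^-1 = cis x.
    by rewrite -cJ -ci invrK.
  by rewrite pw mulNr opprK.
congr (_ +i* _); congr (_ * _); apply: eq_Rintegral => x _; rewrite E /osc.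
  by rewrite addr0.
by rewrite /= cosB cos_pihalf sin_pihalf mulr0 add0r mulr1.
Qed.

End Symbol.

(** * A lower bound for the factorial *)

Section Stirling.
Variable R : realType.
Implicit Types (u x : R) (n : nat).

Lemma le_sinh u : 0 <= u -> u <= (expR u - expR (- u)) / 2.
Proof.
move=> u0.
have c := curveB (curveZ (1 / 2) (curveB (curve_exp u) (curve_expR u (-1)))) (curve_id u).
have := curve_homo u0 c; rewrite mulr0 expR0 mulN1r => H.
have : 0 <= 1 / 2 * (expR u - expR (- u)) - u.
  apply: le_trans (H _); first by lra.
  move=> s _; rewrite mulN1r mulN1r opprK.
  have e : expR s * expR (- s) = 1 by rewrite expRN divff // gt_eqF // expR_gt0.
  have E : expR (- s) * (expR s - 1) ^+ 2 = expR s - 2 + expR (- s).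
    transitivity (expR s * expR (- s) * expR s - 2 * (expR s * expR (- s)) + expR (- s)).
      by ring.
    by rewrite e; ring.
  have : 0 <= expR (- s) * (expR s - 1) ^+ 2 by rewrite mulr_ge0 ?sqr_ge0 ?expR_ge0.
  rewrite E; lra.
lra.
Qed.

(** With [1 + x = e^u] this is [u <= sinh u]. *)
Lemma add1_le_exp x : 0 <= x -> 1 + x <= expR (x * (2 + x) / (2 * (1 + x))).
Proof.
move=> x0; have x1 : 0 < 1 + x by rewrite ltr_wpDr.
rewrite -[leLHS](lnK x1) ler_expR.
have l0 : 0 <= ln (1 + x) by rewrite ln_ge0 // lerDl.
apply: le_trans (le_sinh l0) _; rewrite expRN lnK //.
rewrite le_eqVlt; apply/orP; left; apply/eqP; field.
by rewrite gt_eqF.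
Qed.

(** Half of Stirling's formula: the logarithmic increments of
    [n! e^n / n^(n + 1/2)] are at least [- 1 / (4 n (n + 1))], a telescoping
    bound. Squares keep everything in terms of integer powers. *)
Lemma stirling_lower n :
  n.+1%:R ^+ (n.*2.+3) * expR (3 / 2 + 1 / (2 * n.+1%:R)) <=
    (n.+1`!%:R) ^+ 2 * expR (2 * n.+1%:R) :> R.
Proof.
elim: n => [|n IH].
  by rewrite (_ : 1`! = 1)%N // !expr1n !mul1r ler_expR; lra.
set a : R := n.+1%:R in IH *; have a0 : 0 < a by rewrite ltr0n.
have aS : n.+2%:R = a + 1 :> R by rewrite /a -natr1.
rewrite factS natrM aS exprMn.
set F := n.+1`!%:R ^+ 2 in IH *.
have i0 : 0 <= a^-1 by rewrite invr_ge0 ltW.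
have h := add1_le_exp i0.
have e1 : a^-1 * (2 + a^-1) / (2 * (1 + a^-1)) = (2 * a + 1) / (2 * a * (a + 1)).
  by field; rewrite !gt_eqF // addr_gt0.
have h2 : (1 + a^-1) ^+ n.*2.+3 <= expR (2 + 1 / (2 * a * (a + 1))).
  apply: le_trans (lerXn2r _ _ _ h) _; rewrite ?nnegrE ?expR_ge0 ?addr_ge0 //.
  rewrite -expRM_natl e1 ler_expR -muln2 -addn3 natrD natrM.
  have -> : n%:R = a - 1 :> R by rewrite /a -natr1 addrK.
  rewrite le_eqVlt; apply/orP; left; apply/eqP; field.
  by rewrite !gt_eqF // addr_gt0.
have p0 : 0 <= a ^+ n.*2.+3 by rewrite exprn_ge0 // ltW.
have h3 : (a + 1) ^+ n.*2.+3 <= a ^+ n.*2.+3 * expR (2 + 1 / (2 * a * (a + 1))).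
  have E : a + 1 = a * (1 + a^-1) by field; rewrite gt_eqF.
  by rewrite {1}E exprMn ler_wpM2l.
have s0 : 0 <= (a + 1) ^+ 2 by rewrite sqr_ge0.
have -> : (a + 1) ^+ (n.+1).*2.+3 = (a + 1) ^+ 2 * (a + 1) ^+ n.*2.+3.
  by rewrite -exprD doubleS.
rewrite -(mulrA ((a + 1) ^+ 2)) -(mulrA ((a + 1) ^+ 2)) ler_wpM2l //.
apply: le_trans (ler_wpM2r (expR_ge0 _) h3) _.
rewrite -(mulrA (a ^+ n.*2.+3)) -expRD.
have -> : 2 + 1 / (2 * a * (a + 1)) + (3 / 2 + 1 / (2 * (a + 1)))
    = (3 / 2 + 1 / (2 * a)) + 2.
  by field; rewrite !gt_eqF // addr_gt0.
have -> : 2 * (a + 1) = 2 * a + 2 by ring.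
rewrite (expRD (3 / 2 + 1 / (2 * a)) 2) (expRD (2 * a) 2).
by rewrite (mulrA (a ^+ n.*2.+3)) (mulrA F) ler_wpM2r ?expR_ge0.
Qed.

(** The constant [17/2] leaves room below [12] because
    [sqrt (2 pi) * 17/2 < 12 e^(3/4)] already follows from [pi < 4]. *)
Lemma power_fact_le (t : R) n : 0 < t -> (0 < n)%N ->
  17 / 2 * (t ^+ n / n`!%:R) <=
    12 / Num.sqrt (2 * pi * n%:R) * (expR 1 * t / n%:R) ^+ n.
Proof.
move=> t0; case: n => [//|n] _.
set a : R := n.+1%:R; have a0 : 0 < a by rewrite ltr0n.
set F : R := n.+1`!%:R; have F0 : 0 < F by exact: factR_gt0.
have p0 : 0 < 2 * pi * a :> R by rewrite !mulr_gt0 // pi_gt0.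
have q0 : 0 < Num.sqrt (2 * pi * a) by rewrite sqrtr_gt0.
have tn : 0 < t ^+ n.+1 by rewrite exprn_gt0.
have an : 0 < a ^+ n.+1 by rewrite exprn_gt0.
suff key : 17 / 2 * (Num.sqrt (2 * pi * a) * a ^+ n.+1) <= 12 * (F * expR a).
  have -> : (expR 1 * t / a) ^+ n.+1 = expR a * t ^+ n.+1 / a ^+ n.+1.
    by rewrite !exprMn exprVn -expRM_natl mulr1.
  have -> : 12 / Num.sqrt (2 * pi * a) * (expR a * t ^+ n.+1 / a ^+ n.+1)
      = 12 * expR a * t ^+ n.+1 / (Num.sqrt (2 * pi * a) * a ^+ n.+1).
    by field; rewrite !gt_eqF.
  rewrite ler_pdivlMr ?mulr_gt0 //.
  have -> : 17 / 2 * (t ^+ n.+1 / F) * (Num.sqrt (2 * pi * a) * a ^+ n.+1)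
      = 17 / 2 * (Num.sqrt (2 * pi * a) * a ^+ n.+1) * t ^+ n.+1 / F by ring.
  rewrite ler_pdivrMr //.
  have := ler_wpM2r (ltW tn) key; lra.
apply: le_of_sqr; rewrite ?mulr_ge0 ?divr_ge0 ?expR_ge0 ?(ltW q0) ?(ltW an) ?(ltW F0) //.
have sql (x y : R) : (17 / 2 * (x * y)) ^+ 2 = 289 / 4 * (x ^+ 2 * y ^+ 2) by field.
have sqr (x y : R) : (12 * (x * y)) ^+ 2 = 144 * (x ^+ 2 * y ^+ 2) by ring.
rewrite sql sqr.
rewrite sqr_sqrtr ?(ltW p0) // -expRM_natl.
have st := stirling_lower n; rewrite -/a -/F in st.
have pi4 : pi <= 4 :> R by have := @pihalf_lt2 R; lra.
have e3 : 41 / 10 <= expR (3 / 2 + 1 / (2 * a)) :> R.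
  have h : 9 / 8 <= expR (1 / 8) :> R by have := expR_ge1Dx (1 / 8 : R); lra.
  have h12 : (9 / 8) ^+ 12 <= expR (3 / 2) :> R.
    have -> : 3 / 2 = 12%:R * (1 / 8) :> R by field.
    by rewrite expRM_natl lerXn2r // ?nnegrE ?expR_ge0 ?divr_ge0.
  apply: le_trans (_ : 41 / 10 <= expR (3 / 2)) _.
    by apply: le_trans h12; rewrite !exprS expr0; lra.
  by rewrite ler_expR lerDl divr_ge0 // mulr_ge0 // ltW.
have w0 : 0 <= a ^+ n.*2.+3 by rewrite exprn_ge0 // ltW.
have aE : a * a ^+ n.+1 ^+ 2 = a ^+ n.*2.+3.
  by rewrite -exprM -exprS muln2 doubleS.
have st2 : a ^+ n.*2.+3 * (41 / 10) <= F ^+ 2 * expR (2 * a).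
  by apply: le_trans st; rewrite ler_wpM2l.
have -> : 289 / 4 * (2 * pi * a * a ^+ n.+1 ^+ 2)
    = (289 / 2) * (pi * (a ^+ n.*2.+3)) by rewrite -aE; field.
have : pi * a ^+ n.*2.+3 <= 4 * a ^+ n.*2.+3 by rewrite ler_wpM2r.
rewrite !expr2; rewrite expr2 in st2; lra.
Qed.

End Stirling.

(** * Comparison of the symbols and conclusion *)

Section Comparison.
Variable R : realType.
Local Notation C := R[i].
Variables (t : R) (q0 : int -> C) (l n : nat) (q : R -> int -> C).
Hypotheses (t0 : 0 < t) (hq0 : forall k : int, normc (q0 k) < 1).
Hypothesis hl : forall k : int, q0 k != 0 -> 0 <= k <= l%:Z.
Hypothesis hq : AL_solution q0 q.
Hypotheses (hn : t < n%:R) (hdelta : delta n t < 1).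

Let tau : R := t ^+ n / n`!%:R.
Let A := (layers (sample q0 0 l.+1)).2.
Let B := (layers (sample q0 0 l.+1)).1.
Let win b := window (q t) (- n%:Z) (n + (l.+1 + b)).

Let n0 : (0 < n)%N.
Proof. by rewrite -(ltr_nat R) (lt_trans t0). Qed.

Let tau0 : 0 < tau.
Proof. by rewrite divr_gt0 ?exprn_gt0 // factR_gt0. Qed.

Let deltaE : delta n t = tau * expR t.
Proof. by rewrite /delta /tau; ring. Qed.

Let den_circle s (z : C) : contractive s -> normc z = 1 -> (layers s).2.[z] != 0.
Proof.
move=> hs z1; rewrite -normc_gt0 lt_neqAle normc_ge0 andbT eq_sym.
apply: contraTneq (defect_gt0 hs) => d0.
by rewrite -(layers_defect s z1) d0 expr0n sub0r oppr_gt0 -leNgt sqr_ge0.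
Qed.

Lemma symbol_le1 (z : C) : normc z = 1 -> normc (Gpoly n t).[z] <= 1.
Proof.
move=> z1; rewrite GpolyE // normcM normc_real.
have d0 : 0 <= delta n t by rewrite deltaE mulr_ge0 ?expR_ge0 // ltW.
rewrite ger0_norm ?subr_ge0 ?(ltW hdelta) //.
have h : normc (fourier_sum z n t) <= 1 + delta n t.
  rewrite -[fourier_sum z n t](subrK (z ^+ n * cis (2 * complex.Re z * t))).
  apply: le_trans (normcD _ _) _.
  rewrite [normc (_ * cis _)]normcM normcX z1 expr1n normc_cis mulr1 addrC lerD2l.
  apply: le_trans (fourier_sum_approx z1 n (ltW t0)) _.
  exact: fourier_tail_delta n0 (ltW t0).
have d1 : 0 <= 1 - delta n t by rewrite subr_ge0 ltW.
apply: le_trans (ler_wpM2l d1 h) _; have := sqr_ge0 (delta n t); rewrite expr2; lra.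
Qed.

Lemma symbol_approx (z : C) : normc z = 1 ->
  normc ((Gpoly n t).[z] - z ^+ n * cis (2 * complex.Re z * t)) <= 2 * (tau * expR t).
Proof.
move=> z1; rewrite GpolyE // -deltaE; set S := fourier_sum _ _ _; set c := z ^+ n * _.
have d0 : 0 <= delta n t by rewrite deltaE mulr_ge0 ?expR_ge0 // ltW.
have c1 : normc c = 1 by rewrite normcM normcX z1 expr1n normc_cis mulr1.
have h : normc (S - c) <= delta n t.
  apply: le_trans (fourier_sum_approx z1 n (ltW t0)) _.
  exact: fourier_tail_delta n0 (ltW t0).
have -> : (1 - delta n t)%:C * S - c = (1 - delta n t)%:C * (S - c) - (delta n t)%:C * c.
  by rewrite rmorphB rmorph1; ring.
apply: le_trans (normcB _ _) _.
rewrite [normc (_ * (S - c))]normcM [normc (_ * c)]normcM !normc_real c1 mulr1.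
rewrite !ger0_norm ?subr_ge0 ?(ltW hdelta) //.
have d1 : 0 <= 1 - delta n t by rewrite subr_ge0 ltW.
have := ler_wpM2l d1 h; have := sqr_ge0 (delta n t); rewrite expr2; lra.
Qed.

(** On the circle the solution restricted to [[-n, oo)] has reflection
    coefficient close to [z^n exp (it (z + 1/z)) B/A]: the Lax pair is only
    perturbed at the two ends of the window, where the solution is tiny. *)
Lemma window_approx (K : nat) : exists2 b : nat, (K <= b)%N &
  forall z : C, normc z = 1 ->
    normc ((layers (win b)).1.[z] / (layers (win b)).2.[z]
      - cis (2 * complex.Re z * t) * (z ^+ n * B.[z] / A.[z])) <=
    (6 * (expR t * expR t) + 1 / 2) * tau.
Proof.
set E2 : R := expR t * expR t; have E20 : 0 < E2 by rewrite mulr_gt0 ?expR_gt0.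
have D0 : 0 < 4 * E2 * t by rewrite mulr_gt0 // mulr_gt0.
have [N hN] := @exp_fact_eps R t (tau / (4 * E2 * t)) (divr_gt0 tau0 D0).
pose b := maxn N K; exists b; first exact: leq_maxr.
move=> z z1; pose kap : R := E2 * (t ^+ b / b`!%:R).
have kapt : 2 * kap * t <= tau / 2.
  have := hN b (leq_maxl _ _); move=> /(le_trans (ler_norm _)).
  rewrite ler_pdivlMr // /kap; lra.
have kap0 : 0 <= kap.
  by rewrite mulr_ge0 ?(ltW E20) // divr_ge0 ?exprn_ge0 ?(ltW t0) // ltW // factR_gt0.
pose v m s : R := expR s * exp_tail m s.
have cv m : curve t (v m.+1) (fun s => v m.+1 s + v m s).
  exact: curveM (curve_exp t) (curve_exp_tail t m).
have cg := curveD (curveD (curveZ 2 (cv n)) (curveZ 4 (cv n.+1)))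
  (curveZ (2 * kap) (curve_id t)).
have v0 m : v m.+1 0 = 0 by rewrite /v exp_tail_at0 mulr0.
have vge m s : 0 <= s -> 0 <= v m s.
  by move=> s0; rewrite mulr_ge0 ?expR_ge0 ?exp_tail_ge0.
have vdec m s : 0 <= s -> v m.+1 s <= v m s.
  by move=> s0; rewrite ler_wpM2l ?expR_ge0 ?exp_tail_decr.
have tt : 0 <= t <= t by rewrite ltW ?lexx.
have H := @lax_ratio R q0 q t t0 hq0 hq z z1 (n + (l.+1 + b)) (- n%:Z) _ _ cg.
have q00 : q 0 = q0 by have [E _ _] := hq; apply/funext => k; exact: E.
rewrite q00 (datum_window hl) layers_nseq0 layers_cat_nseq0 /= hornerM hornerXn in H.
apply: le_trans; first apply: H => s /andP[s0 st].
  have hs : 0 <= s <= t by rewrite !ltW.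
  have hL := sol_left_tail t0 hq0 hq hl n hs.
  have hL1 := sol_left_tail t0 hq0 hq hl n.+1 hs.
  have hR := sol_right_tail t0 hq0 hq hl b hs.
  have hR1 := sol_right_tail t0 hq0 hq hl b.+1 hs.
  have hk := exp_tail_unif t0 b hs.
  have hd := vdec b s (ltW s0).
  have i1 : - n%:Z - 1 = - n.+1%:Z by rewrite intS opprD addrC.
  have i2 : - n%:Z + (n + (l.+1 + b))%N%:Z - 1 = l%:Z + b%:Z.
    exact: window_last.
  have i3 : - n%:Z + (n + (l.+1 + b))%N%:Z = l%:Z + b.+1%:Z.
    by rewrite intS addrCA -i2 addrC subrK.
  rewrite i2 i3 i1.
  have q1 := sol_lt1 hq0 hq (- n%:Z) hs.
  have p1 := normc_ge0 (q s (- n%:Z)); have p2 := normc_ge0 (q s (- n.+1%:Z)).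
  have hp : normc (q s (- n.+1%:Z)) * normc (q s (- n%:Z)) <= normc (q s (- n.+1%:Z)).
    by rewrite ler_piMr // ltW.
  rewrite -/(v _ _) in hL; rewrite -/(v _ _) in hL1.
  rewrite -/(v _ _) in hR; rewrite -/(v _ _) in hR1.
  have hkap : v b s <= kap by exact: hk.
  have w1 := vge n.+1 s (ltW s0); have w2 := vge n.+2 s (ltW s0).
  rewrite mulr1; lra.
rewrite !v0 !mulr0 !addr0 subr0.
have vt : v n.+1 t <= E2 * tau.
  rewrite /v /E2 -mulrA ler_wpM2l ?expR_ge0 //.
  apply: le_trans (exp_tail_le _ (ltW t0)) _; rewrite ler_wpM2l ?expR_ge0 //.
  have -> : t ^+ n.+1 / n.+1`!%:R = t / n.+1%:R * tau.
    by rewrite factS natrM invfM exprS /tau; ring.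
  rewrite ler_piMl ?(ltW tau0) // ler_pdivrMr ?ltr0n // mul1r ltW // (lt_trans hn) //.
  by rewrite ltr_nat.
have := vdec n.+1 t (ltW t0); lra.
Qed.

Lemma symbol_window (K : nat) : exists2 b : nat, (K <= b)%N &
  dominated (17 / 2 * (expR (2 * t) * tau))
    ((Gpoly n t * B) * (layers (win b)).2 - (layers (win b)).1 * A)
    (A * (layers (win b)).2).
Proof.
have [b Kb hb] := window_approx K; exists b => // z z1.
have tt : 0 <= t <= t by rewrite ltW ?lexx.
have A0 : A.[z] != 0 by exact: den_circle (sample_contractive _ _ hq0) z1.
have Q0 : (layers (win b)).2.[z] != 0.
  by apply: den_circle => //; exact: sol_window_contractive hq0 hq _ _ _ tt.
rewrite hornerD hornerN (hornerM _ (layers (win b)).2) (hornerM (Gpoly n t) B).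
rewrite (hornerM (layers (win b)).1 A) (hornerM A).
set c := cis (2 * complex.Re z * t); set G := (Gpoly n t).[z].
set P' := (layers (win b)).1.[z] in hb *; set Q' := (layers (win b)).2.[z] in hb Q0 *.
have -> : G * B.[z] * Q' - P' * A.[z] = ((G - z ^+ n * c) * (B.[z] / A.[z])
    - (P' / Q' - c * (z ^+ n * B.[z] / A.[z]))) * (A.[z] * Q').
  by field; rewrite A0 Q0.
rewrite normcM ler_wpM2r ?normc_ge0 //; apply: le_trans (normcB _ _) _.
have BA : normc (B.[z] / A.[z]) <= 1.
  rewrite normcM normcV ler_pdivrMr ?normc_gt0 //.
  exact: (layers_dominated (sample_contractive 0 l.+1 hq0)) z1.
have h1 : normc ((G - z ^+ n * c) * (B.[z] / A.[z])) <= 2 * (tau * expR t).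
  rewrite normcM; apply: le_trans (symbol_approx z1).
  by rewrite ler_piMr ?normc_ge0.
apply: le_trans (lerD h1 (hb z z1)) _.
have -> : expR (2 * t) = expR t * expR t by rewrite -expRD; congr expR; ring.
have e1 : 1 <= expR t by have := expR_ge1Dx t; lra.
have e2 : expR t <= expR t * expR t by rewrite ler_peMr ?expR_ge0.
have -> : 17 / 2 * (expR t * expR t * tau) = (17 / 2 * (expR t * expR t)) * tau by ring.
have -> : 2 * (tau * expR t) + (6 * (expR t * expR t) + 1 / 2) * tau
    = (2 * expR t + 6 * (expR t * expR t) + 1 / 2) * tau by ring.
by rewrite ler_wpM2r ?(ltW tau0) //; lra.
Qed.

End Comparison.

Theorem theorem1p5 (R : realType) (t : R) (ht : 0 < t)
  (q0 : int -> R[i]) (hq0 : forall k : int, normc (q0 k) < 1)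
  (l : nat) (hl : forall k : int, q0 k != 0 -> 0 <= k <= l%:Z)
  (eta : R) (heta : 0 < eta)
  (hprod : eta <= \prod_(0 <= k < l.+1) (1 - normc (q0 k%:Z) ^+ 2))
  (q : R -> int -> R[i]) (hq : AL_solution q0 q)
  (n : nat) (j : int) (hnj : 0 <= n%:Z + j) (hn : t < n%:R)
  (hdelta : delta n t < 1) :
  normc (q t j - qtilde q0 l n t j) <=
    2 ^ j * stabC eta (1 / 2) *
    (12 * expR (5 * t) / Num.sqrt (2 * pi * n%:R)) *
    (2 * expR 1 * t / n%:R) ^+ n.
Proof.
have n0 : (0 < n)%N by rewrite -(ltr_nat R) (lt_trans ht).
set s := sample q0 0 l.+1; set tau : R := t ^+ n / n`!%:R.
have sC : contractive s by exact: sample_contractive.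
have tt : 0 <= t <= t by rewrite ltW ?lexx.
case nj : (n%:Z + j) hnj => [K|//] _.
have jE : j = - n%:Z + K%:Z by rewrite -nj; ring.
have [b Kb hD] := symbol_window ht hq0 hl hq hn hdelta K.
set D := 17 / 2 * _ in hD; set win := window _ _ _ in hD.
have D0 : 0 <= D.
  by rewrite /D !mulr_ge0 ?divr_ge0 ?expR_ge0 ?exprn_ge0 ?(ltW ht) ?(ltW (factR_gt0 _ _)).
have szA : szego_class eta (Gpoly n t * (layers s).1) (layers s).2.
  apply: szego_class_mul; first by move=> z z1; exact: symbol_le1.
  by apply: layers_szego => //; rewrite sample_defect.
have winC : contractive win by exact: sol_window_contractive hq0 hq _ _ _ tt.
have szW : szego_class eta (layers win).1 (layers win).2.
  apply: layers_szego => //; rewrite /win.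
  exact: (sol_defect ht hq0 hq hl heta hprod n b).
have := schur_stability heta szA szW D0 hD K.
have -> : schur_param (layers win).1 (layers win).2 K = q t j.
  by rewrite schur_param_layers // nth_window ?jE //; lia.
have <- : qtilde q0 l n t j = schur_param (Gpoly n t * (layers s).1) (layers s).2 K.
  rewrite /qtilde nj; apply: schur_iter0 heta szA _ _ _ => z.
  by rewrite scatt_fE // hornerM mulrA.
rewrite normc_distC => /le_trans; apply.
have S0 : 0 <= stabC eta (1 / 2) by exact: expR_ge0.
have two0 : (2 : R) != 0 by rewrite pnatr_eq0.
have -> : (2 : R) ^+ K = 2 ^ j * 2 ^+ n.
  by rewrite !exprnP -expfzDr // -nj addrC.
have e25 : expR (2 * t) <= expR (5 * t) by rewrite ler_expR ler_wpM2r ?(ltW ht) //; lra.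
have st := power_fact_le ht n0; rewrite -/tau in st.
have DE : D <= 12 * expR (5 * t) / Num.sqrt (2 * pi * n%:R) * (expR 1 * t / n%:R) ^+ n.
  have -> : D = 17 / 2 * tau * expR (2 * t) by rewrite /D /tau; ring.
  have -> : 12 * expR (5 * t) / Num.sqrt (2 * pi * n%:R) * (expR 1 * t / n%:R) ^+ n
    = 12 / Num.sqrt (2 * pi * n%:R) * (expR 1 * t / n%:R) ^+ n * expR (5 * t) by ring.
  have tau0 : 0 <= tau by rewrite divr_ge0 ?exprn_ge0 ?(ltW ht) ?(ltW (factR_gt0 _ _)).
  have x0 : 0 <= 17 / 2 * tau by rewrite mulr_ge0 // divr_ge0.
  by apply: (ler_pM x0 (expR_ge0 _) st e25).
have -> : 2 * expR 1 * t / n%:R = 2 * (expR 1 * t / n%:R) by ring.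
rewrite [(2 * _) ^+ n]exprMn.
have j0 : 0 <= (2 : R) ^ j by rewrite exprz_ge0.
have c0 : 0 <= 2 ^ j * stabC eta (1 / 2) * 2 ^+ n by rewrite !mulr_ge0 ?exprn_ge0.
have -> : 2 ^ j * 2 ^+ n * stabC eta (1 / 2) * D
    = 2 ^ j * stabC eta (1 / 2) * 2 ^+ n * D by ring.
apply: le_trans (ler_wpM2l c0 DE) _.
by rewrite le_eqVlt; apply/orP; left; apply/eqP; ring.
Qed.
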